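(* Let $\pi=1\pi'\in S_n$, where $\pi'$ is a dominant permutation of $\{2,\ldots,n\}$. Let $\mathcal{C}^2(\pi)$ be the simplicial complex obtained from $\mathrm{core}(\pi)$, the core of the pipe dream complex $PD(\pi)$, by coning over it twice (that is, over two new vertices successively). Then the canonical triangulation of the root polytope $\mathcal{P}(T(\pi))$ (which is a regular triangulation) is a geometric realization of $\mathcal{C}^2(\pi)$.
   Context: Permutations and diagrams. A permutation $\pi\in S_n$ is written in one-line notation $\pi_1\cdots\pi_n$. Positions in the $n\times n$ grid are (row, column), rows numbered top to bottom and columns left to right. The diagram of $\pi$ is $D(\pi)=\{(\pi_j,i): i<j,\ \pi_i>\pi_j\}$. $\pi=1\pi'$ with $\pi'$ dominant means $\pi_1=1$ and $\pi'=\pi_2\cdots\pi_n$ is a $132$-avoiding permutation of $\{2,\ldots,n\}$; equivalently $D(\pi)$ is the Young diagram of a partition whose north-west most box is at $(2,2)$. Pipe dreams. A pipe dream for $\pi$ is a tiling of the $n\times n$ grid by crosses (two strands cross straight) and elbows (one strand joins the left edge to the top edge, another joins the bottom edge to the right edge) such that all tiles at $(a,b)$ with $a+b\ge n+1$ are elbows, and if the strands entering from the left in rows $1,\ldots,n$ are labelled $1,\ldots,n$ and followed (ignoring second crossings among the same strands), they exit at the top reading $\pi_1,\ldots,\pi_n$ from left to right. It is reduced if no two strands cross twice. $PD(\pi)$ is the simplicial complex with vertices the entries $(a,b)$, $a+b\le n$, and facets the sets of elbow positions (in this triangle) of reduced pipe dreams for $\pi$. Let $\mathrm{cone}(\pi)$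 be the set of vertices lying in all facets of $PD(\pi)$; $\mathrm{core}(\pi)$ is the restriction of $PD(\pi)$ to the vertices not in $\mathrm{cone}(\pi)$. The region $R(\pi)$. The bottom reduced pipe dream of $\pi$ has crosses at the boxes obtained by pushing $D(\pi)$ left (left-justifying each row); the top reduced pipe dream has crosses at the boxes obtained by pushing $D(\pi)$ up. The core region $\mathrm{cr}(\pi)$ is the union of the cross positions of these two pipe dreams (it is the vertex set of $\mathrm{core}(\pi)$), and $R(\pi)=\mathrm{cr}(\pi)\cup\{(1,1)\}$. The tree $T(\pi)$. Traverse the southeast boundary of $R(\pi)$ from its SW corner to its NE corner as a sequence of east steps (E) and north steps (N). Let $A$ consist of all N steps together with those E steps such that E bounds the bottom reduced pipe dream (the box of $R(\pi)$ directly above E is a cross of it) but the N step directly preceding E (if the preceding step is an N step) does not bound it (the box directly left of that N step is not a cross of it). Label the steps of $A$ by $1,\ldots,m$ in the order traversed; an E step not in $A$ receives the label of the N step directly preceding it. Place a dot in each box of $R(\pi)$ that is an elbow in the bottom reduced pipe dream, then let the dots in each column drop south so that they occupy the lowest boxes of that column of $R(\pi)$. $T(\pi)$ is the tree on $[m]$ with an edge $(i,j)$, $i<j$, whenever there is a dot in the box in the column of the E step labelled $i$ and the row of the N step labelled $j$. Root polytopes. For an acyclic graph $G$ on $[m]$, with $e_i$ the standard basis of $\mathbb{R}^m$, let $\mathrm{cone}(G)$ be the cone of nonnegative combinations of $e_i-e_j$, $(i,j)\in E(G)$, $i<j$, and let $\mathcal{P}(G)$ be the convex hull of $0$ and all $e_i-e_j$,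 $1\le i<j\le m$, lying in $\mathrm{cone}(G)$. The directed transitive closure of $G$ adds every edge $(i,j)$ such that there is an increasing path $i<i_1<\cdots<i_k<j$ along edges of $G$. A graph is noncrossing if there are no $i<j<k<l$ with $(i,k),(j,l)$ both edges; it is alternating if at each vertex $v$ all edges go to larger vertices or all go to smaller vertices. For $G$ noncrossing and acyclic, the canonical triangulation of $\mathcal{P}(G)$ is the triangulation with top-dimensional simplices $\mathcal{P}(T_1),\ldots,\mathcal{P}(T_k)$, where $T_1,\ldots,T_k$ are the noncrossing alternating spanning trees of the directed transitive closure of $G$. *)

(* Defs.v *)
From mathcomp Require Import all_boot all_order all_algebra all_fingroup.
From mathcomp Require Import boolp classical_sets functions cardinality.

Set Implicit Arguments.
Unset Strict Implicit.
Unset Printing Implicit Defensive.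

Import Order.TTheory GRing.Theory Num.Theory.

(* All indices are 0-based: the permutation lives in S_N with N = n.+1, entry
   (a, b) of the N x N grid stands for (row, column) = (a + 1, b + 1), and
   pi j = i stands for pi_(j+1) = i + 1. *)

Definition box (n : nat) := ('I_n.+1 * 'I_n.+1)%type.

(* With pi ord0 = ord0 this says that pi = 1 pi' with pi' dominant, i.e.
   132-avoiding. *)
Definition dominant_tail (n : nat) (pi : 'S_n.+1) : Prop :=
  forall i j k : 'I_n.+1, 0 < i -> i < j -> j < k -> ~~ (pi i < pi k < pi j).

Definition diagram (n : nat) (pi : 'S_n.+1) : {set box n} :=
  [set p : box n | [exists i : 'I_n.+1, exists j : 'I_n.+1,
              [&& i < j, pi j < pi i & p == (pi j, i)]]].

(* The entries (a, b) with a + b <= N in 1-based coordinates. *)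
Definition triangle (n : nat) : {set box n} := [set p : box n | p.1 + p.2 < n].

(* A tiling is given by the set X of its crosses; every other tile is an elbow. *)
Definition is_cross (n : nat) (X : {set box n}) (a b : nat) : bool :=
  [exists p in X, (p.1 == a :> nat) && (p.2 == b :> nat)].

(* The state (a.+1, b, true), resp. (a.+1, b, false), of a strand means that it
   is about to enter tile (a, b) through its left, resp. bottom, edge; in state
   (0, b, false) it has left the grid through the top of column b.
   A strand leaves a tile to the right if it enters a cross from the left or an
   elbow from below, and leaves it upwards in the two other cases. *)
Definition strand_step (n : nat) (X : {set box n}) (s : nat * nat * bool) :
    nat * nat * bool :=
  let: (h, b, from_left) := s in
  if h is a.+1 then
    if is_cross X a b == from_left then (h, b.+1, true) else (a, b, false)
  else s.

Definition strand_start (n : nat) (i : 'I_n.+1) : nat * nat * bool :=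
  (i.+1, 0, true).

(* Strands only move up and right, so they have left the grid after
   2 * n.+1 steps. *)
Definition strand_exit (n : nat) (X : {set box n}) (i : 'I_n.+1) :
    nat * nat * bool :=
  iter (2 * n.+1) (strand_step X) (strand_start i).

Definition on_strand (n : nat) (X : {set box n}) (i : 'I_n.+1) (p : box n) :
    bool :=
  has (fun s => s.1 == (p.1.+1, nat_of_ord p.2))
      (traject (strand_step X) (strand_start i) (2 * n.+1)).

Definition no_double_crossing (n : nat) (X : {set box n}) : bool :=
  [forall i : 'I_n.+1, forall j : 'I_n.+1, (i < j) ==>
     (#|[set p in X | on_strand X i p && on_strand X j p]| <= 1)].

(* In a reduced pipe dream there are no second crossings to be ignored, so the
   strands are followed straight through all the crosses. *)
Definition reduced_pipe_dream (n : nat) (pi : 'S_n.+1) (X : {set box n}) :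
    bool :=
  [&& X \subset triangle n,
      [forall j : 'I_n.+1, strand_exit X (pi j) == (0, nat_of_ord j, false)]
    & no_double_crossing X].

Definition PD_facets (n : nat) (pi : 'S_n.+1) : {set {set box n}} :=
  [set triangle n :\: X | X : {set box n} & reduced_pipe_dream pi X].

Definition PD (n : nat) (pi : 'S_n.+1) : {set {set box n}} :=
  [set F : {set box n} | [exists G in PD_facets pi, F \subset G]].

Definition PD_cone (n : nat) (pi : 'S_n.+1) : {set box n} :=
  [set v in triangle n | [forall G in PD_facets pi, v \in G]].

Definition core (n : nat) (pi : 'S_n.+1) : {set {set box n}} :=
  [set F in PD pi | F \subset triangle n :\: PD_cone pi].

(* The cone over C, with apex None. *)
Definition coning (V : finType) (C : {set {set V}}) : {set {set option V}} :=
  [set Some @: F | F : {set V} in C]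
  :|: [set None |: Some @: F | F : {set V} in C].

Definition double_cone_core (n : nat) (pi : 'S_n.+1) :
    {set {set option (option (box n))}} :=
  coning (coning (core pi)).

Definition bottom_dream (n : nat) (pi : 'S_n.+1) : {set box n} :=
  [set p : box n | p.2 < #|[set q in diagram pi | q.1 == p.1]|].

Definition top_dream (n : nat) (pi : 'S_n.+1) : {set box n} :=
  [set p : box n | p.1 < #|[set q in diagram pi | q.2 == p.2]|].

Definition core_region (n : nat) (pi : 'S_n.+1) : {set box n} :=
  bottom_dream pi :|: top_dream pi.

Definition region (n : nat) (pi : 'S_n.+1) : {set box n} :=
  (ord0, ord0) |: core_region pi.

Definition south_end (n : nat) (S : {set box n}) (p : box n) : bool :=
  (p \in S) && [forall q in S, (q.2 == p.2) ==> (q.1 <= p.1)].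

Definition east_end (n : nat) (S : {set box n}) (p : box n) : bool :=
  (p \in S) && [forall q in S, (q.1 == p.1) ==> (q.2 <= p.2)].

(* A step of the southeast boundary of a Young-diagram-shaped region: inl b is
   the E step below the lowest box of column b, inr a is the N step to the right
   of the last box of row a. *)
Definition bstep (n : nat) := ('I_n.+1 + 'I_n.+1)%type.

Definition is_N (n : nat) (s : bstep n) : bool := if s is inr _ then true else false.

(* From the SW corner to the NE corner. *)
Definition boundary (n : nat) (S : {set box n}) : seq (bstep n) :=
  flatten [seq rcons [seq inl b | b <- enum 'I_n.+1 & south_end S (a, b)] (inr a)
          | a <- rev (enum 'I_n.+1) & [exists b, (a, b) \in S]].

Definition bounds_bottom (n : nat) (pi : 'S_n.+1) (s : bstep n) : bool :=
  match s with
  | inl b => [exists a, south_end (region pi) (a, b)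
                        && ((a, b) \in bottom_dream pi)]
  | inr a => [exists b, east_end (region pi) (a, b)
                        && ((a, b) \in bottom_dream pi)]
  end.

Definition bstep_at (n : nat) (pi : 'S_n.+1) (k : nat) : bstep n :=
  nth (inl ord0) (boundary (region pi)) k.

(* Membership in A of the k-th step of the boundary (k = 0 is the first one).
   The first step is an E step with no N step before it. It bounds the bottom
   pipe dream, hence is in A, unless diagram pi is empty; in that degenerate case
   it could not inherit a label, and we let it be in A as well. *)
Definition labelled (n : nat) (pi : 'S_n.+1) (k : nat) : bool :=
  let s := bstep_at pi k in
  [|| is_N s,
      k == 0
    | bounds_bottom pi s &&
      ~~ (is_N (bstep_at pi k.-1) && bounds_bottom pi (bstep_at pi k.-1))].

Definition nlabels (n : nat) (pi : 'S_n.+1) : nat :=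
  count (labelled pi) (iota 0 (size (boundary (region pi)))).

(* The 1-based label of a step: the number of steps of A up to and including it;
   for a step not in A this is the label of the step directly preceding it. *)
Definition label (n : nat) (pi : 'S_n.+1) (s : bstep n) : nat :=
  count (labelled pi) (iota 0 (index s (boundary (region pi))).+1).

(* The dots, after they have dropped to the bottom of their columns. *)
Definition dots (n : nat) (pi : 'S_n.+1) : {set box n} :=
  [set p in region pi |
     #|[set q in region pi | (q.2 == p.2) && (p.1 < q.1)]|
     < #|[set q in region pi :\: bottom_dream pi | q.2 == p.2]| ].

(* A graph is given by its set of edges (i, j), i < j; the vertex i : 'I_m stands
   for i + 1 in [m]. *)
Definition graph (m : nat) := {set 'I_m * 'I_m}.

Definition tree (n : nat) (pi : 'S_n.+1) : graph (nlabels pi) :=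
  [set e : 'I_(nlabels pi) * 'I_(nlabels pi) | (e.1 < e.2) &&
     [exists p in dots pi, (label pi (inl p.2) == e.1.+1)
                           && (label pi (inr p.1) == e.2.+1)]].

Definition adjacent (m : nat) (G : graph m) : rel 'I_m :=
  [rel i j | ((i, j) \in G) || ((j, i) \in G)].

Definition transitive_closure (m : nat) (G : graph m) : graph m :=
  [set e : 'I_m * 'I_m | (e.1 < e.2) &&
           connect [rel i j : 'I_m | (i < j) && ((i, j) \in G)] e.1 e.2].

Definition noncrossing (m : nat) (G : graph m) : Prop :=
  forall i j k l : 'I_m, i < j -> j < k -> k < l ->
    ~~ (((i, k) \in G) && ((j, l) \in G)).

Definition alternating (m : nat) (G : graph m) : Prop :=
  forall v : 'I_m, (forall w, adjacent G v w -> v < w) \/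
                   (forall w, adjacent G v w -> w < v).

Definition spanning_tree (m : nat) (G : graph m) : Prop :=
  (forall v w : 'I_m, connect (adjacent G) v w) /\
  (forall c : seq 'I_m, path.cycle (adjacent G) c -> uniq c -> size c <= 2).

Local Open Scope classical_set_scope.
Local Open Scope ring_scope.

Definition dot (R : realFieldType) (m : nat) (c x : 'rV[R]_m) : R :=
  \sum_(i < m) c 0 i * x 0 i.

Definition conv (R : realFieldType) (m : nat) (A : set 'rV[R]_m) :
    set 'rV[R]_m :=
  [set x | exists (k : nat) (p : 'I_k -> 'rV[R]_m) (c : 'I_k -> R),
     [/\ forall i, A (p i), forall i, 0 <= c i, \sum_(i < k) c i = 1
       & x = \sum_(i < k) c i *: p i]].

Definition affinely_independent (R : realFieldType) (m : nat) (I : finType)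
    (S : {set I}) (p : I -> 'rV[R]_m) : Prop :=
  forall c : I -> R, \sum_(i in S) c i = 0 -> \sum_(i in S) c i *: p i = 0 ->
    forall i, i \in S -> c i = 0.

(* The empty set is the simplex with no vertices. *)
Definition simplex (R : realFieldType) (m : nat) (F : set 'rV[R]_m) : Prop :=
  exists (k : nat) (p : 'I_k -> 'rV[R]_m),
    affinely_independent [set: 'I_k]%SET p /\ F = conv (range p).

(* The faces of a polytope P: the empty face and the sets where a linear
   functional attains its maximum on P (for c = 0 this is P itself). *)
Definition face (R : realFieldType) (m : nat) (P F : set 'rV[R]_m) : Prop :=
  F = set0 \/
  exists c : 'rV[R]_m, F = [set x | P x /\ forall y, P y -> dot c y <= dot c x].

Definition geometric_complex (R : realFieldType) (m : nat)
    (K : set (set 'rV[R]_m)) : Prop :=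
  [/\ finite_set K,
      forall F, K F -> simplex F,
      forall F F', K F -> face F F' -> K F'
    & forall F F', K F -> K F' -> face F (F `&` F') /\ face F' (F `&` F')].

Definition triangulation (R : realFieldType) (m : nat) (P : set 'rV[R]_m)
    (K : set (set 'rV[R]_m)) : Prop :=
  geometric_complex K /\ \bigcup_(F in K) F = P.

(* The subsets of A over which the lifting by the heights h has a lower face: the
   sets where h meets an affine function that lies below it on all of A. *)
Definition lower_face (R : realFieldType) (m : nat) (A : set 'rV[R]_m)
    (h : 'rV[R]_m -> R) (S : set 'rV[R]_m) : Prop :=
  exists (c : 'rV[R]_m) (d : R),
    (forall a, A a -> dot c a + d <= h a) /\
    S = [set a | A a /\ dot c a + d = h a].

Definition regular_triangulation (R : realFieldType) (m : nat)
    (A : set 'rV[R]_m) (K : set (set 'rV[R]_m)) : Prop :=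
  triangulation (conv A) K /\
  exists h : 'rV[R]_m -> R, K = [set conv S | S in lower_face A h].

(* K is a geometric simplicial complex whose vertices are placed by f, with
   vertex scheme C; the last-but-one clause makes f injective on vertices. *)
Definition geometric_realization (R : realFieldType) (m : nat) (V : finType)
    (K : set (set 'rV[R]_m)) (C : {set {set V}}) : Prop :=
  exists f : V -> 'rV[R]_m,
    [/\ forall S, S \in C -> affinely_independent S f,
        forall S S', S \in C -> S' \in C ->
          conv (f @` [set` S]) `&` conv (f @` [set` S'])
          = conv (f @` [set` (S :&: S')%SET])
      & K = [set conv (f @` [set` S]) | S in [set` C]]].

Definition simple_diff (R : realFieldType) (m : nat) (i j : 'I_m) : 'rV[R]_m :=
  delta_mx 0 i - delta_mx 0 j.

Definition root_cone (R : realFieldType) (m : nat) (G : graph m) :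
    set 'rV[R]_m :=
  [set x | exists c : 'I_m * 'I_m -> R, (forall e, 0 <= c e) /\
     x = \sum_(e in G | (e.1 < e.2)%N) c e *: simple_diff R e.1 e.2].

Definition root_points (R : realFieldType) (m : nat) (G : graph m) :
    set 'rV[R]_m :=
  [set x | x = 0 \/ exists i j : 'I_m,
     [/\ (i < j)%N, x = simple_diff R i j & root_cone G x]].
Arguments root_points R {m} G.

Definition root_polytope (R : realFieldType) (m : nat) (G : graph m) :
    set 'rV[R]_m :=
  conv (root_points R G).
Arguments root_polytope R {m} G.

(* The simplices P(T_1), ..., P(T_k) together with all their faces. *)
Definition canonical_triangulation (R : realFieldType) (m : nat) (G : graph m) :
    set (set 'rV[R]_m) :=
  [set F | exists T : graph m,
     [/\ T \subset transitive_closure G, spanning_tree T, noncrossing T,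
         alternating T & face (root_polytope R T) F]].
Arguments canonical_triangulation R {m} G.

(* Main.v *)
(* Call two edges (k, j) and (i, l) with k < i <= j < l conflicting, so that the
   noncrossing alternating graphs are the conflict-free ones, and let E be the
   transitive closure of the tree.

   Geometry. The height -(j - i)^2 of e_i - e_j is strictly decreased in total by
   the exchange (k, j), (i, l) -> (k, l), (i, j); hence lower faces are
   conflict-free. Conversely, every conflict-free graph carries a potential u
   with u_j - u_i >= (j - i)^2 for all i < j and equality on its edges. This
   makes it a lower face and gives the uniqueness of conflict-free
   representations, while their existence follows by carrying out the exchanges
   on a nonnegative combination.

   Combinatorics. Sending a box to the labels of its column and row is a
   bijection from the region onto E, and two boxes (a, b), (a', b') with a' < a
   and b < b' conflict exactly when (a, b') lies in the diagram. Elbows of a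
   reduced pipe dream never conflict, for otherwise two strands entering in rows
   up to a would leave in columns up to b', whereas only the first strand does.
   Conversely, a conflict-free spanning tree T of E defines a pipe dream with
   crosses at the boxes of the region outside T. Its strands realize all the
   inversions of pi, and its crosses are as many as the boxes of the diagram, so
   it is a reduced pipe dream for pi. *)

Require Import Defs.
From mathcomp Require Import boolp classical_sets functions cardinality.
From mathcomp Require Import all_boot all_order all_algebra all_fingroup.
From mathcomp Require Import zify ring lra.

Set Implicit Arguments.
Unset Strict Implicit.
Unset Printing Implicit Defensive.

Import Order.TTheory GRing.Theory Num.Theory.

(** * Conflict-free graphs and potentials *)

(** Both complexes turn out to be given by a relation between two vertices: faces are the sets
    without conflicting pairs. So [conflict_boxes], which matches the two relations, settles all
    faces at once, and no facets have to be paired off. The non-strict middle inequality of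
    [conflict] unites crossing and failure to alternate. In its equality case the inner pair of an
    exchange is diagonal: its root, slack and height all vanish. The origin of the polytope takes
    its place, or a diagonal pair that is dropped in the end. A potential may be tight at more edges
    than those it was made for, and then its lower face is too large. But tight edges are
    conflict-free again, hence affinely independent, and a small affine perturbation cuts the face
    down to any chosen subset. The exits of the strands in the dream of a tree are hard to compute.
    Bounding them from below at the boxes of the diagram is enough: this forces the inversions of
    [pi], and comparing the tree with the elbows of the bottom dream leaves no cross for another
    inversion. *)

Definition conflict (m : nat) (e f : 'I_m * 'I_m) : bool :=
  (e.1 < f.1 <= e.2) && (e.2 < f.2).

Definition conflict_free (m : nat) (T : graph m) : Prop :=
  forall e f : 'I_m * 'I_m, e \in T -> f \in T -> ~~ conflict e f.

Definition increasing (m : nat) (T : graph m) : Prop :=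
  forall e : 'I_m * 'I_m, e \in T -> e.1 < e.2.

Section Potential.
Local Open Scope ring_scope.

(* With [s] the largest neighbour of [l] below [r], no edge but [(l, r)] joins
   [l, s] to [s + 1, r]; hence the potentials of the two halves can be shifted
   independently so as to make [(l, r)] tight. *)
Lemma potential_interval (P : rel nat) (d l r : nat) :
    (forall i j k k', P i k -> P j k' -> (i < j)%N -> (j <= k)%N -> (k < k')%N ->
       False) ->
    (r - l <= d)%N -> (l <= r)%N ->
  exists u : nat -> int, u r - u l = (r%:Z - l%:Z) ^+ 2 /\
    forall i j, (l <= i)%N -> (i < j)%N -> (j <= r)%N ->
      (j%:Z - i%:Z) ^+ 2 <= u j - u i /\
      (P i j -> u j - u i = (j%:Z - i%:Z) ^+ 2).
Proof.
move=> Pfree; elim: d l r => [|d IHd] l r led lelr.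
  have -> : r = l by lia.
  by exists (fun=> 0); split=> [|i j]; [rewrite !subrr expr0n | lia].
have [->|ltlr] : r = l \/ (l < r)%N by lia.
  by exists (fun=> 0); split=> [|i j]; [rewrite !subrr expr0n | lia].
(* The disjunct [s == l] is the default when [l] has no neighbour below [r]: the first half is then
   a point. *)
pose Q s := [&& (l <= s)%N, (s < r)%N & (s == l) || P l s].
have exQ : exists s, Q s by exists l; rewrite /Q leqnn ltlr eqxx.
have ubQ s : Q s -> (s <= r)%N by case/and3P=> _ /ltnW.
case: (ex_maxnP exQ ubQ) => s /and3P[lels ltsr sP] smax.
have sep i j : (l <= i)%N -> (i <= s)%N -> (s < j)%N -> (j <= r)%N ->
    (i, j) <> (l, r) -> ~~ P i j.
  move=> leli leis ltsj lejr neq; apply/negP => Pij.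
  have [eil|ltli] : i = l \/ (l < i)%N by lia.
    subst i; have [ejr|ltjr] : j = r \/ (j < r)%N by lia.
      by subst j.
    have Qj : Q j by rewrite /Q Pij orbT ltjr andbT; lia.
    by have := smax _ Qj; lia.
  case/orP: sP => [/eqP esl|Pls]; first by lia.
  exact: (Pfree _ _ _ _ Pls Pij).
have [||u1 [u1E u1P]] := IHd l s; [lia | lia |].
have [||u2 [u2E u2P]] := IHd s.+1 r; [lia | lia |].
pose u i := if (i <= s)%N then u1 i else u2 i - u2 r + u1 l + (r%:Z - l%:Z) ^+ 2.
have ulow i : (i <= s)%N -> u i = u1 i by rewrite /u => ->.
have uhigh i : (s < i)%N -> u i = u2 i - u2 r + u1 l + (r%:Z - l%:Z) ^+ 2.
  by move=> lts; rewrite /u leqNgt lts.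
have eur : u r - u l = (r%:Z - l%:Z) ^+ 2.
  by rewrite (ulow l) // (uhigh r) //; ring.
exists u; split=> // i j leli ltij lejr.
have [lejs|ltsj] := leqP j s.
  by rewrite !ulow ?(leq_trans (ltnW ltij)) //; apply: u1P.
have [ltsi|leis] := ltnP s i.
  rewrite !uhigh //; have [le eq] := u2P i j ltsi ltij lejr.
  by split=> [|/eq]; lia.
split; last first.
  move=> Pij; suff [-> ->] : i = l /\ j = r by [].
  have := sep i j leli leis ltsj lejr.
  by rewrite Pij; case: (eqVneq (i, j) (l, r)) => [[-> ->]//|/eqP neq /(_ neq)].
rewrite (uhigh j) // (ulow i) //.
have u1i : u1 i - u1 l <= (s%:Z - l%:Z) ^+ 2 - (s%:Z - i%:Z) ^+ 2.
  have [->|ltis] : i = s \/ (i < s)%N by lia.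
    by rewrite u1E; lia.
  by have [le _] := u1P i s leli ltis (leqnn _); lia.
have u2j : u2 r - u2 j <= (r%:Z - s.+1%:Z) ^+ 2 - (j%:Z - s.+1%:Z) ^+ 2.
  have [->|ltsj'] : j = s.+1 \/ (s.+1 < j)%N by lia.
    by rewrite u2E; lia.
  by have [le _] := u2P s.+1 j (leqnn _) ltsj' lejr; lia.
(* Written in the gaps between [l], [i], [s], [s.+1], [j] and [r], the difference of the two sides
   has only nonnegative coefficients. *)
have [a ea] : exists a : nat, i = (l + a)%N by exists (i - l)%N; lia.
have [b eb] : exists b : nat, s = (i + b)%N by exists (s - i)%N; lia.
have [c ec] : exists c : nat, j = (s.+1 + c)%N by exists (j - s.+1)%N; lia.
have [e ee] : exists e : nat, r = (j + e)%N by exists (r - j)%N; lia.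
have : (j%:Z - i%:Z) ^+ 2 + ((s%:Z - l%:Z) ^+ 2 - (s%:Z - i%:Z) ^+ 2)
     + ((r%:Z - s.+1%:Z) ^+ 2 - (j%:Z - s.+1%:Z) ^+ 2) <= (r%:Z - l%:Z) ^+ 2.
  rewrite -subr_ge0.
  suff -> : (r%:Z - l%:Z) ^+ 2 - ((j%:Z - i%:Z) ^+ 2
      + ((s%:Z - l%:Z) ^+ 2 - (s%:Z - i%:Z) ^+ 2)
      + ((r%:Z - s.+1%:Z) ^+ 2 - (j%:Z - s.+1%:Z) ^+ 2))
      = (2 * (a * c.+1 + a * e + b * e + e))%:Z by [].
  by subst i s j r; rewrite ?(PoszD, PoszM, intS); ring.
by lra.
Qed.

Definition slack (u : nat -> int) (i j : nat) : int :=
  u j - u i - (j%:Z - i%:Z) ^+ 2.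

(* Strict convexity of the square makes uncrossing lower the total slack. *)
Lemma slack_uncross (u : nat -> int) (i j k l : nat) :
  (i < j <= k)%N -> (k < l)%N ->
  slack u i l + slack u j k < slack u i k + slack u j l.
Proof.
rewrite /slack => /andP[ltij lejk] ltkl.
have [a ea] : exists a : nat, j = (i + a.+1)%N by exists (j - i.+1)%N; lia.
have [b eb] : exists b : nat, k = (j + b)%N by exists (k - j)%N; lia.
have [c ec] : exists c : nat, l = (k + c.+1)%N by exists (l - k.+1)%N; lia.
suff -> : u l - u i - (l%:Z - i%:Z) ^+ 2 + (u k - u j - (k%:Z - j%:Z) ^+ 2)
    = u k - u i - (k%:Z - i%:Z) ^+ 2 + (u l - u j - (l%:Z - j%:Z) ^+ 2)
      - (2 * (a.+1 * c.+1))%:Z by lia.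
by subst j k l; rewrite ?(PoszD, PoszM, intS); ring.
Qed.

Lemma potential (m : nat) (T : graph m) : conflict_free T ->
  exists u : nat -> int,
    (forall i j : 'I_m, (i < j)%N -> 0 <= slack u i j) /\
    (forall e, e \in T -> (e.1 < e.2)%N -> slack u e.1 e.2 = 0).
Proof.
move=> Tfree.
pose P i j := [exists e in T, (e.1 == i :> nat) && (e.2 == j :> nat)].
have PF i j k k' : P i k -> P j k' -> (i < j)%N -> (j <= k)%N -> (k < k')%N -> False.
  case/existsP=> e /andP[eT /andP[/eqP<- /eqP<-]].
  case/existsP=> f /andP[fT /andP[/eqP<- /eqP<-]] lt le lt'.
  by have := Tfree e f eT fT; rewrite /conflict lt le lt'.
(* The interval [[0, m]] ends one past the last vertex, which covers [m = 0] as well. *)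
have [u [_ uP]] := potential_interval PF (leqnn _) (leq0n m).
exists u; split=> [i j ltij|e eT lte].
  by have [le _] := uP i j (leq0n _) ltij (ltnW (ltn_ord j)); rewrite subr_ge0.
have [_ eq] := uP e.1 e.2 (leq0n _) lte (ltnW (ltn_ord _)).
by rewrite /slack eq ?subrr //; apply/existsP; exists e; rewrite eT !eqxx.
Qed.

End Potential.

Lemma conflict_free_sub (m : nat) (S T : graph m) :
  S \subset T -> conflict_free T -> conflict_free S.
Proof. by move=> /subsetP ST Tf e f /ST eT /ST fT; apply: Tf. Qed.

Lemma increasing_sub (m : nat) (S T : graph m) :
  S \subset T -> increasing T -> increasing S.
Proof. by move=> /subsetP ST Ti e /ST; apply: Ti. Qed.

Definition incident (m : nat) (v : 'I_m) (e : 'I_m * 'I_m) : bool :=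
  (e.1 == v) || (e.2 == v).

(* A shortest edge has an endpoint of degree one: otherwise the other edges at
   its two ends are at least as long, hence cross each other. *)
Lemma leaf_edge (m : nat) (T : graph m) (e0 : 'I_m * 'I_m) :
    conflict_free T -> increasing T -> e0 \in T ->
  exists e : 'I_m * 'I_m, [/\ e \in T & exists2 v, incident v e &
    forall f : 'I_m * 'I_m, f \in T -> incident v f -> f = e].
Proof.
move=> Tf Ti e0T.
have [e eT emin] : exists2 e : 'I_m * 'I_m, e \in T &
    forall f : 'I_m * 'I_m, f \in T -> e.2 - e.1 <= f.2 - f.1.
  case: (arg_minnP (fun e : 'I_m * 'I_m => e.2 - e.1) e0T) => e eT emin.
  by exists e.
exists e; split=> //; apply: contrapT => H.
have [f [fT fm fe]] : exists f : 'I_m * 'I_m, [/\ f \in T, incident e.1 f & f <> e].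
  apply: contrapT => Hf; apply: H; exists e.1; first by rewrite /incident eqxx.
  by move=> f fT fm; apply: contrapT => fe; apply: Hf; exists f.
have [g [gT gm ge]] : exists f : 'I_m * 'I_m, [/\ f \in T, incident e.2 f & f <> e].
  apply: contrapT => Hf; apply: H; exists e.2; first by rewrite /incident eqxx orbT.
  by move=> g gT gm; apply: contrapT => ge; apply: Hf; exists g.
have inj (a b : 'I_m * 'I_m) : a.1 = b.1 :> nat -> a.2 = b.2 :> nat -> a = b.
  by case: a b => [? ?] [? ?] /= /val_inj -> /val_inj ->.
have ei := Ti e eT; have fi := Ti f fT; have gi := Ti g gT.
have fmin := emin f fT; have gmin := emin g gT.
have := Tf f e fT eT; have := Tf e g eT gT; have := Tf g f gT fT.
rewrite /conflict => c1 c2 c3.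
case/orP: fm => /eqP/(congr1 (@nat_of_ord m))/= f1; last by lia.
case/orP: gm => /eqP/(congr1 (@nat_of_ord m))/= g1; first by lia.
case: (ltngtP f.2 e.2) => [||/(inj _ _ f1)//] hf; first by lia.
case: (ltngtP g.1 e.1) => [||/inj/(_ g1)//] hg; last by lia.
lia.
Qed.

(** * Uniqueness of conflict-free representations *)

Section FreeRepresentations.
Local Open Scope ring_scope.
Variable R : realFieldType.

Definition rootv (m : nat) (e : 'I_m * 'I_m) : 'rV[R]_m := simple_diff R e.1 e.2.

Lemma rootvE (m : nat) (e : 'I_m * 'I_m) (i : 'I_m) :
  rootv e 0 i = (i == e.1)%:R - (i == e.2)%:R.
Proof. by rewrite /rootv /simple_diff !mxE. Qed.

Lemma dotD (m : nat) (c x y : 'rV[R]_m) : dot c (x + y) = dot c x + dot c y.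
Proof.
by rewrite /dot -big_split; apply: eq_bigr => i _; rewrite mxE mulrDr.
Qed.

Lemma dotZ (m : nat) (c x : 'rV[R]_m) (a : R) : dot c (a *: x) = a * dot c x.
Proof. by rewrite /dot mulr_sumr; apply: eq_bigr => i _; rewrite mxE mulrCA. Qed.

Lemma dot0 (m : nat) (c : 'rV[R]_m) : dot c 0 = 0.
Proof. by rewrite /dot big1 // => i _; rewrite mxE mulr0. Qed.

Lemma dot_sum (m : nat) (c : 'rV[R]_m) (I : Type) (s : seq I) (Q : pred I)
    (a : I -> R) (p : I -> 'rV[R]_m) :
  dot c (\sum_(i <- s | Q i) a i *: p i) = \sum_(i <- s | Q i) a i * dot c (p i).
Proof.
elim/big_rec2: _ => [|i y x _ <-]; first exact: dot0.
by rewrite dotD dotZ.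
Qed.

Lemma dot_root (m : nat) (c : 'rV[R]_m) (e : 'I_m * 'I_m) :
  dot c (rootv e) = c 0 e.1 - c 0 e.2.
Proof.
rewrite /dot; under eq_bigr do rewrite rootvE mulrBr.
rewrite sumrB; congr (_ - _).
  rewrite (bigD1 e.1) //= eqxx mulr1 big1 ?addr0 // => i /negbTE ->.
  by rewrite mulr0.
rewrite (bigD1 e.2) //= eqxx mulr1 big1 ?addr0 // => i /negbTE ->.
by rewrite mulr0.
Qed.

(** By [leaf_edge] a nonempty support has a vertex on only one of its edges, and there the
    coordinate of the sum is this edge's coefficient up to sign. *)
Lemma free_independent (m : nat) (T : graph m) (c : 'I_m * 'I_m -> R) :
    conflict_free T -> increasing T -> (forall e, c e != 0 -> e \in T) ->
  \sum_e c e *: rootv e = 0 -> forall e, c e = 0.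
Proof.
move=> Tf Ti cT sum0 e; apply/eqP/negP => /negP ce.
pose S := [set e | c e != 0].
have ST : S \subset T by apply/subsetP => f; rewrite inE; apply: cT.
have eS : e \in S by rewrite inE.
have [f [fS [v vf vP]]] :=
  leaf_edge (conflict_free_sub ST Tf) (increasing_sub ST Ti) eS.
move/(congr1 (fun x : 'rV__ => x 0 v)): sum0.
rewrite mxE summxE (bigD1 f) //= big1 ?addr0 => [|g gf]; last first.
  rewrite !mxE -/(rootv g); case: (eqVneq (c g) 0) => [->|cg]; first by rewrite mul0r.
  have := vP g; rewrite inE cg => /(_ isT) vg.
  have : ~~ incident v g by apply/negP => /vg gE; rewrite gE eqxx in gf.
  rewrite /incident negb_or => /andP[g1 g2].
  by rewrite ![v == _]eq_sym (negbTE g1) (negbTE g2) subrr mulr0.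
have flt : (f.1 < f.2)%N by apply: Ti; apply: (subsetP ST).
have fne : f.1 != f.2 by apply/eqP => E; rewrite E ltnn in flt.
rewrite inE in fS; rewrite mxE -/(rootv f) rootvE => /eqP.
rewrite mulf_eq0 (negbTE fS) /=; case/orP: vf => /eqP <-.
  by rewrite eqxx (negbTE fne) subr0 oner_eq0.
by rewrite [f.2 == f.1]eq_sym (negbTE fne) eqxx sub0r oppr_eq0 oner_eq0.
Qed.

Definition tight (m : nat) (u : nat -> int) : graph m :=
  [set e : 'I_m * 'I_m | (e.1 < e.2)%N && (slack u e.1 e.2 == 0)].

Lemma tight_increasing (m : nat) (u : nat -> int) : increasing (tight m u).
Proof. by move=> e; rewrite inE => /andP[]. Qed.

(** Uncrossing two tight edges would produce pairs of negative total slack. *)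
Lemma tight_free (m : nat) (u : nat -> int) :
    (forall i j : 'I_m, (i < j)%N -> 0 <= slack u i j) ->
  conflict_free (tight m u).
Proof.
move=> u0 e f; rewrite !inE => /andP[e12 /eqP se] /andP[f12 /eqP sf].
apply/negP => /andP[/[dup] cef /andP[c1 c2] c3].
have := slack_uncross u cef c3; rewrite se sf addr0 ltNge => /negP; apply.
apply: addr_ge0; first by apply: u0; lia.
move: c2; rewrite leq_eqVlt => /orP[/eqP->|/u0//].
by rewrite /slack !subrr.
Qed.

(** Pairing with [u] gives the total slack plus a quadratic cost in which [u] does not occur. So the
    costs of two representations of one vector can be compared through either potential. *)
Lemma sum_root_slack (m : nat) (u : nat -> int) (c : 'I_m * 'I_m -> R) :
  dot (\row_i (u i)%:~R) (\sum_e c e *: rootv e) =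
  - (\sum_e c e * (slack u e.1 e.2)%:~R
     + \sum_e c e * ((e.2%:Z - e.1%:Z) ^+ 2)%:~R).
Proof.
rewrite dot_sum -big_split -sumrN; apply: eq_bigr => e _ /=.
rewrite dot_root !mxE /slack !rmorphB /=; ring.
Qed.

(** Take [u] tight on [S] and [w] tight on [T]. Through [u] the cost of [c] is that of [d] plus the
    slack of [d]; through [w] the roles are swapped. Hence both slacks vanish, both supports are
    tight for [u], and tight roots are independent. *)
Lemma free_sum_unique (m : nat) (S T : graph m) (c d : 'I_m * 'I_m -> R) :
    conflict_free S -> increasing S -> conflict_free T -> increasing T ->
    (forall e, 0 <= c e) -> (forall e, 0 <= d e) ->
    (forall e, c e != 0 -> e \in S) -> (forall e, d e != 0 -> e \in T) ->
  \sum_e c e *: rootv e = \sum_e d e *: rootv e -> c =1 d.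
Proof.
move=> Sf Si Tf Ti c0 d0 cS dT E.
have [u [u0 uS]] := potential Sf; have [w [w0 wT]] := potential Tf.
have sl (t : nat -> int) (b : _ -> R) (V : graph m) :
    (forall e, e \in V -> (e.1 < e.2)%N -> slack t e.1 e.2 = 0) ->
    increasing V -> (forall e, b e != 0 -> e \in V) ->
    \sum_e b e * (slack t e.1 e.2)%:~R = 0.
  move=> tV Vi bV; rewrite big1 // => e _.
  case: (eqVneq (b e) 0) => [->|/bV eV]; first by rewrite mul0r.
  by rewrite tV ?mulr0 //; apply: Vi.
have ge0 (t : nat -> int) (b : 'I_m * 'I_m -> R) (V : graph m) e :
    (forall i j : 'I_m, (i < j)%N -> 0 <= slack t i j) ->
    increasing V -> (forall e, b e != 0 -> e \in V) -> (forall e, 0 <= b e) ->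
    0 <= b e * (slack t e.1 e.2)%:~R.
  move=> t0 Vi bV b0; case: (eqVneq (b e) 0) => [->|/bV eV]; first by rewrite mul0r.
  by rewrite mulr_ge0 // ler0z t0 //; apply: Vi.
have Eu := sum_root_slack u c; rewrite E sum_root_slack (sl u c S) // in Eu.
have Ew := sum_root_slack w c; rewrite E sum_root_slack (sl w d T) // in Ew.
have gu : 0 <= \sum_e d e * (slack u e.1 e.2)%:~R.
  by apply: sumr_ge0 => e _; apply: (ge0 _ _ T).
have gw : 0 <= \sum_e c e * (slack w e.1 e.2)%:~R.
  by apply: sumr_ge0 => e _; apply: (ge0 _ _ S).
have {gw} /eqP zu : \sum_e d e * (slack u e.1 e.2)%:~R = 0 by lra.
rewrite psumr_eq0 in zu; last by move=> e _; apply: (ge0 _ _ T).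
have cd e : c e - d e != 0 -> e \in tight m u.
  rewrite inE => ne.
  case: (eqVneq (c e) 0) => [cz|/cS eS]; last by rewrite Si //= uS // Si.
  have dz : d e != 0 by apply: contra ne => /eqP->; rewrite cz subrr.
  have := allP zu e (mem_index_enum e); rewrite mulf_eq0 (negbTE dz) /=.
  by rewrite intr_eq0 => ->; rewrite Ti //; apply: dT.
move=> e; apply/eqP; rewrite -subr_eq0; apply/eqP; move: e.
apply: (free_independent (tight_free u0) (@tight_increasing _ u) cd).
by under eq_bigr do rewrite scalerBl; rewrite sumrB E subrr.
Qed.

End FreeRepresentations.

(** * Conflict-free representations *)

Section Uncrossing.
Local Open Scope ring_scope.
Variables (R : realFieldType) (m : nat).
Implicit Types (c d : 'I_m * 'I_m -> R) (E : graph m).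

Definition exchange_closed E : Prop :=
  forall e f : 'I_m * 'I_m, e \in E -> f \in E -> conflict e f ->
    (e.1, f.2) \in E /\ ((f.1 < e.2)%N -> (f.1, e.2) \in E).

(* The diagonal pairs, whose roots vanish, absorb the mass created when the two
   conflicting edges share a vertex. *)
Definition supported E c : Prop :=
  forall e : 'I_m * 'I_m, c e != 0 -> e \in E \/ e.1 = e.2.

(** No two pairs of the support conflict in such a way that [z] is the inner pair of their
    exchange. *)
Definition settled c (z : 'I_m * 'I_m) : Prop :=
  forall k l : 'I_m, (k < z.1)%N -> (z.2 < l)%N ->
    c (k, z.2) != 0 -> c (z.1, l) != 0 -> False.

(** A combination of roots depends only on the row and column sums of its coefficients, which vanish
    here. *)
Lemma sum_root_rank1 (a b : 'I_m -> R) : \sum_i a i = 0 -> \sum_i b i = 0 ->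
  \sum_e (a e.1 * b e.2) *: rootv R e = 0.
Proof.
move=> a0 b0; apply/rowP => v; rewrite summxE mxE.
under eq_bigr do rewrite mxE rootvE mulrBr.
rewrite sumrB; apply/eqP; rewrite subr_eq0; apply/eqP; transitivity (0 : R).
  rewrite -(pair_bigA _ (fun i j => a i * b j * (v == i)%:R)) /= big1 // => i _.
  by rewrite -mulr_suml -mulr_sumr b0 mulr0 mul0r.
rewrite -(pair_bigA _ (fun i j => a i * b j * (v == j)%:R)) /= exchange_big /=.
by rewrite big1 // => j _; rewrite -!mulr_suml a0 !mul0r.
Qed.

(* Along a conflict pair [(i, j)] the mass [p] entering [j] from below [i] and
   the mass [q] leaving [i] beyond [j] are rerouted by the rank-one correction
   [t (1_i - p / |p|) (1_j - q / |q|)^T], [t = min(|p|, |q|)]; it does not change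
   the sum, as both factors have total mass [0]. *)
Lemma settle_pair E c (z : 'I_m * 'I_m) :
    increasing E -> exchange_closed E -> (z.1 <= z.2)%N ->
    (forall e, 0 <= c e) -> supported E c ->
  exists d, [/\ forall e, 0 <= d e, supported E d,
    \sum_e d e *: rootv R e = \sum_e c e *: rootv R e, settled d z &
    forall e : 'I_m * 'I_m, d e != 0 -> [\/ c e != 0,
      e = z /\ (exists2 k : 'I_m, (k < z.1)%N & c (k, z.2) != 0) /\
               (exists2 l : 'I_m, (z.2 < l)%N & c (z.1, l) != 0) |
      [/\ (e.1 < z.1)%N, (z.2 < e.2)%N, c (e.1, z.2) != 0 & c (z.1, e.2) != 0]]].
Proof.
move=> Ei Ex; case: z => i j /= leij c0 cE.
pose P := \sum_(k < m | (k < i)%N) c (k, j).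
pose Q := \sum_(l < m | (j < l)%N) c (i, l).
have [P0|P0] := eqVneq P 0.
  exists c; split=> // [k l ki jl /negP[]|e]; last by constructor 1.
  by move/eqP: P0; rewrite psumr_eq0 // => /allP/(_ k (mem_index_enum k))/implyP; apply.
have [Q0|Q0] := eqVneq Q 0.
  exists c; split=> // [k l ki jl _ /negP[]|e]; last by constructor 1.
  by move/eqP: Q0; rewrite psumr_eq0 // => /allP/(_ l (mem_index_enum l))/implyP; apply.
have Pp : 0 < P by rewrite lt_def P0 sumr_ge0.
have Qp : 0 < Q by rewrite lt_def Q0 sumr_ge0.
pose t := Num.min P Q.
have tp : 0 < t by rewrite lt_min Pp.
have tP : t / P <= 1 by rewrite ler_pdivrMr // mul1r ge_min lexx.
have tQ : t / Q <= 1 by rewrite ler_pdivrMr // mul1r ge_min lexx orbT.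
pose a (k : 'I_m) : R := (k == i)%:R - (if (k < i)%N then c (k, j) / P else 0).
pose b (l : 'I_m) : R := (l == j)%:R - (if (j < l)%N then c (i, l) / Q else 0).
have suma : \sum_k a k = 0.
  rewrite sumrB (bigD1 i) //= eqxx big1 ?addr0 => [|k /negbTE -> //].
  by rewrite -big_mkcond /= -mulr_suml divff ?subrr.
have sumb : \sum_k b k = 0.
  rewrite sumrB (bigD1 j) //= eqxx big1 ?addr0 => [|k /negbTE -> //].
  by rewrite -big_mkcond /= -mulr_suml divff ?subrr.
have exk : exists2 k : 'I_m, (k < i)%N & c (k, j) != 0.
  apply: contrapT => H; case/eqP: P0; apply: big1 => k ki.
  by apply/eqP/negPn/negP => ck; apply: H; exists k.
have exl : exists2 l : 'I_m, (j < l)%N & c (i, l) != 0.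
  apply: contrapT => H; case/eqP: Q0; apply: big1 => l jl.
  by apply/eqP/negPn/negP => cl; apply: H; exists l.
have ai : a i = 1 by rewrite /a eqxx ltnn subr0.
have bj : b j = 1 by rewrite /b eqxx ltnn subr0.
have alt (k : 'I_m) : (k < i)%N -> a k = - (c (k, j) / P).
  by move=> ki; rewrite /a ki -val_eqE /= ltn_eqF // sub0r.
have blt (l : 'I_m) : (j < l)%N -> b l = - (c (i, l) / Q).
  by move=> jl; rewrite /b jl -val_eqE /= gtn_eqF // sub0r.
have agt (k : 'I_m) : (i < k)%N -> a k = 0.
  by move=> ki; rewrite /a ltnNge ltnW //= -val_eqE /= gtn_eqF // subr0.
have bgt (l : 'I_m) : (l < j)%N -> b l = 0.
  by move=> jl; rewrite /b ltnNge ltnW //= -val_eqE /= ltn_eqF // subr0.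
pose d (e : 'I_m * 'I_m) : R := c e + t * (a e.1 * b e.2).
have dij : d (i, j) = c (i, j) + t by rewrite /d /= ai bj !mulr1.
have dkj (k : 'I_m) : (k < i)%N -> d (k, j) = c (k, j) * (1 - t / P).
  by move=> ki; rewrite /d /= alt // bj; ring.
have dil (l : 'I_m) : (j < l)%N -> d (i, l) = c (i, l) * (1 - t / Q).
  by move=> jl; rewrite /d /= blt // ai; ring.
have dkl (k l : 'I_m) : (k < i)%N -> (j < l)%N ->
    d (k, l) = c (k, l) + t * (c (k, j) / P * (c (i, l) / Q)).
  by move=> ki jl; rewrite /d /= alt // blt // mulrNN.
have cases (e : 'I_m * 'I_m) : [\/ d e = c e, e = (i, j),
    (exists2 k : 'I_m, (k < i)%N & e = (k, j)) \/
    (exists2 l : 'I_m, (j < l)%N & e = (i, l)) |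
    (e.1 < i)%N /\ (j < e.2)%N].
  case: e => k l /=.
  case: (ltngtP k i) => [ki|ki|/val_inj ->]; last 2 first.
  - by constructor 1; rewrite /d /= agt // mul0r mulr0 addr0.
  - case: (ltngtP l j) => [lj|lj|/val_inj ->].
    + by constructor 1; rewrite /d /= bgt // mulr0 mulr0 addr0.
    + by constructor 3; right; exists l.
    + by constructor 2.
  case: (ltngtP l j) => [lj|lj|/val_inj ->].
  - by constructor 1; rewrite /d /= bgt // mulr0 mulr0 addr0.
  - by constructor 4.
  - by constructor 3; left; exists k.
have dsupp (e : 'I_m * 'I_m) : d e != 0 -> [\/ c e != 0,
      e = (i, j) /\ (exists2 k : 'I_m, (k < i)%N & c (k, j) != 0) /\
               (exists2 l : 'I_m, (j < l)%N & c (i, l) != 0) |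
      [/\ (e.1 < i)%N, (j < e.2)%N, c (e.1, j) != 0 & c (i, e.2) != 0]].
  case: (cases e) => [->|->|[[k ki ->]|[l jl ->]]|[ki jl]].
  - by constructor 1.
  - by constructor 2.
  - rewrite dkj // => H; constructor 1.
    by apply: contra H => /eqP->; rewrite mul0r.
  - rewrite dil // => H; constructor 1.
    by apply: contra H => /eqP->; rewrite mul0r.
  - case: e ki jl => k l /= ki jl; rewrite dkl //.
    have [->|ce] := eqVneq (c (k, l)) 0; last by constructor 1.
    rewrite add0r !mulf_eq0 !negb_or => /and3P[_ /andP[h1 _] /andP[h2 _]].
    by constructor 3.
exists d; split=> //.
- move=> e; case: (cases e) => [->|->|[[k ki ->]|[l jl ->]]|[ki jl]] //.
  + by rewrite dij addr_ge0 // ltW.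
  + by rewrite dkj // mulr_ge0 // subr_ge0.
  + by rewrite dil // mulr_ge0 // subr_ge0.
  + case: e ki jl => k l /= ki jl; rewrite dkl // addr_ge0 // mulr_ge0 ?(ltW tp) //.
    by rewrite mulr_ge0 // divr_ge0 // ltW.
- have toE (k l : 'I_m) : (k < l)%N -> c (k, l) != 0 -> (k, l) \in E.
    by move=> kl /cE[//|/= e]; rewrite e ltnn in kl.
  move=> e /dsupp[/cE//|[-> [[k ki ck] [l jl cl]]]|[ei je ck cl]].
    have [leji|ltij] := leqP j i.
      by right; apply/val_inj/eqP; rewrite eqn_leq leij.
    have kj : (k < j)%N := leq_trans ki leij.
    have il : (i < l)%N := leq_ltn_trans leij jl.
    left; have [|_ /(_ ltij)//] := Ex _ _ (toE k j kj ck) (toE i l il cl).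
    by rewrite /conflict /= ki leij.
  have kj : (e.1 < j)%N := leq_trans ei leij.
  have il : (i < e.2)%N := leq_ltn_trans leij je.
  left; have [|] := Ex _ _ (toE e.1 j kj ck) (toE i e.2 il cl).
    by rewrite /conflict /= ei leij.
  by case: (e).
- under eq_bigr do rewrite /d scalerDl -scalerA.
  by rewrite big_split -scaler_sumr sum_root_rank1 //= scaler0 addr0.
- move=> k l /= ki jl; rewrite dkj // dil //.
  (* Since [t] is one of the two masses, one of the two factors [1 - t / P] and [1 - t / Q] is
     zero. *)
  have [tE|tE] : t = P \/ t = Q by rewrite /t; case: leP; [left | right].
    by rewrite tE divff // subrr mulr0 eqxx.
  by rewrite tE divff // subrr mulr0 eqxx.
Qed.

Definition edge_length (e : 'I_m * 'I_m) : nat := e.2 - e.1.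

(** A pair new to the support is [z] itself or reaches beyond [z] on both sides, and it comes with
    old pairs sharing an end with it. In a conflict at [y] it can be replaced by one of these, which
    gives an old conflict at [y]; the length bound excludes the remaining positions. *)
Lemma settle_pair_keeps c d (z y : 'I_m * 'I_m) :
    (y.1 <= y.2)%N -> (z.1 <= z.2)%N -> (edge_length y <= edge_length z)%N ->
    settled c y ->
    (forall e : 'I_m * 'I_m, d e != 0 -> [\/ c e != 0,
      e = z /\ (exists2 k : 'I_m, (k < z.1)%N & c (k, z.2) != 0) /\
               (exists2 l : 'I_m, (z.2 < l)%N & c (z.1, l) != 0) |
      [/\ (e.1 < z.1)%N, (z.2 < e.2)%N, c (e.1, z.2) != 0 & c (z.1, e.2) != 0]]) ->
  settled d y.
Proof.
case: y z => [i' j'] [i j]; rewrite /edge_length /settled /= => le' le len cs dP k' l'.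
move=> ki jl /dP/= A /dP/= B.
case: A => [A|[[ki' ji'] [[k ltk ck] [l ltl cl]]]|[kl1 kl2 ckl1 ckl2]].
- case: B => [B|[[ki' ji'] [[k ltk ck] [l ltl cl]]]|[kl1 kl2 ckl1 ckl2]].
  + exact: (cs k' l').
  + by subst i' l'; apply: (cs k' l) => //; lia.
  + by apply: (cs k' j) => //; lia.
- case: B => [B|[[ki'' ji''] _]|[kl1 kl2 ckl1 ckl2]].
  + by subst k' j'; apply: (cs k l') => //; lia.
  + by subst; lia.
  + by subst; lia.
- case: B => [B|[[ki'' ji''] _]|[kl1' kl2' ckl1' ckl2']].
  + by apply: (cs i l') => //; lia.
  + by subst; lia.
  + lia.
Qed.

(* Settling a pair keeps the pairs that are not longer settled, so it suffices
   to go through all pairs by increasing length. *)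
Lemma settle_pairs E c (s : seq ('I_m * 'I_m)) :
    increasing E -> exchange_closed E ->
    (forall e, 0 <= c e) -> supported E c ->
    {in s, forall z : 'I_m * 'I_m, (z.1 <= z.2)%N} ->
    pairwise (fun y z => edge_length y <= edge_length z)%N s ->
  exists d, [/\ forall e, 0 <= d e, supported E d,
    \sum_e d e *: rootv R e = \sum_e c e *: rootv R e &
    {in s, forall z, settled d z}].
Proof.
move=> Ei Ex c0 cE; elim/last_ind: s => [|s z IHs] sle; first by exists c.
rewrite pairwise_rcons => /andP[/allP lez /IHs[y ys|d [d0 dE dc dP]]].
  by apply: sle; rewrite mem_rcons inE ys orbT.
have zle : (z.1 <= z.2)%N by apply: sle; rewrite mem_rcons mem_head.
have [d' [d'0 d'E d'd d'z d'P]] := settle_pair Ei Ex zle d0 dE.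
exists d'; split=> // [|y]; first by rewrite d'd.
rewrite mem_rcons inE => /predU1P[->//|ys].
apply: settle_pair_keeps (zle) (lez y ys) (dP y ys) d'P.
by apply: sle; rewrite mem_rcons inE ys orbT.
Qed.

Lemma cone_free_representation E c :
    increasing E -> exchange_closed E ->
    (forall e, 0 <= c e) -> (forall e, c e != 0 -> e \in E) ->
  exists (T : graph m) d, [/\ T \subset E, conflict_free T, forall e, 0 <= d e,
    forall e, d e != 0 -> e \in T &
    \sum_e d e *: rootv R e = \sum_e c e *: rootv R e].
Proof.
move=> Ei Ex c0 cE.
pose s := sort (fun y z => edge_length y <= edge_length z)%N
  [seq z : 'I_m * 'I_m <- enum {: 'I_m * 'I_m} | (z.1 <= z.2)%N].
have sE z : (z \in s) = (z.1 <= z.2)%N by rewrite mem_sort mem_filter mem_enum andbT.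
have [|||d [d0 dE dc dP]] := @settle_pairs E c s Ei Ex c0.
- by move=> e /cE; left.
- by move=> z; rewrite sE.
- rewrite -sorted_pairwise; last by move=> y x z /= ; apply: leq_trans.
  by apply: sort_sorted => x y; apply: leq_total.
(* The diagonal pairs are dropped here; as their roots vanish, the sum stays the same. *)
pose T := [set e : 'I_m * 'I_m | (e.1 != e.2) && (d e != 0)].
exists T, (fun e => if e.1 == e.2 then 0 else d e); split.
- apply/subsetP => e; rewrite inE => /andP[/eqP ne /dE[]//].
- move=> e f; rewrite !inE => /andP[_ de] /andP[_ df]; apply/negP.
  case/andP=> /andP[lt1 le] lt2.
  have zs : (f.1, e.2) \in s by rewrite sE.
  have := dP _ zs e.1 f.2 lt1 lt2; case: (e) (f) de df => [? ?] [? ?] /= h1 h2.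
  exact.
- by move=> e; case: ifP.
- by move=> e; rewrite inE; case: ifP => //; rewrite eqxx.
- rewrite -dc; apply: eq_bigr => e _; case: eqP => // e12.
  by rewrite /rootv /simple_diff e12 subrr !scaler0.
Qed.
End Uncrossing.

(** * Extension of conflict-free graphs to spanning trees *)

Section FreeGraphs.
Variable m : nat.
Implicit Types (S T E : graph m).

Lemma adjacent_sym T : symmetric (adjacent T).
Proof. by move=> i j; rewrite /adjacent /= orbC. Qed.

Lemma connect_adjacent_sym T : connect_sym (adjacent T).
Proof. exact/sym_connect_sym/adjacent_sym. Qed.

Lemma conflict_freeP T : increasing T ->
  conflict_free T <-> noncrossing T /\ alternating T.
Proof.
move=> Ti; split=> [Tf|[Tn Ta] [k j] [i l] kjT ilT].
  split=> [i j k l ltij ltjk ltkl|v].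
    apply/negP => /andP[ikT jlT]; have := Tf _ _ ikT jlT.
    by rewrite /conflict /= ltij ltkl ltnW.
  have adj w : adjacent T v w -> (v < w) && ((v, w) \in T) || (w < v) && ((w, v) \in T).
    by rewrite /adjacent /= => /orP[/[dup] /Ti /= -> ->|/[dup] /Ti /= -> ->]; rewrite ?orbT.
  case: (pselect (exists2 w : 'I_m, v < w & adjacent T v w)) => [[w vw /adj]|H].
    rewrite vw ltnNge ltnW //= orbF => vwT; left=> w' /adj.
    case/orP=> /andP[]// w'v w'vT.
    by have := Tf _ _ w'vT vwT; rewrite /conflict /= w'v vw leqnn.
  right=> w vw; case/orP: (adj w vw) => /andP[]// lt _.
  by case: H; exists w.
apply/negP => /andP[/= /andP[ki ij] jl].
move: ij; rewrite leq_eqVlt => /orP[/eqP/val_inj ij|ij].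
  subst j; case: (Ta i) => H.
    have /H : adjacent T i k by rewrite /adjacent /= kjT orbT.
    by rewrite ltnNge ltnW.
  have /H : adjacent T i l by rewrite /adjacent /= ilT.
  by rewrite ltnNge ltnW.
by have := Tn _ _ _ _ ki ij jl; rewrite kjT ilT.
Qed.

(** Among the edges of [T] between vertices of the cycle, [leaf_edge] finds a vertex on only one of
    them, yet its two neighbours on the cycle are distinct. *)
Lemma free_acyclic T (c : seq 'I_m) : conflict_free T -> increasing T ->
  path.cycle (adjacent T) c -> uniq c -> size c <= 2.
Proof.
move=> Tf Ti cT cu; rewrite leqNgt; apply/negP => csize.
pose S := [set e in T | (e.1 \in c) && (e.2 \in c)].
have ST : S \subset T by apply/subsetP => e; rewrite inE => /andP[].
have mk x y : adjacent T x y -> x \in c -> y \in c ->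
    exists e : 'I_m * 'I_m, e \in S /\ (e = (x, y) \/ e = (y, x)).
  case/orP=> xyT xc yc; [exists (x, y) | exists (y, x)]; rewrite inE /= xyT xc yc;
    by split; [|auto].
have [e0 e0S] : exists e0, e0 \in S.
  have [x [y [xy xc yc]]] : exists x y, [/\ adjacent T x y, x \in c & y \in c].
    case: (c) cT csize => [|x [|y c']] //= /andP[xy _] _.
    by exists x, y; rewrite xy !inE !eqxx orbT.
  by have [e [eS _]] := mk x y xy xc yc; exists e.
have [e [eS [v ve vP]]] :=
  leaf_edge (conflict_free_sub ST Tf) (increasing_sub ST Ti) e0S.
have vc : v \in c by move: eS ve; rewrite inE => /and3P[_ h1 h2] /orP[]/eqP <-.
have [i p cE] := rot_to vc.
have pT : path.cycle (adjacent T) (v :: p) by rewrite -cE rot_cycle.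
have pu : uniq (v :: p) by rewrite -cE rot_uniq.
have psize : 2 < size (v :: p) by rewrite -cE size_rot.
have pc x : x \in v :: p -> x \in c by rewrite -cE mem_rot.
case: p {cE} pT pu psize pc => [|a p] //; case/lastP: p => [|p b] //=.
rewrite rcons_path last_rcons => /and3P[va _ bv] /and3P[_ anb _] _ pc.
have ac : a \in c by apply: pc; rewrite !inE eqxx orbT.
have bc : b \in c by apply: pc; rewrite !inE mem_rcons mem_head !orbT.
have [f [fS fE]] := mk v a va vc ac.
have [g [gS gE]] := mk b v bv bc vc.
have fe : f = e by apply: vP => //; rewrite /incident; case: fE => ->; rewrite /= eqxx ?orbT.
have ge : g = e by apply: vP => //; rewrite /incident; case: gE => ->; rewrite /= eqxx ?orbT.
have ab : a = b.
  by move: fE gE; rewrite fe ge => -[->|->] [[]|[]] *; congruence.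
by rewrite ab mem_rcons mem_head in anb.
Qed.

Definition connected T : Prop := forall v w, connect (adjacent T) v w.

(* Uncrossing an edge [e] of least slack between two components with an edge of
   [T], whose slack is [0], produces edges of smaller slack, one of which still
   joins two components. *)
Lemma free_extension E S :
    increasing E -> exchange_closed E -> connected E -> S \subset E ->
    conflict_free S ->
  exists T, [/\ S \subset T, T \subset E, conflict_free T & connected T].
Proof.
move=> Ei Ex Ec SE Sf.
pose P (T : graph m) := (T \subset E) && `[< conflict_free T >].
have PS : P S by rewrite /P SE; apply/asboolP.
have [T /maxsetP[/andP[TE /asboolP Tf] Tmax] ST] := maxset_exists PS.
exists T; split=> //; apply: contrapT => Tnc.
have [u [u0 uT]] := potential Tf.
have sl0 (e : 'I_m * 'I_m) : e \in E -> (0 <= slack u e.1 e.2)%R by move=> /Ei /u0.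
have [e0 /andP[e0E e0c]] : exists e, (e \in E) && ~~ connect (adjacent T) e.1 e.2.
  apply: contrapT => H; apply: Tnc => v w.
  suff sub : subrel (adjacent E) (connect (adjacent T)) by apply: connect_sub sub _ _ _.
  have eP (e : 'I_m * 'I_m) : e \in E -> connect (adjacent T) e.1 e.2.
    by move=> eE; apply/negPn/negP => ec; apply: H; exists e; rewrite eE.
  move=> x y /orP[/eP //|/eP /=].
  by rewrite connect_adjacent_sym.
have [e [eE ec emin]] : exists e : 'I_m * 'I_m, [/\ e \in E,
    ~~ connect (adjacent T) e.1 e.2 & forall f : 'I_m * 'I_m, f \in E ->
    (slack u f.1 f.2 < slack u e.1 e.2)%R -> connect (adjacent T) f.1 f.2].
  have e0P : [pred e | (e \in E) && ~~ connect (adjacent T) e.1 e.2] e0 by rewrite /= e0E.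
  case: (arg_minnP (fun e : 'I_m * 'I_m => `|slack u e.1 e.2|%N) e0P).
  move=> e /andP[eE ec] emin; exists e; split=> // f fE lt.
  apply/negPn/negP => fc; have := emin f; rewrite /= fE fc => /(_ isT).
  by rewrite leqNgt -ltz_nat !gez0_abs ?sl0 // lt.
have cross f g : f \in E -> g \in E -> conflict f g ->
    (slack u f.1 f.2 + slack u g.1 g.2 = slack u e.1 e.2)%R ->
    connect (adjacent T) f.1 g.2 /\ connect (adjacent T) g.1 f.2.
  move=> fE gE fg slE; have [fgE gfE] := Ex f g fE gE fg.
  case/andP: (fg) => c1 c2; case/andP: (c1) => _ c3.
  have := slack_uncross u c1 c2; rewrite slE => lt.
  have sl1 := sl0 _ fgE; rewrite /= in sl1.
  have sl2 : (0 <= slack u g.1 f.2)%R.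
    move: c3; rewrite leq_eqVlt => /orP[/eqP->|/gfE/sl0//].
    by rewrite /slack !subrr.
  split; first by apply: (emin (f.1, g.2)) => //=; apply: le_lt_trans lt; rewrite lerDl.
  move: c3; rewrite leq_eqVlt => /orP[/eqP/val_inj->//|/gfE gfE'].
  by apply: (emin (g.1, f.2)) => //=; apply: le_lt_trans lt; rewrite lerDr.
have inT f : f \in T -> connect (adjacent T) f.1 f.2 /\ slack u f.1 f.2 = 0%R.
  move=> fT; split; last by apply: uT => //; apply/Ei/(subsetP TE).
  by apply: connect1; rewrite /adjacent /= -surjective_pairing fT.
have Pe : ~ conflict_free (e |: T).
  move=> ef; have := Tmax (e |: T); rewrite /P subUset sub1set eE TE /=.
  move=> /(_ (asboolT ef) (subsetUr _ _)) eT.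
  by case/negP: ec; apply: (inT e _).1; rewrite -eT setU11.
apply: Pe => f g.
have irr (h : 'I_m * 'I_m) : ~~ conflict h h by rewrite /conflict ltnn.
rewrite !inE => /orP[/eqP->|fT] /orP[/eqP->|gT] //.
- apply/negP => eg; have [c0 sl] := inT g gT.
  have [||c1 c2] := cross e g eE _ eg; first exact: (subsetP TE).
    by rewrite sl addr0.
  case/negP: ec; apply: connect_trans c1 _; apply: connect_trans c2.
  by rewrite connect_adjacent_sym.
- apply/negP => fe; have [c0 sl] := inT f fT.
  have [||c1 c2] := cross f e _ eE fe; first exact: (subsetP TE).
    by rewrite sl add0r.
  case/negP: ec; apply: connect_trans c2 _; apply: connect_trans c1.
  by rewrite connect_adjacent_sym.
- exact: Tf.
Qed.

(** A comparison of ranks: the roots of [S] are independent, and the roots of [T] span all roots by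
    telescoping along paths. *)
Lemma free_card_le S T : conflict_free S -> increasing S -> connected T ->
  #|S| <= #|T|.
Proof.
move=> Sf Si Tc.
pose A (V : graph m) := (\matrix_(i < #|V|) rootv rat (enum_val i))%R.
have AS : \rank (A S) = #|S|.
  apply/eqP; rewrite -/(row_free _); apply: inj_row_free => v.
  rewrite mulmx_sum_row => vA.
  pose c (e : 'I_m * 'I_m) : rat := (\sum_(i | enum_val i == e) v 0 i)%R.
  have cS e : (c e != 0)%R -> e \in S.
    move=> ce; apply/negPn/negP => eS; move/negP: ce; apply; apply/eqP.
    apply: big1 => i /eqP ie; by rewrite -ie enum_valP in eS.
  have c0 := free_independent Sf Si cS.
  apply/rowP => i; rewrite mxE -[RHS](c0 _ (enum_val i)).
    by rewrite /c (big_pred1 i) // => j; rewrite /= (inj_eq enum_val_inj).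
  rewrite -[RHS]vA; under eq_bigr do rewrite /c scaler_suml.
  rewrite (exchange_big_dep predT) //=; apply: eq_bigr => j _.
  by rewrite (big_pred1 (enum_val j)) ?rowK // => e; rewrite /= eq_sym.
have sub x y : connect (adjacent T) x y -> (rootv rat (x, y) <= A T)%MS.
  case/connectP=> p; elim: p x => [|z p IHp] x /=.
    by move=> _ ->; rewrite /rootv /simple_diff subrr sub0mx.
  move=> /andP[xz /IHp/[apply] zy].
  have -> : rootv rat (x, y) = (rootv rat (x, z) + rootv rat (z, y))%R.
    by rewrite /rootv /simple_diff /= addrA subrK.
  apply: addmx_sub => //.
  have inA e : e \in T -> (rootv rat e <= A T)%MS.
    move=> eT; rewrite -(enum_rankK_in eT eT).
    by rewrite -[X in (X <= _)%MS](rowK (fun i => rootv rat (enum_val i))) row_sub.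
  case/orP: xz => /inA //.
  rewrite -[rootv _ (x, z)]opprK eqmx_opp => h.
  by rewrite /rootv /simple_diff /= opprB.
rewrite -AS; apply: leq_trans (rank_leq_row (A T)); apply: mxrankS.
apply/row_subP => i; rewrite rowK.
by case: (enum_val i) => x y; apply: sub.
Qed.

End FreeGraphs.

(** * Simplices and their faces *)

Section Simplices.
Local Open Scope classical_set_scope.
Local Open Scope ring_scope.
Variables (R : realFieldType) (m : nat) (I : finType) (p : I -> 'rV[R]_m).
Implicit Types (S : {set I}).

Definition hull S : set 'rV[R]_m := conv (p @` [set` S]).

Lemma hullP S x : hull S x <-> exists c : I -> R,
  [/\ forall i, 0 <= c i, forall i, i \notin S -> c i = 0, \sum_i c i = 1
    & x = \sum_i c i *: p i].
Proof.
split=> [[k [q [a [qS a0 a1 ->]]]]|[c [c0 cS c1 ->]]].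
  have [g gP] : exists g : 'I_k -> I, forall j, g j \in S /\ p (g j) = q j.
    have /choice[g gP] : forall j, exists i, i \in S /\ p i = q j.
      by move=> j; case: (qS j) => i /= iS <-; exists i.
    by exists g.
  exists (fun i => \sum_(j | g j == i) a j); split.
  - by move=> i; apply: sumr_ge0.
  - move=> i iS; apply: big1 => j /eqP ji; by rewrite -ji (gP j).1 in iS.
  - by rewrite -a1 [RHS](partition_big g predT).
  - rewrite (partition_big g predT) //=; apply: eq_bigr => i _.
    by rewrite scaler_suml; apply: eq_bigr => j /eqP <-; rewrite (gP j).2.
exists #|S|, (fun j => p (enum_val j)), (fun j => c (enum_val j)); split=> //.
- by move=> j; exists (enum_val j) => //=; apply: enum_valP.
- rewrite -big_enum_val /= -c1 [RHS](bigID (mem S)) /= [X in _ + X]big1 ?addr0 //.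
- rewrite -(big_enum_val (fun i => c i *: p i)) /= (bigID (mem S)) /=.
  rewrite [X in _ + X]big1 ?addr0 // => i /cS ->; exact: scale0r.
Qed.

Lemma hull0 : hull set0 = classical_sets.set0.
Proof.
apply/seteqP; split=> // x /hullP[c [_ c0 c1 _]].
move: c1; rewrite big1 => [/esym/eqP|i _]; first by rewrite oner_eq0.
by apply: c0; rewrite inE.
Qed.

Lemma hull_sub S S' : S \subset S' -> hull S `<=` hull S'.
Proof.
move=> SS' x /hullP[c [c0 cS c1 ->]]; apply/hullP; exists c; split=> // i iS'.
by apply: cS; apply: contra iS'; apply: (subsetP SS').
Qed.

Lemma hull_vertex S i : i \in S -> hull S (p i).
Proof.
move=> iS; apply/hullP; exists (fun j => (j == i)%:R); split.
- by move=> j; rewrite ler0n.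
- by move=> j; case: eqP => // -> /negP.
- by rewrite (bigD1 i) //= eqxx big1 ?addr0 // => j /negbTE ->.
- rewrite (bigD1 i) //= eqxx scale1r big1 ?addr0 // => j /negbTE ->.
  exact: scale0r.
Qed.

(** With a coordinate [1] appended, affinely independent points become linearly independent rows,
    and their matrix has a right inverse. *)
Lemma affine_extension S (v : I -> R) : affinely_independent S p ->
  exists (c : 'rV[R]_m) (d : R), forall i, i \in S -> dot c (p i) + d = v i.
Proof.
move=> Si.
pose A := \matrix_(i < #|S|) row_mx (p (enum_val i)) (1%:M : 'M[R]_1).
have Afree : row_free A.
  apply: inj_row_free => w; rewrite mulmx_sum_row => wA.
  pose b i := \sum_(j | enum_val j == i) w 0 j.
  have bE j : b (enum_val j) = w 0 j.
    by rewrite /b (big_pred1 j) // => k; rewrite /= (inj_eq enum_val_inj).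
  have wsum : \sum_i w 0 i *: row_mx (p (enum_val i)) (1%:M : 'M[R]_1) = 0.
    by rewrite -[RHS]wA; apply: eq_bigr => i _; rewrite rowK.
  have b0 : \sum_(i in S) b i = 0.
    rewrite big_enum_val; under eq_bigr do rewrite bE.
    move/(congr1 (fun x : 'rV__ => rsubmx x 0 0)): wsum.
    rewrite linear_sum summxE linear0 mxE /= => wsum; rewrite -[RHS]wsum.
    by apply: eq_bigr => i _; rewrite linearZ /= row_mxKr !mxE mulr1.
  have bp : \sum_(i in S) b i *: p i = 0.
    rewrite (big_enum_val (fun i => b i *: p i)); under eq_bigr do rewrite bE.
    move/(congr1 (fun x : 'rV__ => lsubmx x)): wsum.
    rewrite linear_sum linear0 /= => wsum; rewrite -[RHS]wsum.
    by apply: eq_bigr => i _; rewrite linearZ /= row_mxKl.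
  by apply/rowP => j; rewrite mxE -bE (Si b b0 bp) // enum_valP.
have [B AB] := row_freeP Afree.
pose w : 'cV[R]_(m + 1) := B *m \col_i v (enum_val i).
exists (usubmx w)^T, (dsubmx w 0 0) => i iS.
have := congr1 (fun M : 'cV__ => M (enum_rank_in iS i) 0) (mulmxA A B (\col_i v (enum_val i))).
rewrite AB mul1mx -/w [RHS]mxE enum_rankK_in // => <-.
rewrite [RHS]mxE big_split_ord /= big_ord1 /dot; congr (_ + _).
  apply: eq_bigr => k _.
  by rewrite [A _ _]mxE row_mxEl enum_rankK_in // !mxE mulrC.
by rewrite [A _ _]mxE row_mxEr !mxE eqxx mul1r.
Qed.

Lemma faces_of_hull S (F : set 'rV[R]_m) : affinely_independent S p ->
  face (hull S) F <-> exists2 S' : {set I}, S' \subset S & F = hull S'.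
Proof.
move=> Si; split=> [[->|[c ->]]|[S' SS' ->]].
- by exists set0; rewrite ?sub0set ?hull0.
- have [->|[i0 i0S]] := set_0Vmem S.
    by exists set0; rewrite // hull0; apply/seteqP; split=> x //= [].
  have [i iS imax] : exists2 i, i \in S & forall j, j \in S -> dot c (p j) <= dot c (p i).
    by case: (Order.TotalTheory.arg_maxP (fun j => dot c (p j)) i0S) => i iS H; exists i.
  exists [set j in S | dot c (p j) == dot c (p i)]%SET.
    by apply/subsetP => j; rewrite inE => /andP[].
  apply/seteqP; split=> [x [/hullP[a [a0 aS a1 ->]] xmax]|x].
    have := xmax _ (hull_vertex iS); rewrite dot_sum => le.
    apply/hullP; exists a; split=> // j; rewrite inE negb_and.
    case/orP=> [/aS //|ne].
    (* The weighted deficits against the maximum at [i] are nonnegative and sum to at most zero, so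
       all weight lies on maximisers. *)
    have z : \sum_j a j * (dot c (p i) - dot c (p j)) = 0.
      apply/eqP; rewrite eq_le; apply/andP; split.
        under eq_bigr do rewrite mulrBr.
        by rewrite sumrB -mulr_suml a1 mul1r subr_le0.
      apply: sumr_ge0 => k _; case: (boolP (k \in S)) => [/imax kS|/aS ->].
        by rewrite mulr_ge0 // subr_ge0.
      by rewrite mul0r.
    have [|jS] := boolP (j \in S); last exact: aS.
    move=> jS; move/eqP: z; rewrite psumr_eq0 => [|k _]; last first.
      case: (boolP (k \in S)) => [/imax kS|/aS ->]; last by rewrite mul0r.
      by rewrite mulr_ge0 // subr_ge0.
    move/allP/(_ j (mem_index_enum j)); rewrite /= mulf_eq0 subr_eq0.
    by rewrite [_ == dot c (p j)]eq_sym (negbTE ne) orbF => /eqP.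
  case/hullP=> a [a0 aS a1 xE]; split.
    apply/hullP; exists a; split=> // j jS; apply: aS.
    by rewrite inE (negbTE jS).
  have -> : dot c x = dot c (p i).
    rewrite xE dot_sum -[RHS]mul1r -a1 mulr_suml; apply: eq_bigr => j _.
    have [|/aS ->] := boolP (j \in [set j in S | dot c (p j) == dot c (p i)]%SET).
      by rewrite inE => /andP[_ /eqP ->].
    by rewrite !mul0r.
  move=> y /hullP[b [b0 bS b1 ->]]; rewrite dot_sum -[leRHS]mul1r -b1 mulr_suml.
  apply: ler_sum => j _; have [/imax jS|/bS ->] := boolP (j \in S).
    exact: ler_wpM2l.
  by rewrite !mul0r.
- have [->|[i iS']] := set_0Vmem S'; first by left; rewrite hull0.
  (* An affine function that is [1] at the vertices in [S'] and [0] at the other ones attains its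
     maximum exactly on the hull of [S']. *)
  right; have [c [d cd]] := affine_extension (fun i => (i \in S')%:R) Si.
  have val a : (forall i, i \notin S -> a i = 0) -> \sum_i a i = 1 ->
      dot c (\sum_i a i *: p i) = \sum_(i in S') a i - d.
    move=> aS a1; rewrite dot_sum -[d]mul1r -a1 mulr_suml.
    rewrite [X in _ = X - _]big_mkcond /= -sumrB; apply: eq_bigr => j _.
    have [jS|jS] := boolP (j \in S).
      rewrite -[dot _ _](addrK d) cd //; case: (j \in S') => /=; ring.
    rewrite aS // !mul0r; case: ifP => _; by rewrite subr0.
  have iv : dot c (p i) = 1 - d by apply/eqP; rewrite eq_sym subr_eq cd ?iS' // (subsetP SS').
  exists c; apply/seteqP; split=> [x xS'|x [/hullP[a [a0 aS a1 ->]] xmax]].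
    split; first exact: hull_sub xS'.
    case/hullP: xS' => a [a0 aS' a1 ->] y /hullP[b [b0 bS b1 ->]].
    have aS j : j \notin S -> a j = 0.
      by move=> jS; apply: aS'; apply: contra jS; apply: (subsetP SS').
    rewrite !val // lerD2r.
    have -> : \sum_(j in S') a j = 1.
      by rewrite -a1 [RHS](bigID (mem S')) /= [X in _ + X]big1 ?addr0.
    by rewrite -b1 [leRHS](bigID (mem S')) /= lerDl sumr_ge0.
  have := xmax _ (hull_vertex (subsetP SS' i iS')); rewrite val // iv lerD2r => le.
  apply/hullP; exists a; split=> // j jS'.
  move: le; rewrite -a1 [leLHS](bigID (mem S')) /= gerDl => le.
  have : \sum_(i | i \notin S') a i == 0 by rewrite eq_le le sumr_ge0.
  rewrite psumr_eq0 // => /allP/(_ j (mem_index_enum j)).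
  by rewrite /= jS' => /eqP.
Qed.

Lemma simplex_hull S : affinely_independent S p -> simplex (hull S).
Proof.
move=> Si; exists #|S|, (fun j => p (enum_val j)); split.
  move=> c c0 cp j _.
  pose b i := \sum_(j | enum_val j == i) c j.
  have bE k : b (enum_val k) = c k.
    by rewrite /b (big_pred1 k) // => l; rewrite /= (inj_eq enum_val_inj).
  rewrite -bE; apply: (Si b) (enum_valP j).
    rewrite big_enum_val -[RHS]c0; apply: eq_big => [i|i _]; rewrite ?inE //.
  rewrite (big_enum_val (fun i => b i *: p i)) -[RHS]cp.
  by apply: eq_big => [i|i _]; rewrite ?inE // bE.
rewrite /hull; congr conv; apply/seteqP; split=> x.
  case=> i /= iS <-; exists (enum_rank_in iS i) => //.
  by rewrite enum_rankK_in.
by case=> j _ <-; exists (enum_val j) => //=; apply: enum_valP.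
Qed.

End Simplices.

(** * The triangulation of the root polytope *)

Section RootTriangulation.
Local Open Scope classical_set_scope.
Local Open Scope ring_scope.
Variables (R : realFieldType) (m : nat).
Implicit Types (S : {set option ('I_m * 'I_m)}) (T G E : graph m).

(** [None] indexes the origin, so that a simplex with or without the vertex 0 is a set over one
    index type. *)
Definition root_point (i : option ('I_m * 'I_m)) : 'rV[R]_m :=
  if i is Some e then rootv R e else 0.

Definition vertices T : {set option ('I_m * 'I_m)} :=
  [set i | if i is Some e then e \in T else true]%SET.

Definition edges S : graph m := [set e | Some e \in S]%SET.

Lemma Some_vertices T e : (Some e \in vertices T) = (e \in T).
Proof. by rewrite inE. Qed.

Lemma edges_vertices T : edges (vertices T) = T.
Proof. by apply/setP => e; rewrite !inE. Qed.

Lemma sub_vertices S T : (S \subset vertices T) = (edges S \subset T).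
Proof.
apply/subsetP/subsetP => [ST e|ST [e|] iS]; rewrite !inE //.
  by move/ST; rewrite inE.
by apply: ST; rewrite inE.
Qed.

Lemma sum_root_point (c : option ('I_m * 'I_m) -> R) :
  \sum_i c i *: root_point i = \sum_e c (Some e) *: rootv R e.
Proof.
rewrite (bigD1 None) //= scaler0 add0r.
rewrite (reindex_omap Some id) /=; last by case.
by apply: eq_bigl => e; rewrite eqxx.
Qed.

Lemma sum_option (c : option ('I_m * 'I_m) -> R) :
  \sum_i c i = c None + \sum_e c (Some e).
Proof.
rewrite (bigD1 None) //=; congr (_ + _).
rewrite (reindex_omap Some id) /=; last by case.
by apply: eq_bigl => e; rewrite eqxx.
Qed.

Lemma free_affinely_independent S :
  conflict_free (edges S) -> increasing (edges S) -> affinely_independent S root_point.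
Proof.
move=> Sf Si c c0 cp.
pose b i := if i \in S then c i else 0.
have bS e : b (Some e) != 0 -> e \in edges S.
  by rewrite /b inE; case: ifP => //; rewrite eqxx.
have be : forall e, b (Some e) = 0.
  apply: (free_independent Sf Si bS); rewrite -sum_root_point -[RHS]cp.
  rewrite [RHS]big_mkcond; apply: eq_bigr => i _.
  by rewrite /b; case: ifP => // _; rewrite scale0r.
have b0 : b None = 0.
  have : \sum_i b i = 0 by rewrite -[RHS]c0 [RHS]big_mkcond.
  by rewrite sum_option big1 ?addr0 // => e _; apply: be.
move=> i iS; have -> : c i = b i by rewrite /b iS.
by case: i {iS} => [e|]; rewrite ?be.
Qed.

(** The coefficients at the edges agree by [free_sum_unique], and the one at the origin is what is
    missing to total mass 1. *)
Lemma hull_free_inter S S' :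
    conflict_free (edges S) -> increasing (edges S) ->
    conflict_free (edges S') -> increasing (edges S') ->
  hull root_point S `&` hull root_point S' = hull root_point (S :&: S')%SET.
Proof.
move=> Sf Si S'f S'i; apply/seteqP; split=> [x []|x xSS'].
  case/hullP=> a [a0 aS a1 ->] /hullP[b [b0 bS b1]].
  rewrite !sum_root_point => ab.
  have abe e : a (Some e) = b (Some e).
    apply: (free_sum_unique Sf Si S'f S'i (c := a \o Some) (d := b \o Some)) ab e => //= e.
    - by rewrite inE => ae; apply/negPn/negP => /aS a_0; rewrite a_0 eqxx in ae.
    - by rewrite inE => be; apply/negPn/negP => /bS b_0; rewrite b_0 eqxx in be.
  have abi i : a i = b i.
    case: i => [e|]; [exact: abe | move: b1]; rewrite -a1 !sum_option.
    have -> : \sum_e b (Some e) = \sum_e a (Some e).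
      by apply: eq_bigr => e _; rewrite abe.
    by move/addIr.
  apply/hullP; exists a; split=> // [i|]; last by rewrite sum_root_point.
  by rewrite inE negb_and => /orP[/aS //|/bS <-].
by split; move: xSS'; apply: hull_sub; [apply: subsetIl | apply: subsetIr].
Qed.

Lemma free_singleton (e : 'I_m * 'I_m) : conflict_free [set e]%SET.
Proof. by move=> f g; rewrite !inE => /eqP-> /eqP->; rewrite /conflict ltnn. Qed.

(** A root represents itself by a single edge, which is conflict-free; uniqueness does the rest. *)
Lemma root_in_free T (d : 'I_m * 'I_m -> R) (e : 'I_m * 'I_m) :
    conflict_free T -> increasing T -> (forall f, 0 <= d f) ->
    (forall f, d f != 0 -> f \in T) -> (e.1 < e.2)%N ->
  \sum_f d f *: rootv R f = rootv R e -> e \in T.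
Proof.
move=> Tf Ti d0 dT elt dE; apply: (dT).
have -> : d e = (e == e)%:R.
  apply: (free_sum_unique Tf Ti (@free_singleton e) (c := d) (d := fun f => (f == e)%:R)) => //.
  - by move=> f; rewrite inE => /eqP->.
  - by move=> f; rewrite inE pnatr_eq0 eqb0 negbK.
  - rewrite dE (bigD1 e) //= eqxx scale1r big1 ?addr0 // => f /negbTE ->.
    exact: scale0r.
by rewrite eqxx oner_eq0.
Qed.

Lemma root_coneP G x : root_cone G x -> exists c : 'I_m * 'I_m -> R,
  [/\ forall e, 0 <= c e,
      forall e : 'I_m * 'I_m, c e != 0 -> e \in G /\ (e.1 < e.2)%N
    & x = \sum_e c e *: rootv R e].
Proof.
case=> c [c0 ->]; exists (fun e => if (e \in G) && (e.1 < e.2)%N then c e else 0).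
split=> [e|e|]; first by case: ifP.
  by case: ifP => [/andP[]//|]; rewrite eqxx.
rewrite big_mkcond; apply: eq_bigr => e _.
by case: ifP => //; rewrite scale0r.
Qed.

Lemma root_cone_sum G (s : seq ('I_m * 'I_m)) :
  (forall e, e \in s -> e \in G /\ (e.1 < e.2)%N) ->
  root_cone G (\sum_(e <- s) rootv R e).
Proof.
elim: s => [|e s IHs] sG.
  exists (fun=> 0); split=> //; rewrite big_nil big1 // => e _; exact: scale0r.
have [c [c0 cE]] := IHs (fun f fs => sG f (mem_behead (s := e :: s) fs)).
exists (fun f => (f == e)%:R + c f); split=> [f|].
  by rewrite addr_ge0 ?ler0n.
rewrite big_cons cE; under [RHS]eq_bigr do rewrite scalerDl.
rewrite big_split /=; congr (_ + _).
have [eG lte] := sG e (mem_head _ _).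
rewrite (bigD1 e) /= ?eG //= eqxx scale1r big1 ?addr0 // => f /andP[_ /negbTE ->].
exact: scale0r.
Qed.

Lemma closure_root_cone G (e : 'I_m * 'I_m) :
  e \in transitive_closure G -> root_cone G (rootv R e).
Proof.
rewrite inE => /andP[_ /connectP[p]]; case: e => x y /=.
move=> pP yE; suff [s sG ->] : exists2 s : seq ('I_m * 'I_m),
    (forall e : 'I_m * 'I_m, e \in s -> e \in G /\ (e.1 < e.2)%N) &
    rootv R (x, y) = \sum_(e <- s) rootv R e by apply: root_cone_sum.
elim: p x pP yE => [|z p IHp] x /=.
  by move=> _ ->; exists [::]; rewrite ?big_nil // /rootv /simple_diff subrr.
case/andP=> /andP[xz xzG] /IHp/[apply] -[s sG sE].
exists ((x, z) :: s) => [e|]; first by rewrite inE => /predU1P[->//|/sG].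
by rewrite big_cons -sE /rootv /simple_diff /= addrA subrK.
Qed.

Lemma sub_closure G (e : 'I_m * 'I_m) :
  e \in G -> (e.1 < e.2)%N -> e \in transitive_closure G.
Proof.
move=> eG lte; rewrite inE lte /=; apply: connect1.
by rewrite /= lte -surjective_pairing.
Qed.

Lemma closure_increasing G : increasing (transitive_closure G).
Proof. by move=> e; rewrite inE => /andP[]. Qed.

(** A root in the cone has a conflict-free representation inside the closure, and by [root_in_free]
    the root is then one of its edges. *)
Lemma root_points_closure G : exchange_closed (transitive_closure G) ->
  root_points R G = root_point @` [set` vertices (transitive_closure G)].
Proof.
move=> Ex; apply/seteqP; split=> x; last first.
  case=> -[e|] /=; rewrite inE => eG <-; last by left.
  right; exists e.1, e.2; split=> //; last exact: closure_root_cone.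
  exact: closure_increasing eG.
case=> [->|[i [j [ltij xE xG]]]]; first by exists None; rewrite //= inE.
exists (Some (i, j)) => //=; rewrite inE.
have [c [c0 cG cE]] := root_coneP xG.
have [|T [d [TE Tf d0 dT dE]]] :=
    cone_free_representation (@closure_increasing G) Ex c0 (c := c).
  by move=> e /cG[]; apply: sub_closure.
apply: (subsetP TE); apply: (root_in_free Tf _ d0 dT) => //.
  exact: increasing_sub TE (@closure_increasing G).
by rewrite dE -cE xE.
Qed.

Lemma root_points_free T : conflict_free T -> increasing T ->
  root_points R T = root_point @` [set` vertices T].
Proof.
move=> Tf Ti; apply/seteqP; split=> x; last first.
  case=> -[e|] /=; rewrite inE => eT <-; last by left.
  right; exists e.1, e.2; split=> //; first exact: Ti.
  by apply: closure_root_cone; apply: sub_closure => //; apply: Ti.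
case=> [->|[i [j [ltij xE xG]]]]; first by exists None; rewrite //= inE.
exists (Some (i, j)) => //=; rewrite inE.
have [c [c0 cG cE]] := root_coneP xG.
apply: (root_in_free Tf Ti c0 _ (e := (i, j))) => //; first by move=> f /cG[].
by rewrite -cE xE.
Qed.

(* The indicator of the sources of [T] takes the value [1] on the edges of [T]
   and at most [1] on every root, so a representation supported on [T] has the
   least total mass. *)
Lemma free_mass_le T (c d : 'I_m * 'I_m -> R) :
    conflict_free T -> increasing T -> (forall e, 0 <= c e) ->
    (forall e, d e != 0 -> e \in T) ->
    \sum_e d e *: rootv R e = \sum_e c e *: rootv R e ->
  \sum_e d e <= \sum_e c e.
Proof.
move=> Tf Ti c0 dT dc.
pose src (v : 'I_m) := [exists e in T, e.1 == v].
pose w : 'rV[R]_m := \row_v (src v)%:R.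
have -> : \sum_e d e = dot w (\sum_e d e *: rootv R e).
  rewrite dot_sum; apply: eq_bigr => e _; rewrite dot_root !mxE.
  have [->|/dT eT] := eqVneq (d e) 0; first by rewrite mul0r.
  have -> : src e.1 by apply/existsP; exists e; rewrite eT eqxx.
  suff /negbTE -> : ~~ src e.2 by rewrite subr0 mulr1.
  apply/negP => /existsP[f /andP[fT /eqP fe]].
  have := Tf e f eT fT; rewrite /conflict fe leqnn andbT Ti //=.
  by have := Ti f fT; rewrite fe => ->.
rewrite dc dot_sum; apply: ler_sum => e _.
rewrite dot_root !mxE -[leRHS]mulr1 ler_wpM2l //.
by case: (src _) (src _) => [] [] /=;
  rewrite ?subrr ?subr0 ?sub0r ?lexx ?ler01 ?lerN10 // (le_trans (lerN10 _)) ?ler01.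
Qed.

(** A quadratic form on the whole space whose value at the root of [(i, j)] is [-(j - i)^2] and at
    the origin 0. *)
Definition height (x : 'rV[R]_m) : R := - (dot (\row_i (i : nat)%:R) x) ^+ 2.

Lemma height_root (e : 'I_m * 'I_m) :
  height (rootv R e) = - ((e.2%:Z - e.1%:Z) ^+ 2)%:~R.
Proof. by rewrite /height dot_root !mxE rmorphXn rmorphB /= !pmulrn -sqrrN opprB. Qed.

Lemma height0 : height 0 = 0.
Proof. by rewrite /height dot0 expr0n oppr0. Qed.

Lemma ex_pos_lower_bound (I : finType) (f : I -> R) : (forall i, 0 < f i) ->
  exists2 eps, 0 < eps & forall i, eps <= f i.
Proof.
move=> f0; have [eps eps0 epsP] : exists2 eps, 0 < eps &
    forall i, i \in enum I -> eps <= f i.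
  elim: (enum I) => [|i s [eps eps0 epsP]]; first by exists 1.
  exists (Num.min (f i) eps); first by rewrite lt_min f0.
  by move=> j; rewrite inE ge_min => /predU1P[->|/epsP ->]; rewrite ?lexx ?orbT.
by exists eps => // i; apply: epsP; rewrite mem_enum.
Qed.

Section Closed.
Variable G : graph m.
Let E := transitive_closure G.
Hypotheses (Ex : exchange_closed E) (Ec : connected E).

Let Ei : increasing E := @closure_increasing G.

Definition free_simplex S : Prop := edges S \subset E /\ conflict_free (edges S).

Lemma free_simplex_increasing S : free_simplex S -> increasing (edges S).
Proof. by case=> SE _; apply: increasing_sub SE Ei. Qed.

Lemma free_simplex_sub S S' : S \subset S' -> free_simplex S' -> free_simplex S.
Proof.
move=> SS' [S'E S'f].
have sub : edges S \subset edges S'.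
  by apply/subsetP => e; rewrite !inE; apply: (subsetP SS').
by split; [apply: subset_trans S'E | apply: conflict_free_sub S'f].
Qed.

Lemma free_simplex_independent S : free_simplex S -> affinely_independent S root_point.
Proof.
move=> Ss; apply: free_affinely_independent; first by case: Ss.
exact: free_simplex_increasing.
Qed.

Lemma free_simplex_extend S : free_simplex S -> exists T,
  [/\ S \subset vertices T, free_simplex (vertices T), connected T & T \subset E].
Proof.
case=> SE Sf; have [T [ST TE Tf Tc]] := free_extension Ei Ex Ec SE Sf.
by exists T; rewrite sub_vertices /free_simplex edges_vertices.
Qed.

(** A face of the simplex of a tree arises by discarding some edges and possibly the origin;
    conversely, every conflict-free set of edges of the closure extends to a conflict-free spanning
    tree. *)
Lemma canonical_triangulationE : canonical_triangulation R G =
  [set hull root_point S | S in free_simplex].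
Proof.
apply/seteqP; split=> F.
  case=> T [TE _ Tn Ta]; have Ti := increasing_sub TE Ei.
  have Tf : conflict_free T by apply/conflict_freeP.
  have Ts : free_simplex (vertices T) by split; rewrite edges_vertices.
  rewrite /root_polytope root_points_free //.
  move=> /(faces_of_hull _ (free_simplex_independent Ts))[S ST ->].
  by exists S => //; apply: free_simplex_sub ST Ts.
case=> S Ss <-; have [T [ST Ts Tc TE]] := free_simplex_extend Ss.
have Ti := increasing_sub TE Ei; have Tf : conflict_free T.
  by case: Ts; rewrite edges_vertices.
have [Tn Ta] := (conflict_freeP Ti).1 Tf.
exists T; split=> //.
  by split=> // c; apply: free_acyclic.
rewrite /root_polytope root_points_free //.
by apply/(faces_of_hull _ (free_simplex_independent Ts)); exists S.
Qed.

(** By [free_mass_le] passing to a conflict-free representation does not raise the total mass above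
    1; the rest is put on the origin. *)
Lemma free_simplices_cover x : root_polytope R G x ->
  exists2 S, free_simplex S & hull root_point S x.
Proof.
rewrite /root_polytope (root_points_closure Ex) => /hullP[a [a0 aV a1]].
rewrite sum_root_point => xE.
have [|T [d [TE Tf d0 dT dE]]] :=
    @cone_free_representation R m E (a \o Some) Ei Ex (fun e => a0 (Some e)).
  by move=> e /= ae; apply: contraNT ae => eE; apply/eqP/aV; rewrite inE.
have dle : \sum_e d e <= 1.
  apply: le_trans (free_mass_le Tf (increasing_sub TE Ei) _ dT dE) _ => [e|].
    exact: a0.
  by rewrite -a1 sum_option lerDr.
exists (vertices T); first by split; rewrite edges_vertices.
apply/hullP; exists (fun i => if i is Some e then d e else 1 - \sum_e d e).
split=> [[e|]|[e|]||] //.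
- by rewrite subr_ge0.
- by rewrite inE => eT; apply/eqP/negPn/negP => /dT; apply/negP.
- by rewrite inE.
- by rewrite sum_option subrK.
- by rewrite sum_root_point xE -dE.
Qed.

(** The potential of [S] supports the lifting along the simplex [V] of its tight edges and the
    origin. As [V] is affinely independent, some affine function is 0 on [S] and 1 on the rest of
    [V]; subtracting a small multiple of it lifts the contact off that rest. This also removes the
    origin when it is not in [S]. *)
Lemma free_simplex_lower S : free_simplex S ->
  lower_face (root_points R G) height (root_point @` [set` S]).
Proof.
move=> [SE Sf]; have [u [u0 uS]] := potential Sf.
have Si := increasing_sub SE Ei.
pose V : {set option ('I_m * 'I_m)} := vertices (E :&: tight m u)%SET.
have Vs : free_simplex V.
  split; rewrite edges_vertices; first exact: subsetIl.
  exact: conflict_free_sub (subsetIr _ _) (tight_free u0).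
have SV : S \subset V.
  rewrite sub_vertices; apply/subsetP => e eS.
  rewrite in_setI (subsetP SE e eS) [e \in tight _ _]inE Si //=.
  by rewrite uS ?eqxx ?Si.
have [c1 [d1 cd1]] := affine_extension (fun i => (i \notin S)%:R)
  (free_simplex_independent Vs).
pose c0 : 'rV[R]_m := \row_i (u i)%:~R.
pose gap i := height (root_point i) - dot c0 (root_point i).
have gapE e : gap (Some e) = (slack u e.1 e.2)%:~R.
  by rewrite /gap height_root dot_root !mxE /slack !rmorphB /=; ring.
have gap0 : gap None = 0 by rewrite /gap height0 dot0 subr0.
have gapV i : i \in V -> gap i = 0.
  case: i => [e|//]; rewrite Some_vertices gapE in_setI.
  by rewrite [e \in tight _ _]inE => /andP[_ /andP[_ /eqP ->]].
have gapNV i : i \in vertices E -> i \notin V -> 0 < gap i.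
  case: i => [e|]; last by rewrite !inE.
  rewrite !Some_vertices gapE => eE; rewrite in_setI eE [e \in tight _ _]inE (Ei eE) /= => ne.
  by rewrite ltr0z lt_def ne u0 // Ei.
pose psi i := dot c1 (root_point i) + d1.
(* Outside [V] this bound keeps [eps * |psi i|] below the gap; the value 1 elsewhere is a filler. *)
pose f i := if (i \in vertices E) && (i \notin V) then gap i / (`|psi i| + 1) else 1.
have norm1 i : 0 < `|psi i| + 1 by rewrite ltr_wpDl.
have [i|eps eps0 epsP] := @ex_pos_lower_bound _ f.
  by rewrite /f; case: ifP => // /andP[iE iV]; rewrite divr_gt0 // gapNV.
have lowE i : dot (c0 - eps *: c1) (root_point i) - eps * d1 =
    height (root_point i) - (gap i + eps * psi i).
  have -> : dot (c0 - eps *: c1) (root_point i) =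
      dot c0 (root_point i) - eps * dot c1 (root_point i).
    rewrite /dot mulr_sumr -sumrB; apply: eq_bigr => k _; rewrite !mxE; ring.
  by rewrite /gap /psi; ring.
have low i : i \in vertices E -> 0 <= gap i + eps * psi i ?= iff (i \in S).
  move=> iE; have [iV|iV] := boolP (i \in V).
    rewrite /psi gapV // add0r cd1 //; split; case: (i \in S) => /=.
    - by rewrite mulr0.
    - by rewrite mulr1 ltW.
    - by rewrite mulr0 eqxx.
    - by rewrite mulr1 eq_sym gt_eqF.
  have -> : (i \in S) = false by apply/negbTE; apply: contra iV; apply: (subsetP SV).
  suff h : 0 < gap i + eps * psi i by split; [exact: ltW | rewrite eq_sym gt_eqF].
  have := epsP i; rewrite /f iE iV /= ler_pdivlMr // => le.
  have : - (eps * `|psi i|) <= eps * psi i.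
    by rewrite -mulrN ler_pM2l // lerNl -normrN ler_norm.
  have := mulr_gt0 eps0 (norm1 i); rewrite mulrDr mulr1 in le *.
  by move: eps0 le => *; lra.
exists (c0 - eps *: c1), (- (eps * d1)); rewrite (root_points_closure Ex); split.
  move=> _ [i /= iE <-]; rewrite lowE gerBl; by case: (low i iE).
apply/seteqP; split=> x.
  case=> i /= iS <-; have iE : i \in vertices E.
    by apply: subsetP iS; rewrite sub_vertices.
  split; first by exists i.
  rewrite lowE; have [_] := low i iE; rewrite iS => /eqP <-.
  by rewrite subr0.
case=> -[i /= iE <-]; rewrite lowE => /eqP; rewrite subr_eq addrC -subr_eq subrr.
by have [_ ->] := low i iE => iS; exists i.
Qed.

Lemma lower_free_simplex (F : set 'rV[R]_m) :
  lower_face (root_points R G) height F ->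
  exists2 S, free_simplex S & F = root_point @` [set` S].
Proof.
case=> c [d]; rewrite (root_points_closure Ex) => -[low ->].
pose S := [set i in vertices E | dot c (root_point i) + d == height (root_point i)]%SET.
have inE' e : e \in E -> dot c (rootv R e) + d <= height (rootv R e).
  by move=> eE; apply: low; exists (Some e) => //=; rewrite inE.
have in0 : dot c 0 + d <= height 0 by apply: low; exists None; rewrite //= inE.
exists S; last first.
  apply/seteqP; split=> x.
    by case=> -[i /= iE <-] /eqP eq; exists i => //=; rewrite inE iE.
  by case=> i /=; rewrite inE => /andP[iE /eqP eq] <-; split; first by exists i.
have inS e : (e \in edges S) =
    (e \in E) && (dot c (rootv R e) + d == height (rootv R e)).
  by rewrite [LHS]inE [LHS]inE Some_vertices.
split; first by apply/subsetP => e; rewrite inS => /andP[].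
move=> e f; rewrite !inS => /andP[eE /eqP se] /andP[fE /eqP sf].
apply/negP => ef; have [efE feE] := Ex eE fE ef.
case/andP: (ef) => c1 c2; case/andP: (c1) => _ c3.
have toR (a b a' b' : int) : a + b < a' + b' ->
    a%:~R + b%:~R < a'%:~R + b'%:~R :> R by rewrite -(ltr_int R) !intrD.
(* For the zero potential the slack of a pair is the height of its root. *)
have /toR := slack_uncross (fun=> 0) c1 c2.
have slE i j : (slack (fun=> 0) i j)%:~R = - ((j%:Z - i%:Z) ^+ 2)%:~R :> R.
  by rewrite /slack subrr sub0r rmorphN.
rewrite !slE -!height_root -se -sf.
have := inE' _ efE; rewrite !height_root /= => l1.
move: c3; rewrite leq_eqVlt => /orP[/eqP c3|/feE/inE'].
  (* The edges share a vertex: the inner root of the exchange is 0, and the origin supplies the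
     missing inequality. *)
  move: in0; rewrite height0 dot0 add0r => d0.
  rewrite c3 subrr expr0n oppr0 addr0 !dot_root in l1 *.
  have -> : c 0 f.1 = c 0 e.2 by congr (c 0 _); apply/val_inj.
  by rewrite /= in l1 *; lra.
by rewrite height_root !dot_root /= in l1 * => l2; lra.
Qed.

Theorem regular_canonical_triangulation :
  regular_triangulation (root_points R G) (canonical_triangulation R G).
Proof.
rewrite canonical_triangulationE; split; last first.
  exists height; apply/seteqP; split=> F.
    case=> S Ss <-; exists (root_point @` [set` S]) => //.
    exact: free_simplex_lower.
  by case=> _ /lower_free_simplex[S Ss ->] <-; exists S.
split; first split.
- by apply: finite_image; apply: finite_finset.
- by move=> _ [S Ss <-]; apply: simplex_hull; apply: free_simplex_independent.
- move=> _ F' [S Ss <-] /(faces_of_hull _ (free_simplex_independent Ss))[S' S'S ->].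
  by exists S' => //; apply: free_simplex_sub Ss.
- move=> _ _ [S Ss <-] [S' S's <-].
  have Si := free_simplex_increasing Ss; have S'i := free_simplex_increasing S's.
  rewrite hull_free_inter //; [|by case: Ss|by case: S's].
  split; apply/faces_of_hull; try exact: free_simplex_independent.
    by exists (S :&: S')%SET => //; apply: subsetIl.
  by exists (S :&: S')%SET => //; apply: subsetIr.
apply/seteqP; split=> x.
  case=> _ [S Ss <-]; rewrite (root_points_closure Ex); apply: hull_sub.
  by rewrite sub_vertices; case: Ss.
by move=> /free_simplices_cover[S Ss xS]; exists (hull root_point S) => //; exists S.
Qed.

End Closed.
End RootTriangulation.

(** * From conflict-free simplices to an abstract complex *)

Section Realization.
Local Open Scope classical_set_scope.
Local Open Scope ring_scope.
Variables (R : realFieldType) (m : nat) (V : finType) (G : graph m).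
Variables (C : {set {set V}}) (U : {set V}) (g : V -> option ('I_m * 'I_m)).

Lemma affinely_independent_imset (S : {set V}) : {in S &, injective g} ->
  affinely_independent (g @: S)%SET (@root_point R m) ->
    affinely_independent S (@root_point R m \o g).
Proof.
move=> gi gS c c0 cp.
pose b i := if [pick v in S | g v == i] is Some v then c v else 0.
have bE v : v \in S -> b (g v) = c v.
  rewrite /b => vS; case: pickP => [w /andP[wS /eqP gwv]|/(_ v)].
    by rewrite (gi w v).
  by rewrite vS eqxx.
move=> v vS; rewrite -bE //; apply: gS (imset_f g vS).
  by rewrite big_imset //= -[RHS]c0; apply: eq_bigr => w /bE.
rewrite (big_imset (fun i => b i *: root_point R i)) //= -[RHS]cp.
by apply: eq_bigr => w /bE ->.
Qed.

(** What is left to combinatorics: a vertex map that carries the faces of [C] onto the conflict-free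
    simplices. Injectivity is asked on [U] only, because the vertex type of the double cone contains
    all boxes of the grid. *)
Lemma canonical_triangulation_realizes :
    exchange_closed (transitive_closure G) -> connected (transitive_closure G) ->
    {in U &, injective g} -> (forall S, S \in C -> S \subset U) ->
    (forall S, S \in C -> free_simplex G (g @: S)%SET) ->
    (forall S', free_simplex G S' -> exists2 S, S \in C & S' = (g @: S)%SET) ->
  geometric_realization (canonical_triangulation R G) C.
Proof.
move=> Ex Ec gi CU Cg gC; rewrite canonical_triangulationE //.
have giS S : S \in C -> {in S &, injective g}.
  by move=> /CU/subsetP SU v w vS wS; apply: gi; apply: SU.
have convE (S : {set V}) :
    conv ((@root_point R m \o g) @` [set` S]) = hull (@root_point R m) (g @: S)%SET.
  rewrite /hull; congr conv; apply/seteqP; split=> x.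
    by case=> v /= vS <-; exists (g v) => //=; apply: imset_f.
  by case=> i /= /imsetP[v vS ->] <-; exists v.
exists (@root_point R m \o g); split.
- move=> S SC; apply: affinely_independent_imset; first exact: giS.
  exact/free_simplex_independent/Cg.
- move=> S S' SC S'C; rewrite !convE.
  have fS := Cg S SC; have fS' := Cg S' S'C.
  rewrite hull_free_inter.
  + rewrite imsetI // => v w vS wS'; apply: gi.
      exact: (subsetP (CU S SC)).
    exact: (subsetP (CU S' S'C)).
  + by case: fS.
  + exact: free_simplex_increasing fS.
  + by case: fS'.
  + exact: free_simplex_increasing fS'.
- apply/seteqP; split=> F.
    by case=> S' /gC[S SC ->] <-; exists S => //=; rewrite convE.
  by case=> S /= SC <-; rewrite convE; exists (g @: S)%SET => //; apply: Cg.
Qed.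

End Realization.

(** * The diagram and the core region *)

Section Shape.
Variables (n : nat) (pi : 'S_n.+1).

Lemma is_crossE (X : {set box n}) (p : box n) : is_cross X p.1 p.2 = (p \in X).
Proof.
apply/existsP/idP => [[q /and3P[qX /eqP/val_inj q1 /eqP/val_inj q2]]|pX].
  by case: p q qX q1 q2 => [? ?] [? ?] /= qX <- <-.
by exists p; rewrite pX !eqxx.
Qed.

Lemma is_cross_ord (X : {set box n}) (a b : nat) :
  is_cross X a b -> exists p : box n, [/\ p \in X, p.1 = a :> nat & p.2 = b :> nat].
Proof. by case/existsP=> p /and3P[pX /eqP pa /eqP pb]; exists p. Qed.

(** The diagram as a predicate on natural numbers, false off the grid, so that neighbouring rows and
    columns can be named without bounds. *)
Definition dg (a b : nat) : bool := is_cross (diagram pi) a b.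

Lemma mem_diagram (a b : 'I_n.+1) :
  ((a, b) \in diagram pi) = (a < pi b) && (b < (pi^-1)%g a).
Proof.
rewrite inE; apply/existsP/andP => [[i /existsP[j /and3P[ij ji /eqP[-> ->]]]]|[ab ba]].
  by rewrite permK.
by exists b; apply/existsP; exists ((pi^-1)%g a); rewrite permKV ba ab eqxx.
Qed.

Lemma dg_ord (a b : nat) : dg a b -> exists i j : 'I_n.+1,
  [/\ a = i, b = j, i < pi j & j < (pi^-1)%g i].
Proof.
case/is_cross_ord=> -[i j] [ijD /= <- <-]; exists i, j.
by move: ijD; rewrite mem_diagram => /andP[].
Qed.

Lemma ord_dg (i j : 'I_n.+1) : i < pi j -> j < (pi^-1)%g i -> dg i j.
Proof. by move=> ij ji; rewrite /dg -/((i, j).1) -/((i, j).2) is_crossE mem_diagram ij. Qed.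

Hypotheses (pi0 : pi ord0 = ord0) (pi_dom : dominant_tail pi).

Lemma dg_gt0 (a b : nat) : dg a b -> 0 < a /\ 0 < b.
Proof.
case/dg_ord=> i [j [-> -> ij ji]]; split; rewrite lt0n; apply/eqP.
  move=> i0; have ei : i = ord0 by apply/val_inj.
  by move: ji; rewrite ei -{1}pi0 permK.
move=> j0; have ej : j = ord0 by apply/val_inj.
by move: ij; rewrite ej pi0.
Qed.

(** A box missing to the left or above would leave a 132 pattern. If [pi j' < i], it sits at the
    positions [j'], [j] and that of [i]; if the value [i'] stands before position [j], it is formed
    by [i'], [pi j] and [i]. *)
Lemma dg_sub (a b a' b' : nat) : dg a b -> 0 < a' <= a -> 0 < b' <= b -> dg a' b'.
Proof.
have left (i j j' : 'I_n.+1) : i < pi j -> j < (pi^-1)%g i -> 0 < j' -> j' < j ->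
    i < pi j'.
  move=> ij ji j'0 j'j; rewrite ltnNge; apply/negP => j'i.
  have := pi_dom j'0 j'j ji; rewrite permKV ij andbT; case/negP.
  rewrite ltn_neqAle j'i andbT; apply/eqP => /val_inj E.
  by move: ji; rewrite -E permK ltnNge ltnW.
have up (i i' j : 'I_n.+1) : i < pi j -> j < (pi^-1)%g i -> 0 < i' -> i' < i ->
    j < (pi^-1)%g i'.
  move=> ij ji i'0 i'i; rewrite ltnNge; apply/negP => i'j.
  have lt : (pi^-1)%g i' < j.
    rewrite ltn_neqAle i'j andbT; apply/eqP => /val_inj E.
    by move: ij; rewrite -E permKV ltnNge ltnW.
  have gt0 : 0 < (pi^-1)%g i'.
    rewrite lt0n; apply/eqP => E; have {}E : (pi^-1)%g i' = ord0 by apply/val_inj.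
    have : i' = ord0 by rewrite -pi0 -E permKV.
    by move=> i'E; rewrite i'E in i'0.
  by have := pi_dom gt0 lt ji; rewrite !permKV ij i'i.
move=> /dg_ord[i [j [-> -> ij ji]]] /andP[a'0 a'i] /andP[b'0 b'j].
have [j' j'E] : exists j' : 'I_n.+1, b' = j'.
  by exists (Ordinal (leq_ltn_trans b'j (ltn_ord j))).
have [i' i'E] : exists i' : 'I_n.+1, a' = i'.
  by exists (Ordinal (leq_ltn_trans a'i (ltn_ord i))).
subst a' b'.
have ij' : i < pi j'.
  move: b'j; rewrite leq_eqVlt => /orP[/eqP/val_inj->//|/(left i j j' ij ji b'0)//].
have j'i : j' < (pi^-1)%g i by apply: leq_ltn_trans ji.
move: a'i; rewrite leq_eqVlt => /orP[/eqP/val_inj->|i'i]; first exact: ord_dg.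
apply: ord_dg; first exact: ltn_trans ij'.
exact: (up i).
Qed.

Lemma card_interval (k : nat) : k <= n -> #|[set c : 'I_n.+1 | 0 < c <= k]| = k.
Proof.
move=> kn; rewrite -[RHS](card_ord k).
have lt (c : 'I_k) : c.+1 < n.+1 by rewrite ltnS (leq_trans (ltn_ord c)).
pose f (c : 'I_k) : 'I_n.+1 := Ordinal (lt c).
have fi : injective f by move=> c d /(congr1 val)/= [] /val_inj.
rewrite -(card_imset _ fi); apply: eq_card => c; rewrite inE.
apply/andP/imsetP => [[c0 ck]|[d _ ->]] /=; last by rewrite ltn_ord.
have ck' : c.-1 < k by rewrite prednK.
by exists (Ordinal ck') => //; apply/val_inj; rewrite /= prednK.
Qed.

(** The columns 1 to [b] carry [b] different values above [a], and there are only [n - a] such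
    values. *)
Lemma dg_bound (a b : nat) : dg a b -> a + b <= n.
Proof.
move=> ab; have [i [j [aE bE ij ji]]] := dg_ord ab.
have bn : b <= n by rewrite bE -ltnS.
have an : a <= n by rewrite aE -ltnS.
have : pi @: [set c : 'I_n.+1 | 0 < c <= b] \subset ~: [set c : 'I_n.+1 | c <= a].
  apply/subsetP => _ /imsetP[c + ->]; rewrite !inE -ltnNge => /andP[c0 cb].
  have [a0 _] := dg_gt0 ab.
  have := @dg_sub a b a c ab; rewrite a0 leqnn c0 cb => /(_ isT isT).
  by case/dg_ord => i' [j' [-> /val_inj -> +]].
move/subset_leq_card; rewrite card_imset; last exact: perm_inj.
rewrite card_interval // cardsCs setCK card_ord.
have -> : [set c : 'I_n.+1 | c <= a] = ord0 |: [set c : 'I_n.+1 | 0 < c <= a].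
  by apply/setP => c; rewrite !inE -val_eqE /=; case: (c : nat) => //=.
by rewrite cardsU1 inE /= card_interval // add1n subSS; lia.
Qed.

Lemma card_diagram_row (a : 'I_n.+1) :
  #|[set q in diagram pi | q.1 == a]| = #|[set c : 'I_n.+1 | dg a c]|.
Proof.
rewrite -[RHS](card_imset _ (f := fun c => (a, c))); last by move=> c d [].
apply: eq_card => -[i j]; rewrite !inE /=; apply/idP/imsetP => [/andP[ijD /eqP ia]|].
  by exists j; rewrite ?ia // inE -ia /dg -/((i, j).1) -/((i, j).2) is_crossE inE.
case=> c; rewrite inE => + [-> ->]; rewrite eqxx andbT.
by rewrite /dg -/((a, c).1) -/((a, c).2) is_crossE inE.
Qed.

Lemma card_diagram_col (b : 'I_n.+1) :
  #|[set q in diagram pi | q.2 == b]| = #|[set c : 'I_n.+1 | dg c b]|.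
Proof.
rewrite -[RHS](card_imset _ (f := fun c => (c, b))); last by move=> c d [].
apply: eq_card => -[i j]; rewrite !inE /=; apply/idP/imsetP => [/andP[ijD /eqP jb]|].
  by exists i; rewrite ?jb // inE -jb /dg -/((i, j).1) -/((i, j).2) is_crossE inE.
case=> c; rewrite inE => + [-> ->]; rewrite eqxx andbT.
by rewrite /dg -/((c, b).1) -/((c, b).2) is_crossE inE.
Qed.

Lemma card_initial (Q : pred nat) (k : nat) : k <= n ->
    (forall c, Q c -> 0 < c <= n) -> (forall c c', Q c -> 0 < c' <= c -> Q c') ->
  (k < #|[set c : 'I_n.+1 | Q c]|) = Q k.+1.
Proof.
move=> kn Q0 Qsub; apply/idP/idP => [|Qk].
  apply: contraLR => Qk; rewrite -leqNgt -(card_interval kn).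
  apply/subset_leq_card/subsetP => c; rewrite !inE => Qc.
  have /andP[-> _] := Q0 _ Qc; rewrite leqNgt; apply/negP => kc.
  by rewrite (Qsub _ _ Qc) ?kc in Qk.
have /andP[_ kn'] := Q0 _ Qk.
rewrite -{1}(card_interval kn'); apply/subset_leq_card/subsetP => c.
by rewrite !inE; apply: Qsub.
Qed.

(** Nonempty rows of the diagram start in column 1, so left-justifying moves each box by one
    column. *)
Lemma mem_bottom_dream (p : box n) : (p \in bottom_dream pi) = dg p.1 p.2.+1.
Proof.
rewrite inE card_diagram_row (@card_initial (dg p.1)) // ?leq_ord // => [c|c c'] pc.
  have [_ ->] := dg_gt0 pc; have := dg_bound pc; lia.
by move=> c'c; have [a0 b0] := dg_gt0 pc; apply: (dg_sub pc); rewrite ?a0 ?b0 ?leqnn.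
Qed.

Lemma mem_top_dream (p : box n) : (p \in top_dream pi) = dg p.1.+1 p.2.
Proof.
rewrite inE card_diagram_col (@card_initial (dg^~ p.2)) // ?leq_ord // => [c|c c'] pc.
  have [-> _] := dg_gt0 pc; have := dg_bound pc; lia.
by move=> c'c; have [a0 b0] := dg_gt0 pc; apply: (dg_sub pc); rewrite ?a0 ?b0 ?leqnn.
Qed.

Definition rgn (a b : nat) : bool :=
  [|| (a == 0) && (b == 0), dg a b.+1 | dg a.+1 b].

Lemma mem_core_region (p : box n) :
  (p \in core_region pi) = dg p.1 p.2.+1 || dg p.1.+1 p.2.
Proof. by rewrite in_setU mem_bottom_dream mem_top_dream. Qed.

Lemma mem_region (p : box n) : (p \in region pi) = rgn p.1 p.2.
Proof. by rewrite in_setU1 mem_core_region. Qed.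

Lemma rgn_bound (a b : nat) : rgn a b -> a <= n /\ b <= n.
Proof. by case/or3P=> [/andP[/eqP-> /eqP->]//|/dg_bound|/dg_bound]; lia. Qed.

Lemma rgn_ord (a b : nat) : rgn a b ->
  exists p : box n, [/\ p \in region pi, p.1 = a :> nat & p.2 = b :> nat].
Proof.
move=> ab; have [an bn] := rgn_bound ab.
by exists (Ordinal (an : a < n.+1), Ordinal (bn : b < n.+1)); rewrite mem_region.
Qed.

Lemma rgn_sub (a b a' b' : nat) : rgn a b -> a' <= a -> b' <= b -> rgn a' b'.
Proof.
move=> ab a'a b'b; case: a' b' a'a b'b => [|a'] [|b'] // a'a b'b; rewrite /rgn /=.
- case/or3P: ab => [/andP[_ /eqP b0]|ab|ab]; first by rewrite b0 in b'b.
    have [a0 _] := dg_gt0 ab.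
    by rewrite [X in _ || X](dg_sub ab) ?orbT //; lia.
  by rewrite [X in _ || X](dg_sub ab) ?orbT //; lia.
- case/or3P: ab => [/andP[/eqP a0 _]|ab|ab]; first by rewrite a0 in a'a.
    by rewrite (dg_sub ab) //; have [] := dg_gt0 ab; lia.
  by rewrite (dg_sub ab) //; have [] := dg_gt0 ab; lia.
- case/or3P: ab => [/andP[/eqP a0 _]|ab|ab]; first by rewrite a0 in a'a.
    by rewrite (dg_sub ab) //; lia.
  by rewrite [X in _ || X](dg_sub ab) ?orbT //; lia.
Qed.

(** The converse fails at the boxes of the diagram with no box to their right or below. These outer
    corners are the places where an E step takes over the label of the N step before it. *)
Lemma rgn_dg (a b : nat) : rgn a b -> 0 < a -> 0 < b -> dg a b.
Proof.
case/or3P=> [/andP[/eqP-> _]//|ab|ab] a0 b0; apply: dg_sub ab _ _; lia.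
Qed.

Lemma dg_rgn_left (a b : nat) : dg a b -> rgn a b.-1.
Proof. by move=> ab; have [_ b0] := dg_gt0 ab; rewrite /rgn prednK // ab orbT. Qed.

Lemma dg_rgn_up (a b : nat) : dg a b -> rgn a.-1 b.
Proof. by move=> ab; have [a0 _] := dg_gt0 ab; rewrite /rgn prednK // ab !orbT. Qed.

End Shape.

(** * Labels of the boundary steps *)

Lemma count_iotaS (P : pred nat) (N : nat) :
  count P (iota 0 N.+1) = count P (iota 0 N) + P N.
Proof. by rewrite -[N.+1]addn1 iotaD count_cat /= add0n addn0. Qed.

Lemma count_iota_le (P : pred nat) (M N : nat) : M <= N ->
  count P (iota 0 M) <= count P (iota 0 N).
Proof. by move=> /subnKC <-; rewrite iotaD count_cat leq_addr. Qed.

Lemma count_iota_pick (P : pred nat) (N k : nat) : k < count P (iota 0 N) ->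
  exists j, [/\ j < N, P j & count P (iota 0 j.+1) = k.+1].
Proof.
elim: N => // N IHN; rewrite count_iotaS => kN.
have [/IHN[j [jN Pj jE]]|Nk] := ltnP k (count P (iota 0 N)).
  by exists j; split=> //; apply: ltnW.
by exists N; rewrite count_iotaS; split=> //; case: (P N) kN => //= kN; lia.
Qed.

Lemma enum_ord_sorted (k : nat) : sorted (fun i j : 'I_k => i < j) (enum 'I_k).
Proof. by have := iota_ltn_sorted 0 k; rewrite -val_enum_ord sorted_map. Qed.

Section Labels.
Variables (n : nat) (pi : 'S_n.+1).
Hypotheses (pi0 : pi ord0 = ord0) (pi_dom : dominant_tail pi).

Local Notation dg := (dg pi).
Local Notation rgn := (rgn pi).
Local Notation bd := (boundary (region pi)).

(** The order of traversal in closed form; [index_before] identifies it with the order of positions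
    in the list. *)
Definition before (s t : bstep n) : bool :=
  match s, t with
  | inl b, inl b' => b < b'
  | inr a, inr a' => a' < a
  | inl b, inr a => rgn a b
  | inr a, inl b => ~~ rgn a b
  end.

Lemma before_irr : irreflexive before.
Proof. by case=> x /=; apply: ltnn. Qed.

Lemma before_asym s t : before s t -> ~~ before t s.
Proof. by case: s t => x [] y /=; rewrite ?negbK // -leqNgt => /ltnW. Qed.

Lemma south_endE (a b : 'I_n.+1) : south_end (region pi) (a, b) = rgn a b && ~~ rgn a.+1 b.
Proof.
rewrite /south_end mem_region //; congr (_ && _); apply/forallP/negP => [H ab|H [a' b']].
  have [[i j] [ij /= iE jE]] := rgn_ord pi0 pi_dom ab.
  by have := H (i, j); rewrite ij -val_eqE /= jE eqxx iE ltnn.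
apply/implyP => /=; rewrite mem_region // => /= ab.
apply/implyP => /eqP bE; rewrite leqNgt; apply/negP => aa'; apply: H.
by apply: (rgn_sub pi0 pi_dom ab); rewrite ?bE.
Qed.

Lemma east_endE (a b : 'I_n.+1) : east_end (region pi) (a, b) = rgn a b && ~~ rgn a b.+1.
Proof.
rewrite /east_end mem_region //; congr (_ && _); apply/forallP/negP => [H ab|H [a' b']].
  have [[i j] [ij /= iE jE]] := rgn_ord pi0 pi_dom ab.
  by have := H (i, j); rewrite ij -val_eqE /= iE eqxx jE ltnn.
apply/implyP => /=; rewrite mem_region // => /= ab.
apply/implyP => /eqP aE; rewrite leqNgt; apply/negP => bb'; apply: H.
by apply: (rgn_sub pi0 pi_dom ab); rewrite ?aE.
Qed.

Lemma exists_south_end (b : 'I_n.+1) : rgn 0 b ->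
  exists a : 'I_n.+1, south_end (region pi) (a, b).
Proof.
move=> b0; have ex : exists a, rgn a b by exists 0.
have ub a : rgn a b -> a <= n by case/(rgn_bound pi0 pi_dom).
case: (ex_maxnP ex ub) => a ab amax; have an := ub a ab.
exists (Ordinal (an : a < n.+1)); rewrite south_endE /= ab /=.
by apply/negP => /amax; rewrite ltnn.
Qed.

Lemma mem_boundary (s : bstep n) : (s \in bd) =
  match s with inl b => rgn 0 b | inr a => rgn a 0 end.
Proof.
have row (a : 'I_n.+1) : [exists b, (a, b) \in region pi] = rgn a 0.
  apply/existsP/idP => [[b]|a0]; last by exists ord0; rewrite mem_region.
  by rewrite mem_region // => ab; apply: (rgn_sub pi0 pi_dom ab).
apply/flatten_mapP/idP => [[a]|].
  rewrite mem_filter mem_rev mem_enum andbT row mem_rcons inE => a0.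
  case/predU1P=> [->//|/mapP[b + ->]].
  rewrite mem_filter south_endE => /andP[/andP[ab _] _].
  exact: (rgn_sub pi0 pi_dom ab).
case: s => [b /exists_south_end[a ab]|a a0].
  exists a; first rewrite mem_filter mem_rev mem_enum andbT row.
    by move: ab; rewrite south_endE => /andP[ab _]; apply: (rgn_sub pi0 pi_dom ab).
  by rewrite mem_rcons inE map_f // mem_filter ab mem_enum.
exists a; first by rewrite mem_filter mem_rev mem_enum andbT row.
by rewrite mem_rcons mem_head.
Qed.

Lemma boundary_sorted : pairwise before bd.
Proof.
rewrite /boundary.
have : pairwise (fun a a' : 'I_n.+1 => a' < a)
    [seq a <- rev (enum 'I_n.+1) | [exists b, (a, b) \in region pi]].
  apply: pairwise_filter; rewrite -sorted_pairwise; last first.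
    by move=> y x z xy yz; apply: ltn_trans xy.
  by rewrite rev_sorted enum_ord_sorted.
have : {in [seq a <- rev (enum 'I_n.+1) | [exists b, (a, b) \in region pi]],
    forall a : 'I_n.+1, rgn a 0}.
  move=> a; rewrite mem_filter => /andP[/existsP[b]].
  by rewrite mem_region // => ab _; apply: (rgn_sub pi0 pi_dom ab).
elim: [seq a <- _ | _] => //= a s IHs s0 /andP[/allP sa /IHs sP].
rewrite pairwise_cat sP => [|a' a's]; last by apply: s0; rewrite inE a's orbT.
rewrite andbT; apply/andP; split.
  apply/allrelP => x y; rewrite mem_rcons inE => xa /flatten_mapP[a' /[dup] a's /sa a'a].
  have a'0 : rgn a' 0 by apply: s0; rewrite inE a's orbT.
  rewrite mem_rcons inE => /predU1P[->|/mapP[b' + ->]].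
    case/predU1P: xa => [-> //|/mapP[b + ->]].
    rewrite mem_filter south_endE => /andP[/andP[ab _] _] /=.
    exact: (rgn_sub pi0 pi_dom ab (ltnW a'a)).
  rewrite mem_filter south_endE => /andP[/andP[_ a'b'] _].
  have ab' : ~~ rgn a b' by apply: contra a'b' => ab'; apply: (rgn_sub pi0 pi_dom ab').
  case/predU1P: xa => [-> //|/mapP[b + ->]] /=.
  rewrite mem_filter south_endE => /andP[/andP[ab _] _] /=.
  by rewrite ltnNge; apply: contra ab' => b'b; apply: (rgn_sub pi0 pi_dom ab).
rewrite pairwise_rcons; apply/andP; split.
  apply/allP => _ /mapP[b + ->]; rewrite mem_filter south_endE => /andP[/andP[ab _] _].
  exact: ab.
rewrite pairwise_map; apply: pairwise_filter.
rewrite -sorted_pairwise /= ?enum_ord_sorted // => y x z; exact: ltn_trans.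
Qed.

Lemma boundary_uniq : uniq bd.
Proof. exact: pairwise_uniq before_irr boundary_sorted. Qed.

Lemma bstep_at_index s : s \in bd -> bstep_at pi (index s bd) = s.
Proof. exact: nth_index. Qed.

Lemma index_before s t : s \in bd -> t \in bd ->
  (index s bd < index t bd) = before s t.
Proof.
move=> sb tb; have imp x y : x \in bd -> y \in bd -> index x bd < index y bd -> before x y.
  move=> xb yb xy.
  have /pairwiseP H := boundary_sorted; have := H (inl ord0) (index x bd) (index y bd).
  by rewrite !inE !index_mem xb yb !nth_index //; apply.
apply/idP/idP => [|st]; first exact: imp.
rewrite ltnNge leq_eqVlt negb_or; apply/andP; split.
  apply/eqP => E; have ts : t = s by rewrite -(bstep_at_index tb) E bstep_at_index.
  by rewrite ts before_irr in st.
by apply/negP => /imp-/(_ tb sb); apply/negP; apply: before_asym.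
Qed.

Lemma before_pred (s t : bstep n) : s \in bd -> 0 < index s bd ->
    t = bstep_at pi (index s bd).-1 ->
  [/\ t \in bd, index t bd = (index s bd).-1, before t s &
      forall r, r \in bd -> before t r -> before r s -> False].
Proof.
move=> sb s0 ->; have lt : (index s bd).-1 < size bd.
  by rewrite (leq_ltn_trans (leq_pred _)) // index_mem.
have tb : bstep_at pi (index s bd).-1 \in bd by apply: mem_nth.
have ti : index (bstep_at pi (index s bd).-1) bd = (index s bd).-1.
  by apply: index_uniq => //; apply: boundary_uniq.
split=> // [|r rb]; rewrite -!index_before // ti; [by rewrite prednK|].
lia.
Qed.

(** If the lowest box [(a, b)] of the column lay in the top dream only, the diagram would contain
    [(a.+1, b)] and the region [(a.+1, b.-1)]. The preceding step would then be an N step. So an E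
    step after an E step bounds the bottom dream. *)
Lemma predecessor_of_E (b : 'I_n.+1) : rgn 0 b -> 0 < index (inl b : bstep n) bd ->
  let t := bstep_at pi (index (inl b : bstep n) bd).-1 in
  (bounds_bottom pi (inl b) /\
   (exists b' : 'I_n.+1, [/\ t = inl b', b = b'.+1 :> nat &
      forall a, rgn a b -> ~~ rgn a.+1 b -> ~~ rgn a.+1 b'])) \/
  exists a : 'I_n.+1, [/\ t = inr a, ~~ rgn a b, rgn a.-1 b, rgn a b.-1 &
    0 < a /\ 0 < b].
Proof.
move=> b0 i0 t; have sb : (inl b : bstep n) \in bd by rewrite mem_boundary.
have [tb ti ts between] := before_pred sb i0 (erefl t).
case: (t) tb ti ts between => [b'|a]; rewrite mem_boundary => /= tb _ ts between.
  have bE : b = b'.+1 :> nat.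
    apply/eqP; rewrite eqn_leq ts andbT leqNgt; apply/negP => lt.
    have lt' : b'.+1 < n.+1 := ltn_trans lt (ltn_ord b).
    apply: (between (inl (Ordinal lt'))) => //=; rewrite ?mem_boundary //.
    by apply: (rgn_sub pi0 pi_dom b0) => //=; apply: ltnW.
  have south a : rgn a b -> ~~ rgn a.+1 b -> ~~ rgn a.+1 b'.
    move=> ab a1b; apply/negP => a1b'.
    have [[i j] [_ /= iE _]] := rgn_ord pi0 pi_dom a1b'.
    apply: (between (inr i)) => /=; rewrite ?mem_boundary ?iE //.
    by apply: (rgn_sub pi0 pi_dom a1b').
  left; split; last by exists b'.
  have [a] := exists_south_end b0; rewrite south_endE => /andP[ab a1b].
  have := south a ab a1b; apply: contraR => nb.
  rewrite /rgn -bE; suff -> : dg a.+1 b by rewrite orbT.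
  case/or3P: (ab) => [/andP[_ /eqP bz]|abD|//]; first by rewrite bz in bE.
  case/negP: nb; apply/existsP; exists a.
  by rewrite south_endE ab a1b mem_bottom_dream.
right; exists a; have a0 : 0 < a.
  by rewrite lt0n; apply: contraNneq ts => ->.
have bp : 0 < b by rewrite lt0n; apply: contraNneq ts => ->.
split=> //.
  have lt : a.-1 < n.+1 by rewrite (leq_ltn_trans (leq_pred _)).
  apply/negPn/negP => a1b; apply: (between (inr (Ordinal lt))) => //=.
    by rewrite mem_boundary; apply: (rgn_sub pi0 pi_dom tb); rewrite //= leq_pred.
  by rewrite prednK.
have lt : b.-1 < n.+1 by rewrite (leq_ltn_trans (leq_pred _)).
apply/negPn/negP => ab1; apply: (between (inl (Ordinal lt))) => //=.
  by rewrite mem_boundary; apply: (rgn_sub pi0 pi_dom b0); rewrite //= leq_pred.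
by rewrite prednK.
Qed.

(** Both reasons for missing [A] put [(a, b)] into the diagram: either the N step of row [a] bounds
    the bottom dream, or the box above the E step is a cross of the top dream only. *)
Lemma unlabelled s : s \in bd -> ~~ labelled pi (index s bd) ->
  exists a b : 'I_n.+1, [/\ s = inl b, index s bd = (index (inr a : bstep n) bd).+1,
    rgn a 0, dg a b & ~~ rgn a b].
Proof.
move=> sb; rewrite /labelled bstep_at_index // !negb_or => /and3P[sN i0].
case: s sb sN i0 => [b|//] sb _; rewrite -lt0n => i0.
move: (sb); rewrite mem_boundary => b0.
have [tb ti ts _] := before_pred sb i0 (erefl _).
have [[bb [b' [-> _ _]]]|[a [tE nab a1b ab1 [a0 bp]]]] := predecessor_of_E b0 i0.
  by rewrite bb.
rewrite tE in tb ti ts *; rewrite negb_and negbK /= => H.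
exists a, b; rewrite ti prednK //; split=> //; first by rewrite mem_boundary in tb.
have eastP (b1 : 'I_n.+1) : b1 = b.-1 :> nat -> east_end (region pi) (a, b1).
  by move=> b1E; rewrite east_endE b1E ab1 prednK.
case/orP: H => [nb|/existsP[b1 /andP[]]]; last first.
  rewrite east_endE mem_bottom_dream // => /andP[ab1' nab1'] /=.
  suff -> : b1.+1 = b by [].
  apply/eqP; rewrite eqn_leq; apply/andP; split.
    by rewrite ltnNge; apply: contra nab => bb1; apply: (rgn_sub pi0 pi_dom ab1').
  rewrite leqNgt; apply: contra nab1' => bb1; apply: (rgn_sub pi0 pi_dom ab1);
    rewrite // -ltnS prednK //.
case/or3P: (a1b) => [/andP[_ /eqP bz]|a1bD|]; [by rewrite bz in bp | | by rewrite prednK].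
case/negP: nb; apply/existsP.
have lt : a.-1 < n.+1 by rewrite (leq_ltn_trans (leq_pred _)).
by exists (Ordinal lt); rewrite south_endE /= a1b prednK // nab mem_bottom_dream.
Qed.

Lemma corner_unlabelled (a b : 'I_n.+1) : dg a b -> ~~ rgn a b ->
  index (inl b : bstep n) bd = (index (inr a : bstep n) bd).+1 /\
  ~~ labelled pi (index (inl b : bstep n) bd).
Proof.
move=> ab nab; have [a0 bp] := dg_gt0 pi0 ab.
have ab1 := dg_rgn_left pi0 ab; have a1b := dg_rgn_up pi0 ab.
have b0 : rgn 0 b by apply: (rgn_sub pi0 pi_dom a1b).
have sb : (inl b : bstep n) \in bd by rewrite mem_boundary.
have rb : (inr a : bstep n) \in bd by rewrite mem_boundary; apply: (rgn_sub pi0 pi_dom ab1).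
have i0 : 0 < index (inl b : bstep n) bd.
  by apply: (@leq_ltn_trans (index (inr a : bstep n) bd)); rewrite ?index_before.
have [tb ti ts _] := before_pred sb i0 (erefl _).
have tE : bstep_at pi (index (inl b : bstep n) bd).-1 = inr a.
  have [[_ [b' [_ bE south]]]|[a' [-> na'b a'1b a'b1 [a'0 _]]]] := predecessor_of_E b0 i0.
    have [a1] := exists_south_end b0; rewrite south_endE => /andP[a1b' na1b].
    case/negP: (south a1 a1b' na1b); apply: (rgn_sub pi0 pi_dom ab1); last by rewrite bE.
    by rewrite ltnNge; apply: contra nab => aa1; apply: (rgn_sub pi0 pi_dom a1b').
  congr inr; apply/val_inj/eqP; rewrite /= eqn_leq; apply/andP; split.
    by rewrite leqNgt; apply: contra nab => aa'; apply: (rgn_sub pi0 pi_dom a'1b);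
      rewrite // -ltnS prednK //.
  by rewrite leqNgt; apply: contra na'b => aa'; apply: (rgn_sub pi0 pi_dom a1b);
    rewrite // -ltnS prednK //.
rewrite tE in ti; split; first by rewrite ti prednK.
rewrite /labelled bstep_at_index //= tE eqn0Ngt i0 /=.
rewrite negb_and; apply/orP; right; rewrite negbK; apply/existsP.
have lt : b.-1 < n.+1 by rewrite (leq_ltn_trans (leq_pred _)).
by exists (Ordinal lt); rewrite east_endE /= ab1 prednK // nab mem_bottom_dream //= prednK.
Qed.

Lemma label_lt s t : index s bd < index t bd -> labelled pi (index t bd) ->
  label pi s < label pi t.
Proof.
move=> st tl; rewrite /label [count _ (iota 0 (index t bd).+1)]count_iotaS tl addn1.
exact: count_iota_le.
Qed.

Lemma label_before s t : s \in bd -> t \in bd -> before s t ->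
  label pi s < label pi t \/
  exists a b : 'I_n.+1, [/\ s = inr a, t = inl b, dg a b, ~~ rgn a b &
    label pi s = label pi t].
Proof.
move=> sb tb; rewrite -index_before // => st.
have [tl|tnl] := boolP (labelled pi (index t bd)); first by left; apply: label_lt.
have [a [b [tE ti a0 ab nab]]] := unlabelled tb tnl.
have labE : label pi (inr a) = label pi t.
  by rewrite /label [in RHS]ti [RHS]count_iotaS -ti (negbTE tnl) addn0.
have rb : (inr a : bstep n) \in bd by rewrite mem_boundary.
have [->|sa] := eqVneq s (inr a); first by right; exists a, b.
left; rewrite -labE; apply: label_lt.
  rewrite ti ltnS leq_eqVlt in st; case/orP: st => // /eqP E.
  by rewrite -(bstep_at_index sb) E bstep_at_index ?eqxx in sa.
by rewrite /labelled bstep_at_index.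
Qed.

Lemma label_box (a b : 'I_n.+1) : rgn a b -> label pi (inl b) < label pi (inr a).
Proof.
move=> ab; have [||//|//|] := @label_before (inl b) (inr a).
- by rewrite mem_boundary; apply: (rgn_sub pi0 pi_dom ab).
- by rewrite mem_boundary; apply: (rgn_sub pi0 pi_dom ab).
- by case=> ? [? []].
Qed.

Lemma label_corner (a b : 'I_n.+1) : dg a b -> ~~ rgn a b ->
  label pi (inl b) = label pi (inr a).
Proof.
move=> ab nab; have [iE nl] := corner_unlabelled ab nab.
by rewrite /label [in LHS]iE [LHS]count_iotaS -iE (negbTE nl) addn0.
Qed.

Lemma label_outside (a b : 'I_n.+1) : rgn a 0 -> rgn 0 b -> ~~ dg a b -> ~~ rgn a b ->
  label pi (inr a) < label pi (inl b).
Proof.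
move=> a0 b0 nab ab; have [||//|//|] := @label_before (inr a) (inl b).
- by rewrite mem_boundary.
- by rewrite mem_boundary.
- by case=> a' [b' [[<-] [<-] ab']]; rewrite ab' in nab.
Qed.

Lemma label_cols (b b' : 'I_n.+1) : rgn 0 b' -> b < b' ->
  label pi (inl b) < label pi (inl b').
Proof.
move=> b0 bb'; have [||//|//|] := @label_before (inl b) (inl b').
- by rewrite mem_boundary; apply: (rgn_sub pi0 pi_dom b0) => //; apply: ltnW.
- by rewrite mem_boundary.
- by case=> ? [? []].
Qed.

Lemma label_rows (a a' : 'I_n.+1) : rgn a' 0 -> a < a' ->
  label pi (inr a') < label pi (inr a).
Proof.
move=> a0 aa'; have [||//|//|] := @label_before (inr a') (inr a).
- by rewrite mem_boundary.
- by rewrite mem_boundary; apply: (rgn_sub pi0 pi_dom a0) => //; apply: ltnW.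
- by case=> ? [? []].
Qed.

Lemma label_bound s : s \in bd -> 0 < label pi s <= nlabels pi.
Proof.
move=> sb; apply/andP; split; last by apply: count_iota_le; rewrite index_mem.
by apply: (@leq_trans (count (labelled pi) (iota 0 1)));
  [by rewrite /= /labelled eqxx orbT | exact: count_iota_le].
Qed.

Lemma label_surj (k : nat) : k < nlabels pi -> exists2 s, s \in bd & label pi s = k.+1.
Proof.
case/count_iota_pick=> j [jb _ jE]; exists (bstep_at pi j); first exact: mem_nth.
by rewrite /label index_uniq // boundary_uniq.
Qed.

End Labels.

(** * The transitive closure of the tree *)

Section TreeClosure.
Variables (n : nat) (pi : 'S_n.+1).
Hypotheses (pi0 : pi ord0 = ord0) (pi_dom : dominant_tail pi).

Local Notation dg := (dg pi).
Local Notation rgn := (rgn pi).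
Local Notation bd := (boundary (region pi)).

Let memE := mem_region pi0 pi_dom.
Let sub := rgn_sub pi0 pi_dom.

Lemma rgn_label (a b : 'I_n.+1) : rgn a 0 -> rgn 0 b ->
  label pi (inl b) < label pi (inr a) -> rgn a b.
Proof.
move=> a0 b0; apply: contraLR => nab; rewrite -leqNgt.
have [ab|ab] := boolP (dg a b); first by rewrite (label_corner pi0 pi_dom ab nab).
exact/ltnW/(label_outside pi0 pi_dom a0 b0 ab nab).
Qed.

Lemma nlabels_gt0 : 0 < nlabels pi.
Proof.
have /andP[h1 h2] : 0 < label pi (inl ord0) <= nlabels pi.
  by apply: label_bound; rewrite mem_boundary.
exact: leq_trans h2.
Qed.

(** Total by means of a default vertex; on boundary steps [label_vertexE] relates it to the label,
    which is larger by one. *)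
Definition label_vertex (s : bstep n) : 'I_(nlabels pi) :=
  insubd (Ordinal nlabels_gt0) (label pi s).-1.

Lemma label_vertexE s : s \in bd -> label pi s = (label_vertex s).+1.
Proof.
move=> /label_bound/andP[s0 sm].
by rewrite val_insubd !prednK // sm prednK.
Qed.

Definition box_edge (p : box n) : 'I_(nlabels pi) * 'I_(nlabels pi) :=
  (label_vertex (inl p.2), label_vertex (inr p.1)).

Lemma region_steps (p : box n) : p \in region pi ->
  ((inl p.2 : bstep n) \in bd) && ((inr p.1 : bstep n) \in bd).
Proof.
rewrite memE => pR; rewrite !mem_boundary //.
by rewrite (sub pR) ?(sub pR).
Qed.

Lemma vertex_lt s t : s \in bd -> t \in bd ->
  (label_vertex s < label_vertex t) = (label pi s < label pi t).
Proof. by move=> sb tb; rewrite !label_vertexE. Qed.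

Lemma vertex_le s t : s \in bd -> t \in bd ->
  (label_vertex s <= label_vertex t) = (label pi s <= label pi t).
Proof. by move=> sb tb; rewrite !label_vertexE. Qed.

Lemma mem_tree_box e : e \in tree pi -> exists2 p, p \in region pi & e = box_edge p.
Proof.
case: e => i j; rewrite inE => /andP[_ /existsP[p /and3P[pd /eqP pi1 /eqP pj]]].
have pR : p \in region pi by move: pd; rewrite inE => /andP[].
exists p => //; have /andP[b1 b2] := region_steps pR.
move: pi1 pj; rewrite !label_vertexE //= => -[/val_inj <-] [/val_inj <-].
by case: p {pd pR b1 b2}.
Qed.

(** The boxes below such a box in its column are all elbows of the bottom dream, and the one in row
    0 is a further elbow not below it. So the dropped dots reach up to the box. *)
Lemma rim_tree (p : box n) : p \in region pi -> ~~ dg p.1.+1 p.2.+1 ->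
  box_edge p \in tree pi.
Proof.
move=> pR prim; have /andP[b1 b2] := region_steps pR.
have pR' := pR; rewrite memE in pR'.
rewrite inE vertex_lt // label_box //=.
apply/existsP; exists p; rewrite -!label_vertexE // !eqxx !andbT inE pR /=.
apply: proper_card; apply/properP; split.
  apply/subsetP => q; rewrite in_set => /and3P[qR /eqP qp pq].
  rewrite in_set in_setD qR qp eqxx !andbT mem_bottom_dream // qp.
  by apply: contra prim => h; apply: (dg_sub pi0 pi_dom h); rewrite /= ?leqnn ?pq.
have oR : rgn 0 p.2 by move: pR; rewrite memE => pR; apply: (sub pR).
exists (ord0, p.2); last by rewrite !inE /= ltn0 !andbF.
rewrite in_set /= eqxx andbT in_setD memE /= oR andbT mem_bottom_dream //=.
by apply/negP => /(dg_gt0 pi0)[].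
Qed.

Lemma ex_corner (a b : nat) : dg a.+1 b.+1 -> exists i j : 'I_n.+1,
  [/\ a < i, b < j, dg i j & ~~ rgn i j].
Proof.
move=> ab; have bnd c d : dg c d -> c <= n /\ d <= n.
  by move/(dg_bound pi0 pi_dom); lia.
have ex1 : exists i, dg i b.+1 by exists a.+1.
have ub1 i : dg i b.+1 -> i <= n by case/bnd.
case: (ex_maxnP ex1 ub1) => i ib imax.
have ex2 : exists j, dg i j by exists b.+1.
have ub2 j : dg i j -> j <= n by case/bnd.
case: (ex_maxnP ex2 ub2) => j ij jmax.
have ai := imax _ ab; have bj := jmax _ ib; have [i_n jn] := bnd _ _ ij.
exists (Ordinal (i_n : i < n.+1)), (Ordinal (jn : j < n.+1)); split=> //=.
rewrite /rgn; apply/or3P => -[/andP[/eqP iz _]|/jmax|h].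
- by rewrite iz in ai.
- by rewrite ltnn.
- have : dg i.+1 b.+1 by apply: (dg_sub pi0 pi_dom h); rewrite /= ?leqnn.
  by move/imax; rewrite ltnn.
Qed.

(** A box off the rim has an outer corner [(a', b')] of the diagram to its southeast. Column [b']
    and row [a'] share a label there, so the shorter edges of [(a', b)] and [(a, b')] compose to the
    edge of [(a, b)]. *)
Lemma box_edge_closure (p : box n) : p \in region pi ->
  box_edge p \in transitive_closure (tree pi).
Proof.
have [k] := ubnP (label pi (inr p.1) - label pi (inl p.2)).
elim: k p => // k IHk [a b] lek pR; rewrite /= in lek.
have /andP[b1 b2] := region_steps pR; rewrite /= in b1 b2.
have ab : rgn a b by rewrite memE in pR.
have lab := label_box pi0 pi_dom ab.
have [corner|rim] := boolP (dg a.+1 b.+1); last first.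
  by apply: sub_closure; [apply: rim_tree | rewrite vertex_lt].
have [a' [b' [aa' bb' ab' nab']]] := ex_corner corner.
have p1R : rgn a' b.
  rewrite /rgn; suff -> : dg a' b.+1 by rewrite orbT.
  apply: (dg_sub pi0 pi_dom ab'); rewrite /= ?leqnn ?andbT //.
  exact: leq_ltn_trans aa'.
have p2R : rgn a b'.
  rewrite /rgn; suff -> : dg a.+1 b' by rewrite !orbT.
  apply: (dg_sub pi0 pi_dom ab'); rewrite /= ?leqnn ?andbT //.
  exact: leq_ltn_trans bb'.
have l1 := label_box pi0 pi_dom p1R; have l2 := label_box pi0 pi_dom p2R.
have l12 := label_corner pi0 pi_dom ab' nab'.
have := IHk (a', b); have := IHk (a, b'); rewrite !memE /= => IH2 IH1.
have {}IH1 : box_edge (a', b) \in transitive_closure (tree pi) by apply: IH1 => //;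
  move: lek lab l1 l2 l12; clear; lia.
have {}IH2 : box_edge (a, b') \in transitive_closure (tree pi) by apply: IH2 => //;
  move: lek lab l1 l2 l12; clear; lia.
move: IH1 IH2; rewrite !inE /= => /andP[lt1 c1] /andP[lt2 c2].
have vE : label_vertex (inl b') = label_vertex (inr a').
  by apply/val_inj; rewrite /label_vertex l12.
rewrite vE in lt2 c2; rewrite (ltn_trans lt1 lt2) /=.
exact: connect_trans c1 c2.
Qed.

(** An increasing path leads from a column label to a larger row label, and by [rgn_label] this
    comparison alone places the box in the region. *)
Lemma closureE : transitive_closure (tree pi) = box_edge @: region pi.
Proof.
apply/setP => -[x y]; apply/idP/imsetP => [|[p pR ->]]; last exact: box_edge_closure.
rewrite inE /= => /andP[ltxy /connectP[p pP yE]].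
have : p != [::] by apply: contraTneq ltxy => p0; rewrite yE p0 ltnn.
elim: p x pP yE {ltxy} => // z p IHp x /= /andP[/andP[_ /mem_tree_box[q qR [-> zE]]] pP] yE _.
have [p0|pn] := eqVneq p [::].
  by exists q => //; rewrite yE p0 /= zE.
have [r rR [zE' ->]] := IHp z pP yE pn.
have /andP[q1 q2] := region_steps qR; have /andP[r1 r2] := region_steps rR.
exists (r.1, q.2); last by [].
rewrite memE /=; apply: rgn_label.
- by rewrite mem_boundary in r2.
- by rewrite mem_boundary in q1.
have lq : label pi (inl q.2) < label pi (inr q.1) by apply: label_box; rewrite // memE in qR.
have lr : label pi (inl r.2) < label pi (inr r.1) by apply: label_box; rewrite // memE in rR.
apply: ltn_trans lq _; rewrite label_vertexE // -zE zE' -label_vertexE //.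
Qed.

(** The edges of the closure are characterised by comparing a column label with a row label, so only
    inequalities have to be checked. *)
Lemma closure_exchange : exchange_closed (transitive_closure (tree pi)).
Proof.
move=> e f; rewrite closureE => /imsetP[p pR ->] /imsetP[q qR ->].
have /andP[p1 p2] := region_steps pR; have /andP[q1 q2] := region_steps qR.
have in_region (s t : 'I_n.+1) : (inl s : bstep n) \in bd -> (inr t : bstep n) \in bd ->
    label pi (inl s) < label pi (inr t) ->
    (label_vertex (inl s), label_vertex (inr t)) \in box_edge @: region pi.
  rewrite !mem_boundary // => s0 t0 st.
  by apply/imsetP; exists (t, s) => //; rewrite memE; apply: rgn_label.
rewrite /conflict /= !vertex_lt // vertex_le // => /andP[/andP[c1 c2] c3].
split; last by apply: in_region.
apply: in_region => //; apply: leq_ltn_trans (ltnW c1) _.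
exact: leq_ltn_trans c3.
Qed.

Lemma closure_connected : connected (transitive_closure (tree pi)).
Proof.
pose v0 := label_vertex (inr ord0).
have adj (p : box n) : p \in region pi ->
    connect (adjacent (transitive_closure (tree pi)))
      (label_vertex (inl p.2)) (label_vertex (inr p.1)).
  by move=> pR; apply: connect1; rewrite /adjacent /= closureE (imset_f box_edge pR).
have symm := connect_adjacent_sym (transitive_closure (tree pi)).
suff to0 v : connect (adjacent (transitive_closure (tree pi))) v v0.
  by move=> v w; apply: connect_trans (to0 v) _; rewrite symm.
have [s sb sE] := label_surj pi0 pi_dom (ltn_ord v).
have -> : v = label_vertex s by apply/val_inj/succn_inj; rewrite -label_vertexE.
case: s sb {sE} => x; rewrite mem_boundary // => xR.
  by apply: (adj (ord0, x)); rewrite memE.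
apply: (@connect_trans _ _ (label_vertex (inl ord0))).
  by rewrite symm; apply: (adj (x, ord0)); rewrite memE.
by apply: (adj (ord0, ord0)); rewrite memE.
Qed.

Definition boxes_conflict (p q : box n) : bool :=
  [&& q.1 < p.1, p.2 < q.2 & dg p.1 q.2].

(** The middle inequality of [conflict] allows equal labels, which a column and a row have exactly
    at an outer corner. This is why the condition is on the diagram and not on the region. *)
Lemma conflict_boxes (p q : box n) : p \in region pi -> q \in region pi ->
  conflict (box_edge p) (box_edge q) = boxes_conflict p q.
Proof.
move=> pR qR; have /andP[p1 p2] := region_steps pR; have /andP[q1 q2] := region_steps qR.
rewrite /conflict /boxes_conflict /= !vertex_lt // vertex_le //.
move: p1 p2 q1 q2; rewrite !mem_boundary // => p1 p2 q1 q2.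
have -> : (label pi (inl p.2) < label pi (inl q.2)) = (p.2 < q.2).
  case: (ltngtP p.2 q.2) => [lt|lt|/val_inj->]; last by rewrite ltnn.
    exact: label_cols lt.
  by apply/negbTE; rewrite -leqNgt ltnW // label_cols.
have -> : (label pi (inr p.1) < label pi (inr q.1)) = (q.1 < p.1).
  case: (ltngtP q.1 p.1) => [lt|lt|/val_inj->]; last by rewrite ltnn.
    exact: label_rows lt.
  by apply/negbTE; rewrite -leqNgt ltnW // label_rows.
rewrite [RHS]andbCA -andbA; case: ltnP => //= pq2.
rewrite andbC; case: ltnP => //= qp1.
apply/idP/idP => [le|pqD].
  have [//|npq] := boolP (dg p.1 q.2).
  have [pq|/(label_outside pi0 pi_dom p2 q1 npq)] := boolP (rgn p.1 q.2).
    by case/negP: npq; apply: (rgn_dg pi0 pi_dom pq);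
      [apply: leq_ltn_trans qp1 | apply: leq_ltn_trans pq2].
  by rewrite ltnNge le.
have [pq|npq] := boolP (rgn p.1 q.2); first exact/ltnW/label_box.
by rewrite (label_corner pi0 pi_dom pqD npq).
Qed.

Lemma box_edge_inj : {in region pi &, injective box_edge}.
Proof.
move=> p q pR qR [/(congr1 val) e1 /(congr1 val) e2].
have /andP[p1 p2] := region_steps pR; have /andP[q1 q2] := region_steps qR.
have l1 : label pi (inl p.2) = label pi (inl q.2).
  by rewrite (label_vertexE p1) (label_vertexE q1); congr _.+1.
have l2 : label pi (inr p.1) = label pi (inr q.1).
  by rewrite (label_vertexE p2) (label_vertexE q2); congr _.+1.
move: p1 p2 q1 q2; rewrite !mem_boundary // => p1 p2 q1 q2.
have E2 : p.2 = q.2.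
  apply/val_inj; case: (ltngtP p.2 q.2) => [lt|lt|//].
    by have := label_cols pi0 pi_dom q1 lt; rewrite l1 ltnn.
  by have := label_cols pi0 pi_dom p1 lt; rewrite l1 ltnn.
have E1 : p.1 = q.1.
  apply/val_inj; case: (ltngtP p.1 q.1) => [lt|lt|//].
    by have := label_rows pi0 pi_dom q2 lt; rewrite l2 ltnn.
  by have := label_rows pi0 pi_dom p2 lt; rewrite l2 ltnn.
by case: p q E1 E2 {pR qR e1 e2 l1 l2 p1 p2 q1 q2} => [? ?] [? ?] /= -> ->.
Qed.

End TreeClosure.

(** * Strands of pipe dreams *)

Section Strands.
Variables (n : nat) (X : {set box n}).
Hypothesis Xtri : X \subset triangle n.

Definition strand_at (i : 'I_n.+1) (t : nat) : nat * nat * bool :=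
  iter t (strand_step X) (strand_start i).

Definition exit_col (i : 'I_n.+1) : nat := (strand_at i (2 * n.+1)).1.2.

Lemma cross_bound (a b : nat) : is_cross X a b -> a + b < n.
Proof. by case/is_cross_ord=> p [/(subsetP Xtri) + <- <-]; rewrite inE. Qed.

Variant step_spec (a b : nat) (l : bool) : nat * nat * bool -> Prop :=
| StepRight of is_cross X a b = l : step_spec a b l (a.+1, b.+1, true)
| StepUp of is_cross X a b = ~~ l : step_spec a b l (a, b, false).

Lemma stepP (a b : nat) (l : bool) : step_spec a b l (strand_step X (a.+1, b, l)).
Proof.
rewrite /strand_step; case: eqP => c; first exact: StepRight.
by apply: StepUp; case: l (is_cross X a b) c => [] [].
Qed.

Lemma strand_atS (i : 'I_n.+1) (t : nat) : strand_at i t.+1 = strand_step X (strand_at i t).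
Proof. by []. Qed.

(* The diagonal [b - h] increases by one at each step before the exit. *)
Lemma strand_inv (i : 'I_n.+1) (t h b : nat) (l : bool) : strand_at i t = (h, b, l) ->
  [/\ (if l then (0 < h) && (h + b <= n.+1) else (h + b <= n) && (h <= i)),
      h <= i.+1, (0 < h -> b + i.+1 = h + t), (h = 0 -> b + i.+1 <= t) &
      (l -> t = 0 \/ 0 < b)].
Proof.
elim: t h b l => [|t IHt] h b l.
  case=> <- <- <- /=; split=> //; try by left.
    by rewrite addn0 ltn_ord.
  by rewrite addn0.
rewrite strand_atS; case E: (strand_at i t) => [[[|a] b'] l'].
  have [H1 H2 H3 H4 H5] := IHt _ _ _ E.
  by case=> <- <- lE; rewrite -lE; split=> // [_|]; [apply: leqW;
    apply: H4 | case: l' H1 {H5 lE E}].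
have [H1 H2 H3 H4 H5] := IHt _ _ _ E; have H3' := H3 isT.
case: stepP => c [<- <- <-]; split=> //=; try by [lia | right].
  case: l' c H1 {E H5} => [/cross_bound|_]; lia.
by case: l' c H1 {E H5} => _; lia.
Qed.

Lemma strand_time (i : 'I_n.+1) (t h b : nat) (l : bool) :
  strand_at i t = (h, b, l) -> 0 < h -> b + i.+1 = h + t.
Proof. by case/strand_inv. Qed.

Lemma strand_active_time (i : 'I_n.+1) (t h b : nat) (l : bool) :
  strand_at i t = (h, b, l) -> 0 < h -> t < 2 * n.+1.
Proof.
move=> E h0; have [H1 _ H3 _ _] := strand_inv E.
by have := H3 h0; have := ltn_ord i; case: l H1 {E} => /andP[]; lia.
Qed.

Lemma strand_exitE (i : 'I_n.+1) (t : nat) : 2 * n.+1 <= t ->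
  strand_at i t = (0, exit_col i, false).
Proof.
move=> /subnK <-; elim: (t - _) => [|k IHk]; last by rewrite addSn strand_atS IHk.
rewrite add0n /exit_col; case E: (strand_at i _) => [[[|a] b] l] /=.
  by have [] := strand_inv E; case: l E.
by have := strand_active_time E isT; rewrite ltnn.
Qed.

Lemma strand_exit_visit (i : 'I_n.+1) (t b : nat) (l : bool) :
  strand_at i t = (0, b, l) -> b = exit_col i.
Proof.
move=> E; have stall k : strand_at i (k + t) = (0, b, l).
  by elim: k => // k IHk; rewrite addSn strand_atS IHk.
have := stall (2 * n.+1); rewrite strand_exitE ?leq_addr //.
by case.
Qed.

Lemma exit_col_bound (i : 'I_n.+1) : exit_col i <= n.
Proof.
have := @strand_exitE i (2 * n.+1) (leqnn _).
by case/strand_inv=> /andP[].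
Qed.

Lemma strand_step_inj (a a' b b' : nat) (l l' : bool) :
  strand_step X (a.+1, b, l) = strand_step X (a'.+1, b', l') ->
  (a.+1, b, l) = (a'.+1, b', l').
Proof.
case: stepP => c; case: stepP => c' // [ea eb]; move: c c'; rewrite ea eb => -> // E.
  by rewrite E.
by move/negb_inj: E => ->.
Qed.

(** Steps inside the grid are reversible, and a starting state is not the result of a step; tracing
    back ends at the same row. *)
Lemma strand_inj (i j : 'I_n.+1) (t t' a b : nat) (l : bool) :
  strand_at i t = (a.+1, b, l) -> strand_at j t' = (a.+1, b, l) -> i = j.
Proof.
elim: t t' a b l => [|t IHt] [|t'] a b l.
- by case=> ia _ _ [ja _ _]; apply/val_inj; rewrite /= ia ja.
- case=> <- <- <-; rewrite strand_atS.
  case E: (strand_at j t') => [[[|a'] b'] l'] //.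
  by case: stepP => _ [].
- move=> + [ja jb jl]; rewrite -ja -jb -jl strand_atS.
  case E: (strand_at i t) => [[[|a'] b'] l'] //.
  by case: stepP => _ [].
rewrite !strand_atS.
case E: (strand_at i t) => [[[|a1] b1] l1] //.
case E': (strand_at j t') => [[[|a2] b2] l2] // <- /esym/strand_step_inj E12.
by apply: (IHt t' a1 b1 l1) => //; rewrite E' -E12.
Qed.

Lemma strand_last_step (i : 'I_n.+1) : exists t b l,
  strand_at i t = (1, b, l) /\ strand_step X (1, b, l) = (0, exit_col i, false).
Proof.
have ex : exists t, (strand_at i t).1.1 == 0.
  by exists (2 * n.+1); rewrite strand_exitE.
case: (ex_minnP ex) => -[|t]; first by [].
case E': (strand_at i t.+1) => [[h' b'] l'] /= /eqP h0 tmin.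
case E: (strand_at i t) => [[[|a] b] l].
  by have := tmin t; rewrite E eqxx ltnn => /(_ isT).
exists t, b, l; have aE : a = 0.
  by move: E'; rewrite strand_atS E; case: stepP => _ []; lia.
rewrite aE in E; have E2 : strand_step X (1, b, l) = strand_at i t.+1 by rewrite strand_atS E.
split; first exact: E.
transitivity (strand_at i t.+1); first exact: E2.
rewrite h0 in E'; rewrite E' (strand_exit_visit E').
by have [+ _ _ _ _] := strand_inv E'; case: (l').
Qed.

Lemma exit_col_inj (i j : 'I_n.+1) : exit_col i = exit_col j -> i = j.
Proof.
have [t [b [l [E S]]]] := strand_last_step i.
have [t' [b' [l' [E' S']]]] := strand_last_step j.
move=> ij; rewrite ij -S' in S; have bE := strand_step_inj S.
by apply: (strand_inj E); rewrite bE; exact: E'.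
Qed.

(** The strand is traced backwards, to the left or downwards, until it meets the left edge. Each
    move lowers [n - a + b], and as crosses lie in the triangle the trace stays within it and its
    antidiagonal. *)
Lemma tile_covered (k a b : nat) (l : bool) : n - a + b <= k ->
  a + b + ~~ l <= n -> exists i t, strand_at i t = (a.+1, b, l).
Proof.
elim: k a b l => [|k IHk] a b l.
  move=> k0 abn; have [an b0] : a = n /\ b = 0 by lia.
  have l1 : l by case: (l) abn => //=; lia.
  by exists ord_max, 0; rewrite /strand_at /= /strand_start /= an b0 l1.
move=> ab abn; case: l abn => /= abn.
  case: b ab abn => [|b] ab abn.
    have lt : a < n.+1 by lia.
    by exists (Ordinal lt), 0.
  have [c|c] := boolP (is_cross X a b).
    have [||i [t E]] := IHk a b true; [lia | by have := cross_bound c; lia |].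
    by exists i, t.+1; rewrite strand_atS E /= c eqxx.
  have [||i [t E]] := IHk a b false; [lia | by rewrite /=; lia |].
  by exists i, t.+1; rewrite strand_atS E /= (negbTE c) eqxx.
have [c|c] := boolP (is_cross X a.+1 b).
  have [||i [t E]] := IHk a.+1 b false; [lia | by have := cross_bound c; rewrite /=; lia |].
  by exists i, t.+1; rewrite strand_atS E /= c.
have [||i [t E]] := IHk a.+1 b true; [lia | by rewrite /=; lia |].
by exists i, t.+1; rewrite strand_atS E /= (negbTE c).
Qed.

Lemma on_strandP (i : 'I_n.+1) (p : box n) :
  reflect (exists t l, strand_at i t = (p.1.+1, nat_of_ord p.2, l)) (on_strand X i p).
Proof.
apply: (iffP hasP) => [[s /trajectP[t _ ->] /eqP E]|[t [l E]]].
  by exists t, (strand_at i t).2; rewrite -E -surjective_pairing.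
exists (p.1.+1, nat_of_ord p.2, l); last by [].
apply/trajectP; exists t => //; exact: strand_active_time E _.
Qed.

(* One strand enters a tile from the left, another one from below. *)
Lemma two_strands (p : box n) (i j k : 'I_n.+1) : i != j ->
  on_strand X i p -> on_strand X j p -> on_strand X k p -> k = i \/ k = j.
Proof.
move=> ij /on_strandP[t [l E]] /on_strandP[t' [l' E']] /on_strandP[t'' [l'' E'']].
have [ll|ll] := eqVneq l'' l; first by left; rewrite ll in E''; exact: strand_inj E'' E.
right; have l'E : l'' = l'.
  have : l' != l by apply: contraNneq ij => ll'; rewrite ll' in E'; apply/eqP;
    exact: strand_inj E E'.
  by case: (l) (l') (l'') ll => [] [] [].
by rewrite l'E in E''; exact: strand_inj E'' E'.
Qed.

Lemma cross_two_strands (p : box n) : p \in X ->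
  exists i j : 'I_n.+1, [/\ i < j, on_strand X i p & on_strand X j p].
Proof.
move=> pX; have := subsetP Xtri _ pX; rewrite inE => pn.
have [|i [t E]] := @tile_covered _ p.1 p.2 true (leqnn _); first by rewrite addn0 ltnW.
have [|j [t' E']] := @tile_covered _ p.1 p.2 false (leqnn _); first by rewrite addn1.
have ip : on_strand X i p by apply/on_strandP; exists t, true.
have jp : on_strand X j p by apply/on_strandP; exists t', false.
case: (ltngtP i j) => [ij|ij|/val_inj ij]; [by exists i, j | by exists j, i |].
(* The diagonal of a tile fixes the time of the visit, so one strand cannot enter it on two
   sides. *)
have tt : t = t'.
  have := strand_time E isT; have := strand_time E' isT; rewrite ij; lia.
by move: E; rewrite tt ij E'.
Qed.

End Strands.

(** * Exits and crossings of strands *)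

Section Crossings.
Variables (n : nat) (X : {set box n}).
Hypothesis Xtri : X \subset triangle n.

Local Notation strand_at := (strand_at X).
Local Notation exit_col := (exit_col X).

Definition visits (i : 'I_n.+1) (s : nat * nat * bool) : Prop :=
  exists t, strand_at i t = s.

Lemma visits_step (i : 'I_n.+1) s : visits i s -> visits i (strand_step X s).
Proof. by case=> t E; exists t.+1; rewrite strand_atS E. Qed.

Lemma visits_start (i : 'I_n.+1) : visits i (i.+1, 0, true).
Proof. by exists 0. Qed.

Lemma leaves_row (i : 'I_n.+1) (a b' b : nat) (l : bool) : visits i (a.+1, b', l) ->
  b' <= b ->
  (exists2 c, c <= b & visits i (a, c, false)) \/ visits i (a.+1, b.+1, true).
Proof.
have [k] := ubnP (b - b'); elim: k b' l => // k IHk b' l lek /visits_step + b'b.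
case: stepP => _ v; last by left; exists b'.
have [bb'|lt] := leqP b b'.
  by right; have -> : b = b' by lia.
by apply: IHk v _ => //; lia.
Qed.

(** A strand that comes along the row is turned up by the elbow at the latest. One that enters the
    elbow itself from below is sent right, which the term [~~ l] excludes. *)
Lemma leaves_at_elbow (i : 'I_n.+1) (a b' b : nat) (l : bool) :
    visits i (a.+1, b', l) -> b' + ~~ l <= b -> ~~ is_cross X a b ->
  exists2 c, c <= b & visits i (a, c, false).
Proof.
have [k] := ubnP (b - b'); elim: k b' l => // k IHk b' l lek /visits_step + b'b cab.
case: stepP => c v; last by exists b' => //; apply: leq_trans (leq_addr _ _) b'b.
have lt : b' < b.
  rewrite ltn_neqAle (leq_trans (leq_addr _ _) b'b) andbT; apply/eqP => bb'.
  rewrite -bb' c in cab; move: b'b; rewrite bb' (negbTE cab) /=; lia.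
by apply: (IHk b'.+1 true) v _ cab; lia.
Qed.

(** The strands from rows up to [m] that cross the upper border of row [a] in the columns up to [b];
    for [a = 0] they leave the grid there. *)
Definition upward (m a b : nat) : {set 'I_n.+1} :=
  [set i : 'I_n.+1 | (i <= m) && `[< exists2 c, c <= b & visits i (a, c, false) >]].

(* Among the strands entering row [a] within the columns up to [b], including
   the one that starts in this row, at most one fails to leave it there. *)
Lemma card_upward (m a b : nat) : a <= m -> a <= n ->
  #|upward m a.+1 b| <= #|upward m a b|.
Proof.
move=> am an; pose a' : 'I_n.+1 := Ordinal (an : a < n.+1).
pose Y := [set i : 'I_n.+1 | `[< visits i (a.+1, b.+1, true) >]].
have Y1 : #|Y| <= 1.
  apply/card_le1P => i; rewrite inE => /asboolP[t E] j; rewrite !inE.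
  apply/asboolP/eqP => [[t' E']|->]; last by exists t.
  exact: strand_inj E' E.
have aN : a' \notin upward m a.+1 b.
  rewrite inE negb_and; apply/orP; right; apply/negP => /asboolP[c _ [t E]].
  by have [/andP[_]] := strand_inv Xtri E; rewrite /= ltnn.
have sub : a' |: upward m a.+1 b \subset upward m a b :|: Y.
  apply/subsetP => i; rewrite in_setU1 in_setU => /predU1P[->|].
    have [H|H] := leaves_row (visits_start a') (leq0n b).
      by rewrite inE /= am; apply/orP; left; apply/asboolP.
    by rewrite orbC inE; apply/orP; left; apply/asboolP.
  rewrite inE => /andP[im /asboolP[c cb /leaves_row/(_ cb)[H|H]]].
    by rewrite inE im; apply/orP; left; apply/asboolP.
  by rewrite orbC inE; apply/orP; left; apply/asboolP.
have := leq_trans (subset_leq_card sub) (leq_card_setU _ _).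
rewrite cardsU1 aN /= => le; have := leq_trans le (leq_add (leqnn _) Y1).
by rewrite addnC leq_add2r.
Qed.

Lemma card_upward_le (m a a' b : nat) : a' <= a -> a <= m.+1 -> a <= n.+1 ->
  #|upward m a b| <= #|upward m a' b|.
Proof.
elim: a => [|a IHa]; first by rewrite leqn0 => /eqP->.
rewrite leq_eqVlt => /predU1P[->//|a'a] am an.
apply: leq_trans (card_upward b _ _) (IHa a'a (ltnW am) (ltnW an)).
  exact: am.
exact: an.
Qed.

(** The elbow [p] makes the strand of its row go up within the columns up to [p.2], so by
    [card_upward_le] some strand still does so just below row [q.1]. There it is joined by the
    strand starting in row [q.1]; the elbow [q] turns both up, and two strands remain up to the
    top. *)
Lemma elbows_two_exits (p q : box n) : p \notin X -> q \notin X ->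
    q.1 < p.1 -> p.2 < q.2 ->
  exists i j : 'I_n.+1, [/\ i != j, i <= p.1, j <= p.1,
    exit_col i <= q.2 & exit_col j <= q.2].
Proof.
move=> pX qX qp pq; rewrite -is_crossE in pX; rewrite -is_crossE in qX.
have cp : 0 < #|upward p.1 p.1 p.2|.
  apply/card_gt0P; exists p.1; rewrite inE leqnn; apply/asboolP.
  exact: leaves_at_elbow (visits_start _) _ pX.
have : 0 < #|upward p.1 q.1.+1 p.2|.
  by apply: leq_trans cp (card_upward_le _ _ _ _) => //; apply/ltnW.
case/card_gt0P=> i; rewrite inE => /andP[ip /asboolP[c cp2 ic]].
have iq : i != q.1.
  apply/eqP => iq; case: ic => t E.
  by have [/andP[_]] := strand_inv Xtri E; rewrite iq ltnn.
have up2 : [set i; q.1] \subset upward p.1 q.1 q.2.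
  apply/subsetP => j; rewrite !inE => /orP[]/eqP->.
    rewrite ip; apply/asboolP; apply: leaves_at_elbow ic _ qX.
    by rewrite addn1 (leq_ltn_trans cp2).
  rewrite ltnW //; apply/asboolP.
  exact: leaves_at_elbow (visits_start _) _ qX.
have : 1 < #|upward p.1 0 q.2|.
  apply: leq_trans (card_upward_le q.2 (leq0n q.1) _ _); last 2 first.
  - by apply/ltnW/ltnW.
  - by apply/ltnW.
  by apply: leq_trans (subset_leq_card up2); rewrite cards2 iq.
case/card_gt1P=> j [k [+ + jk]]; rewrite !inE.
move=> /andP[jp /asboolP[cj cjq [tj Ej]]] /andP[kp /asboolP[ck ckq [tk Ek]]].
exists j, k; split=> //.
  by rewrite -(strand_exit_visit Xtri Ej).
by rewrite -(strand_exit_visit Xtri Ek).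
Qed.

(** Only the two ends of the path are recorded: its last vertical run, found backwards from the
    exit, and its first horizontal run. They meet in one elbow, or the first run ends at an earlier
    elbow of row [i]. *)
Lemma exit_path (i : 'I_n.+1) : exists a,
  [/\ a <= i, ~~ is_cross X a (exit_col i),
      forall a', a' < a -> is_cross X a' (exit_col i) &
      (a = i /\ forall b, b < exit_col i -> is_cross X i b) \/
      (a < i /\ exists2 e, e < exit_col i & ~~ is_cross X i e)].
Proof.
have row t h b l : strand_at i t = (h, b, l) ->
    (h = i.+1 /\ forall e, e < b -> is_cross X i e) \/
    (h <= i /\ exists e, [/\ e <= b, l -> e < b & ~~ is_cross X i e]).
  elim: t h b l => [|t IHt] h b l; first by case=> <- <- _; left.
  rewrite strand_atS; case E: (strand_at i t) => [[[|a] b'] l'].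
    by case=> <- <- <-; case: (IHt _ _ _ E) => [[]//|[? [e [? H ?]]]]; right; split=> //;
      exists e.
  have lT : a = i -> l' = true.
    by move=> ai; move: (strand_inv Xtri E) => [+ _ _ _ _]; rewrite ai ltnn andbF; case: (l').
  case: (IHt _ _ _ E) => [[[ai] H]|[ai [e [eb eb' ce]]]]; case: stepP => c [<- <- <-].
  - left; rewrite ai; split=> // e; rewrite ltnS leq_eqVlt => /predU1P[->|/H//].
    by rewrite -ai c lT.
  - right; rewrite ai; split=> //; exists b'; split=> //.
    by rewrite -ai c lT.
  - by right; split=> //; exists e; split=> //; apply: leqW.
  - by right; split; [apply: ltnW | exists e; split=> //].
have col t h b l : strand_at i t = (h, b, l) -> 0 < h + ~~ l ->
    exists a, [/\ visits i (a.+1, b, true), h <= a.+1, forall a', h <= a' < a -> is_cross X a' b &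
      (if l then a.+1 = h else (h <= a) && ~~ is_cross X a b)].
  elim: t h b l => [|t IHt] h b l.
    case=> <- <- <- _; exists i; split=> //; first exact: visits_start.
    by move=> a'; lia.
  rewrite strand_atS; case E: (strand_at i t) => [[[|a] b'] l'].
    case=> <- <- lE; have l'0 : l' = false.
      by have [+ _ _ _ _] := strand_inv Xtri E; case: (l').
    by rewrite -lE l'0 => _; have [|a] := IHt _ _ _ E; rewrite l'0 //; exists a.
  have [|a1 [v1 le1 c1 H1]] := IHt _ _ _ E; first by [].
  have v : visits i (strand_step X (a.+1, b', l')) by apply: visits_step; exists t.
  case: stepP v => c v [<- <- <-] _.
    by exists a; split=> // a'; lia.
  exists a1; case: l' {E v} c H1 => /= c H1.
    case: H1 => a1a; split=> // [|a'|]; [by lia | by lia | by rewrite a1a leqnn c].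
  case/andP: H1 => aa1 ca1; split=> // [|a'|].
  - by lia.
  - case/andP; rewrite leq_eqVlt => /predU1P[<-//|aa'] a'a1.
    by apply: c1; rewrite aa'.
  - by rewrite ltnW.
have [a [va _ ca /andP[_ cae]]] :=
  col _ _ _ _ (strand_exitE Xtri i (leqnn _)) isT.
have ca' a' : a' < a -> is_cross X a' (exit_col i) by move=> H; apply: ca.
case: (va) => t /row[[[ai] H]|[ai [e [_ eb ce]]]].
  by exists a; split=> //; [rewrite ai | left].
by exists a; split=> //; [exact: ltnW | right; split=> //; exists e => //; apply: eb].
Qed.

(** The position of an edge along a diagonal of constant [b - h]: twice the column, plus one for an
    entry from below. Strand [j] is observed [j - i] steps later than strand [i], which puts both on
    the same diagonal. *)
Definition key (s : nat * nat * bool) : nat := 2 * s.1.2 + ~~ s.2.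

Definition shared_cross (s s' : nat * nat * bool) : bool :=
  [&& 0 < s.1.1, s.1 == s'.1 & is_cross X s.1.1.-1 s.1.2].

Local Arguments strand_step : simpl never.

(* Keys order the strands met along a diagonal; two strands are swapped exactly
   at the crosses which they share. *)
Lemma key_step (i j : 'I_n.+1) (t : nat) : i < j ->
    let s := strand_at i t in let s' := strand_at j (t + (j - i)) in
    key s != key s' ->
  (key (strand_step X s) != key (strand_step X s')) &&
  ((key (strand_step X s) < key (strand_step X s')) ==
   ((key s < key s') (+) shared_cross s s')).
Proof.
move=> ij /=; case E: (strand_at i t) => [[h b] l]; case E': (strand_at j _) => [[h' b'] l'].
have [I1 _ I3 I4 I5] := strand_inv Xtri E; have [J1 _ J3 J4 J5] := strand_inv Xtri E'.
have stop c k : strand_step X (0, c, k) = (0, c, k) by [].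
rewrite /shared_cross /key /=.
case: h E I1 I3 I4 => [|a] E I1 I3 I4; case: h' E' J1 J3 J4 => [|a'] E' J1 J3 J4.
- by rewrite !stop addbF => ->; rewrite eqxx.
- have {}I4 := I4 (erefl _); have {}J3 := J3 isT.
  have {I1} l0 : l = false by case: (l) I1.
  have bb' : b < b' by lia.
  by rewrite l0 stop addbF; case: stepP => _ /= _; case: (l') => /=; apply/andP; split;
    move: bb'; clear; lia.
- have {}J4 := J4 (erefl _); have {}I3 := I3 isT.
  have {J1} l0 : l' = false by case: (l') J1.
  have bb' : b' < b by lia.
  by rewrite l0 stop xpair_eqE /= addbF; case: stepP => _ /= _; case: (l) => /=; apply/andP;
    split; move: bb'; clear; lia.
have {}J3 := J3 isT; have {}I3 := I3 isT.
have diag : b + a' = b' + a by lia.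
case: (ltngtP b b') => bb'.
- rewrite xpair_eqE (ltn_eqF bb') andbF addbF.
  by case: stepP => _; case: stepP => _ /=; case: (l) (l') => [] [] /= _; apply/andP; split;
    move: bb'; clear; lia.
- rewrite xpair_eqE (gtn_eqF bb') andbF addbF.
  by case: stepP => _; case: stepP => _ /=; case: (l) (l') => [] [] /= _; apply/andP; split;
    move: bb'; clear; lia.
have aa' : a = a' by lia.
subst b' a'; rewrite eqxx /=.
case: stepP => c; case: stepP => c' /=; rewrite c; move: c c';
  case: (is_cross X a b) (l) (l') => [] [] [] //= _ _ H; apply/andP; split; move: H; clear; lia.
Qed.

Lemma key_start (i j : 'I_n.+1) : i < j ->
  key (strand_at i 0) < key (strand_at j (0 + (j - i))).
Proof.
move=> ij; rewrite add0n; case E: (strand_at j _) => [[h b] l].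
have [_ _ _ _ H] := strand_inv Xtri E; rewrite /key /=.
by case: (l) H => /=; [case=> //; lia | lia].
Qed.

Lemma key_exit (i : 'I_n.+1) (t : nat) : 2 * n.+1 <= t ->
  key (strand_at i t) = 2 * exit_col i + 1.
Proof. by move=> /(strand_exitE Xtri i) ->. Qed.

Lemma shared_cross_box (i j : 'I_n.+1) (t t' : nat) :
  shared_cross (strand_at i t) (strand_at j t') ->
  exists p : box n, [/\ p \in X, on_strand X i p, on_strand X j p &
    exists l, strand_at i t = (p.1.+1, nat_of_ord p.2, l)].
Proof.
case E: (strand_at i t) => [[h b] l]; case E': (strand_at j t') => [[h' b'] l'].
case/and3P=> /= h0 /eqP[hh bb] /is_cross_ord[p [pX pa pb]].
have hE : h = p.1.+1 by rewrite pa prednK.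
subst h' b'; rewrite hE -pb in E E' *; exists p; split=> //.
- by apply/on_strandP => //; exists t, l.
- by apply/on_strandP => //; exists t', l'.
- by exists l.
Qed.

Lemma uncrossed_exit (i j : 'I_n.+1) : i < j ->
  (forall p, p \in X -> on_strand X i p -> on_strand X j p -> False) ->
  exit_col i < exit_col j.
Proof.
move=> ij noX; have ord t : key (strand_at i t) < key (strand_at j (t + (j - i))).
  elim: t => [|t IHt]; first exact: key_start.
  have /= := @key_step i j t ij; rewrite neq_ltn IHt => /(_ isT)/andP[_ /eqP].
  move=> ->; rewrite addTb; apply/negP => /shared_cross_box.
  by case=> p [pX ip jp _]; apply: (noX p).
have := ord (2 * n.+1); rewrite !key_exit ?leq_addr //; lia.
Qed.

Lemma crossed_once_exit (i j : 'I_n.+1) (p : box n) : i < j ->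
    p \in X -> on_strand X i p -> on_strand X j p ->
    (forall q, q \in X -> on_strand X i q -> on_strand X j q -> q = p) ->
  exit_col j < exit_col i.
Proof.
move=> ij pX /(on_strandP Xtri)[t0 [l E]] /(on_strandP Xtri)[t1 [l' E']] uniqp.
have T0 := strand_time Xtri E isT; have T1 := strand_time Xtri E' isT.
have t1E : t1 = t0 + (j - i) by lia.
have sh t : shared_cross (strand_at i t) (strand_at j (t + (j - i))) = (t == t0).
  apply/idP/eqP => [/shared_cross_box[q [qX iq jq [l'' E'']]]|->].
    rewrite (uniqp q qX iq jq) in E''; have := strand_time Xtri E'' isT; lia.
  by rewrite -t1E E E' /shared_cross /= eqxx is_crossE.
have ord t : (key (strand_at i t) != key (strand_at j (t + (j - i)))) &&
    ((key (strand_at i t) < key (strand_at j (t + (j - i)))) == (t <= t0)).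
  elim: t => [|t /andP[IHt /eqP IHt']]; first by rewrite neq_ltn key_start.
  have /= := @key_step i j t ij IHt; move=> /andP[-> /eqP ->].
  by rewrite sh IHt' /=; case: (ltngtP t t0).
have t0N := strand_active_time Xtri E isT.
have /andP[+ /eqP] := ord (2 * n.+1).
rewrite !key_exit ?leq_addr // [2 * n.+1 <= t0]leqNgt t0N /=; lia.
Qed.

End Crossings.

(** * Pipe dreams from spanning trees *)

(** Let [c] be the first column where they differ, with [s c < p c], say. The value [s c] comes
    after position [c] in [p], so [(s c, c)] lies in the diagram of [p] but not in that of [s]. *)
Lemma diagram_inj (n : nat) (s p : 'S_n.+1) : diagram s = diagram p -> s = p.
Proof.
have step (s1 p1 : 'S_n.+1) (c : 'I_n.+1) : diagram s1 = diagram p1 ->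
    (forall d : 'I_n.+1, d < c -> s1 d = p1 d) -> ~~ (s1 c < p1 c).
  move=> sp eq; apply/negP => lt; have : (s1 c, c) \in diagram s1.
    rewrite sp mem_diagram lt /= ltnNge; apply/negP; rewrite leq_eqVlt.
    case/orP=> [/eqP/val_inj E|/eq].
      by move: lt; rewrite -{2}E permKV ltnn.
    rewrite permKV => /perm_inj E; move: lt; rewrite -[in X in _ < X]E permKV ltnn //.
  by rewrite mem_diagram ltnn.
move=> sp; apply/permP => c.
have [k] := ubnP (c : nat); elim: k c => // k IHk c; rewrite ltnS => ck.
have eq (d : 'I_n.+1) : d < c -> s d = p d.
  by move=> dc; apply: IHk; apply: leq_trans ck.
apply/val_inj; case: (ltngtP (s c) (p c)) => // H.
  by have := step s p c sp eq; rewrite H.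
by have := step p s c (esym sp) (fun d dc => esym (eq d dc)); rewrite H.
Qed.

Section TreesAndDreams.
Variables (n : nat) (pi : 'S_n.+1).
Hypotheses (pi0 : pi ord0 = ord0) (pi_dom : dominant_tail pi).

Local Notation dg := (dg pi).
Local Notation rgn := (rgn pi).
Local Notation box_edge := (box_edge pi0 pi_dom).
Local Notation vtx := (label_vertex pi0 pi_dom).

Let memE := mem_region pi0 pi_dom.

Lemma core_sub_triangle : core_region pi \subset triangle n.
Proof.
apply/subsetP => p; rewrite mem_core_region // inE.
by case/orP=> /(dg_bound pi0 pi_dom); rewrite ?addnS.
Qed.

Lemma exit_of_trace (X : {set box n}) : X \subset triangle n ->
  [forall j : 'I_n.+1, strand_exit X (pi j) == (0, nat_of_ord j, false)] ->
  forall i, exit_col X i = (pi^-1)%g i.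
Proof.
move=> Xtri /forallP tr i; have := tr ((pi^-1)%g i); rewrite permKV => /eqP.
exact: (fun E => esym (strand_exit_visit Xtri E)).
Qed.

Lemma reduced_elbows_free (X : {set box n}) (p q : box n) :
  reduced_pipe_dream pi X -> p \notin X -> q \notin X -> ~~ boxes_conflict pi p q.
Proof.
case/and3P=> Xtri tr _ pX qX; apply/negP => /and3P[qp pq D].
have exitE := exit_of_trace Xtri tr.
have [i [j [ij ip jp iq jq]]] := elbows_two_exits Xtri pX qX qp pq.
have is0 (k : 'I_n.+1) : k <= p.1 -> exit_col X k <= q.2 -> k = ord0.
  move=> kp; rewrite exitE => kq; apply/val_inj/eqP; rewrite /= -leqn0 leqNgt.
  apply/negP => k0; have [_ q0] := dg_gt0 pi0 D.
  have := @dg_sub _ _ pi0 pi_dom _ _ k q.2 D; rewrite k0 kp q0 leqnn.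
  case/(_ isT isT)/dg_ord=> k' [q' [/val_inj <- /val_inj <- _]].
  by rewrite ltnNge kq.
by move/eqP: ij; apply; rewrite (is0 i) // (is0 j).
Qed.

Lemma card_bottom_dream : #|bottom_dream pi| = #|diagram pi|.
Proof.
have inj : {in bottom_dream pi &, injective (fun p : box n => (p.1, inord p.2.+1) : box n)}.
  move=> [a b] [a' b']; rewrite !mem_bottom_dream //= => /(dg_bound pi0 pi_dom) h.
  move=> /(dg_bound pi0 pi_dom) h' [-> /(congr1 val)/=].
  by rewrite !inordK ?ltnS => [[/val_inj->]//||]; lia.
rewrite -(card_in_imset inj); apply: eq_card => -[a b]; apply/imsetP/idP.
  case=> -[a' b']; rewrite mem_bottom_dream //= => D [-> ->].
  have := dg_bound pi0 pi_dom D => h.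
  rewrite -is_crossE /= inordK //; last by rewrite ltnS; lia.
rewrite -is_crossE => /= D; have [_ b0] := dg_gt0 pi0 D.
have lt : b.-1 < n.+1 by rewrite (leq_ltn_trans (leq_pred _)).
exists (a, Ordinal lt); first by rewrite mem_bottom_dream //= prednK.
by congr pair; apply/val_inj; rewrite /= inordK prednK.
Qed.

Lemma bottom_sub_region : bottom_dream pi \subset region pi.
Proof. by apply/subsetP => p; rewrite memE /rgn mem_bottom_dream // => ->; rewrite orbT. Qed.

(** This conflict-free graph of known size is what spanning trees are measured against in
    [card_tree_crosses]. *)
Lemma bottom_elbows_free : conflict_free (box_edge @: (region pi :\: bottom_dream pi)).
Proof.
move=> _ _ /imsetP[p /setDP[pR pb] ->] /imsetP[q /setDP[qR _] ->].
rewrite conflict_boxes //; apply/negP => /and3P[qp pq D]; case/negP: pb.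
rewrite mem_bottom_dream //; apply: (dg_sub pi0 pi_dom D); last by rewrite /= pq.
by rewrite leqnn andbT (leq_ltn_trans _ qp).
Qed.

(** * The pipe dream of a conflict-free spanning tree *)

Section DreamOfTree.
Variable T : graph (nlabels pi).
Hypotheses (TE : T \subset transitive_closure (tree pi)) (Tf : conflict_free T)
  (Tc : connected T) (T0 : box_edge (ord0, ord0) \in T).

Definition tree_crosses : {set box n} := [set p in region pi | box_edge p \notin T].
Local Notation X := tree_crosses.

Lemma tree_crosses_triangle : X \subset triangle n.
Proof.
apply/subsetP => p; rewrite inE => /andP[pR pT]; apply: (subsetP core_sub_triangle).
by move: pR; rewrite in_setU1 => /predU1P[p0|//]; rewrite p0 T0 in pT.
Qed.

Let Xtri := tree_crosses_triangle.

Lemma elbow_edge (p : box n) : p \in region pi -> ~~ is_cross X p.1 p.2 -> box_edge p \in T.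
Proof. by move=> pR; rewrite is_crossE inE pR negbK. Qed.

Lemma cross_edge (p : box n) : is_cross X p.1 p.2 -> box_edge p \notin T.
Proof. by rewrite is_crossE inE => /andP[]. Qed.

Lemma tree_edge_box e : e \in T -> exists2 p, p \in region pi & e = box_edge p.
Proof. by move=> /(subsetP TE); rewrite closureE => /imsetP. Qed.

Lemma T_increasing : increasing T.
Proof. exact: increasing_sub TE (@closure_increasing _ _). Qed.

(* The labels between those of column [c] and row [r] would form a union of
   components of the connected graph [T]. *)
Lemma no_isolated_corner (r c : 'I_n.+1) : dg r c -> ~~ is_cross X r c ->
    (forall b, b < c -> is_cross X r b) -> (forall a, a < r -> is_cross X a c) ->
  False.
Proof.
move=> D rc row col; have [r0 c0] := dg_gt0 pi0 D.
pose x := vtx (inl c); pose y := vtx (inr r).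
have cB : rgn 0 c by apply: (rgn_sub pi0 pi_dom (dg_rgn_up pi0 D)).
have rB : rgn r 0 by apply: (rgn_sub pi0 pi_dom (dg_rgn_left pi0 D)).
have cbd : (inl c : bstep n) \in boundary (region pi) by rewrite mem_boundary.
have rbd : (inr r : bstep n) \in boundary (region pi) by rewrite mem_boundary.
have xy : x <= y /\ (x < y -> (x, y) \in T).
  rewrite /x /y vertex_le ?vertex_lt ?mem_boundary //.
  have [rcR|nrc] := boolP (rgn r c); last first.
    by rewrite (label_corner pi0 pi_dom D nrc) ltnn.
  split; first exact/ltnW/label_box.
  by move=> _; apply: (@elbow_edge (r, c)); rewrite ?memE.
case: xy => xy xyT.
pose S := [pred v : 'I_(nlabels pi) | x <= v <= y].
have colP (p : box n) : p \in region pi -> vtx (inl p.2) = x -> p.2 = c.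
  move=> pR E; have /andP[p2 _] := region_steps pi0 pi_dom pR.
  have : label pi (inl p.2) = label pi (inl c).
    by rewrite (label_vertexE pi0 pi_dom p2) (label_vertexE pi0 pi_dom cbd) E.
  rewrite mem_boundary // in p2.
  move=> l; apply/val_inj; case: (ltngtP p.2 c) => // lt.
    by have := label_cols pi0 pi_dom cB lt; rewrite l ltnn.
  by have := label_cols pi0 pi_dom p2 lt; rewrite l ltnn.
have rowP (p : box n) : p \in region pi -> vtx (inr p.1) = y -> p.1 = r.
  move=> pR E; have /andP[_ p1] := region_steps pi0 pi_dom pR.
  have : label pi (inr p.1) = label pi (inr r).
    by rewrite (label_vertexE pi0 pi_dom p1) (label_vertexE pi0 pi_dom rbd) E.
  rewrite mem_boundary // in p1.
  move=> l; apply/val_inj; case: (ltngtP p.1 r) => // lt.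
    by have := label_rows pi0 pi_dom rB lt; rewrite l ltnn.
  by have := label_rows pi0 pi_dom p1 lt; rewrite l ltnn.
(* An edge leaving [[x, y]] conflicts with [(x, y)] unless it starts at [x] or ends at [y]. In these
   cases it is an elbow above row [r] in column [c], or left of column [c] in row [r], and those
   tiles are crosses. *)
have edgeS (e : 'I_(nlabels pi) * 'I_(nlabels pi)) : e \in T -> (e.1 \in S) = (e.2 \in S).
  move=> eT; have elt := T_increasing eT; have [p pR eE] := tree_edge_box eT.
  have pX : ~~ is_cross X p.1 p.2 by rewrite is_crossE inE pR -eE eT.
  have /andP[p2 p1] := region_steps pi0 pi_dom pR.
  have cf f g := Tf (e := f) (f := g).
  apply/idP/idP; rewrite !inE => /andP[h1 h2].
    rewrite (leq_trans h1 (ltnW elt)) /= leqNgt; apply/negP => h3.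
    move: h1; rewrite leq_eqVlt => /orP[/eqP/val_inj h1|h1]; last first.
      have := cf _ _ (xyT (leq_trans h1 h2)) eT.
      by rewrite /conflict /= h1 h2 h3.
    have pc : p.2 = c by apply: colP => //; rewrite h1 eE.
    case/negP: pX; rewrite pc; apply: col.
    move: h3; rewrite eE /= /y (vertex_lt pi0 pi_dom rbd p1) => h3.
    rewrite ltnNge leq_eqVlt; apply/negP => /orP[/eqP/val_inj E|lt].
      by rewrite E ltnn in h3.
    rewrite mem_boundary // in p1.
    by have := ltn_trans h3 (label_rows pi0 pi_dom p1 lt); rewrite ltnn.
  rewrite andbC (leq_trans (ltnW elt) h2) /= leqNgt; apply/negP => h3.
  move: h2; rewrite leq_eqVlt => /orP[/eqP/val_inj h2|h2]; last first.
    have := cf _ _ eT (xyT (leq_ltn_trans h1 h2)).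
    by rewrite /conflict /= h1 h2 h3.
  have pr : p.1 = r by apply: rowP => //; rewrite -h2 eE.
  case/negP: pX; rewrite pr; apply: row.
  move: h3; rewrite eE /= /x (vertex_lt pi0 pi_dom p2 cbd) => h3.
  rewrite ltnNge leq_eqVlt; apply/negP => /orP[/eqP/val_inj E|lt].
    by rewrite E ltnn in h3.
  rewrite mem_boundary // in p2.
  by have := ltn_trans h3 (label_cols pi0 pi_dom p2 lt); rewrite ltnn.
have closedS : closed (adjacent T) S.
  by move=> v w /orP[/edgeS|/edgeS/esym].
have := closed_connect closedS (Tc x (vtx (inl ord0))).
rewrite !inE leqnn xy /= leqNgt.
have -> : vtx (inl ord0) < x.
  by rewrite /x vertex_lt ?mem_boundary // label_cols.
by [].
Qed.

(** An exit [d] with [0 < d <= c] would make [(r, d)] a box of the diagram. By [exit_path] the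
    strand then either turns only once, at an isolated corner, or has elbows [(r, e)] and [(a, d)]
    that conflict. Exit 0 is barred by the elbow at the origin. *)
Lemma tree_exit_gt (r : 'I_n.+1) (c : nat) : dg r c -> c < exit_col X r.
Proof.
move=> D; rewrite ltnNge; apply/negP => le.
have [r0 _] := dg_gt0 pi0 D.
have [a [ar nac col alt]] := exit_path Xtri r.
set d := exit_col X r in le nac col alt.
have [d0|d0] := posnP d.
  have a0 : a = 0.
    apply/eqP; rewrite -leqn0 leqNgt; apply/negP => /col; rewrite d0.
    by move/(@cross_edge (ord0, ord0)); rewrite T0.
  case: alt => [[ra _]|[_ [e]]]; first by rewrite -ra a0 in r0.
  by rewrite d0.
have Dd : dg r d by apply: (dg_sub pi0 pi_dom D); rewrite ?r0 ?d0 ?leqnn.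
have [i [j [ri dj _ _]]] := dg_ord Dd.
rewrite dj in nac col Dd alt.
case: alt => [[ra row]|[lt [e ej ce]]].
  by rewrite ra in nac col; apply: (no_isolated_corner Dd nac).
have eR : rgn r e.
  by rewrite /rgn (dg_sub pi0 pi_dom Dd) ?orbT //= r0 leqnn.
have aR : rgn a j.
  by rewrite /rgn (dg_sub pi0 pi_dom Dd (a' := a.+1)) ?orbT //= -?dj ?d0 leqnn.
have [p [pR p1 p2]] := rgn_ord pi0 pi_dom eR.
have [q [qR q1 q2]] := rgn_ord pi0 pi_dom aR.
rewrite -p1 -p2 in ce; rewrite -q1 -q2 in nac.
have := Tf (elbow_edge pR ce) (elbow_edge qR nac).
by rewrite conflict_boxes // /boxes_conflict p1 p2 q1 q2 lt ej Dd.
Qed.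

Lemma tree_exit_0 : exit_col X ord0 = 0.
Proof.
have [a [ar nac col alt]] := exit_path Xtri ord0.
case: alt => [[_ row]|[]]; last by rewrite ltn0.
apply/eqP; rewrite -leqn0 leqNgt; apply/negP => /row.
by move/(@cross_edge (ord0, ord0)); rewrite T0.
Qed.

Definition exit_ord (i : 'I_n.+1) : 'I_n.+1 := inord (exit_col X i).

Lemma exit_ordE i : exit_ord i = exit_col X i :> nat.
Proof. by rewrite inordK // ltnS exit_col_bound. Qed.

Lemma exit_ord_inj : injective exit_ord.
Proof. by move=> i j /(congr1 val); rewrite /= !exit_ordE; apply: exit_col_inj. Qed.

Definition traced : 'S_n.+1 := ((perm exit_ord_inj)^-1)%g.

Lemma tracedV i : (traced^-1)%g i = exit_col X i :> nat.
Proof. by rewrite /traced invgK permE exit_ordE. Qed.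

(** The bound [tree_exit_gt] is used twice: for strand [r], and for the strand that exits at [c],
    which would exit further right if it started in one of the rows 1 to [r]. *)
Lemma diagram_sub_traced : diagram pi \subset diagram traced.
Proof.
apply/subsetP => -[r c]; rewrite -is_crossE /= => D.
rewrite mem_diagram tracedV tree_exit_gt // andbT.
have [r0 c0] := dg_gt0 pi0 D.
have E : exit_col X (traced c) = c by rewrite -tracedV permK.
rewrite ltnNge; apply/negP => le.
have [z|nz] := posnP (traced c).
  have {}z : traced c = ord0 by apply/val_inj.
  by move: c0; rewrite -E z tree_exit_0.
have : c < exit_col X (traced c).
  by apply: tree_exit_gt; apply: (dg_sub pi0 pi_dom D); rewrite ?nz ?c0 ?leqnn.
by rewrite E ltnn.
Qed.

(** By [free_card_le] the connected graph [T] has at least as many edges as the bottom dream has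
    elbows in the region; then pass to complements. *)
Lemma card_tree_crosses : #|X| <= #|diagram pi|.
Proof.
have inj (A : {set box n}) : A \subset region pi -> #|box_edge @: A| = #|A|.
  move=> /subsetP AR; apply: card_in_imset => p q /AR pR /AR qR.
  exact: box_edge_inj.
have TX : T = box_edge @: (region pi :\: X).
  apply/setP => e; apply/idP/imsetP => [eT|[p /setDP[pR pX] ->]].
    have [p pR eE] := tree_edge_box eT; exists p => //.
    by rewrite in_setD pR andbT [p \in X]in_set pR -eE eT.
  by apply: elbow_edge; rewrite ?is_crossE.
have XR : X \subset region pi by apply/subsetP => p; rewrite inE => /andP[].
have inc : increasing (box_edge @: (region pi :\: bottom_dream pi)).
  move=> _ /imsetP[p /setDP[pR _] ->].
  by apply: (@closure_increasing _ (tree pi)); apply: box_edge_closure.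
have := free_card_le bottom_elbows_free inc Tc.
rewrite [in leqRHS]TX !inj ?subsetDl // !cardsDS // ?bottom_sub_region //.
rewrite -card_bottom_dream => le.
have := subset_leq_card XR; have := subset_leq_card bottom_sub_region; lia.
Qed.

Lemma crossing_tile (i j : 'I_n.+1) : i < j -> exit_col X j < exit_col X i ->
  exists p, [/\ p \in X, on_strand X i p & on_strand X j p].
Proof.
move=> ij ji; apply: contrapT => H.
have : exit_col X i < exit_col X j.
  by apply: uncrossed_exit => // p pX ip jp; apply: H; exists p.
by move=> /ltn_trans/(_ ji); rewrite ltnn.
Qed.

(* Each box of the diagram yields a crossing of its own, which uses up all the
   crosses of [X]; so there is neither a double crossing nor a further
   inversion. *)
Lemma crosses_of_diagram :
  diagram pi = diagram traced /\ no_double_crossing X /\ #|X| = #|diagram pi|.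
Proof.
have tile (d : box n) : exists p : box n, d \in diagram pi ->
    [/\ d.1 < traced d.2, p \in X, on_strand X d.1 p & on_strand X (traced d.2) p].
  have [dD|] := boolP (d \in diagram pi); last by exists d.
  have := subsetP diagram_sub_traced _ dD; case: (d) => r c.
  rewrite mem_diagram tracedV => /andP[rc cr].
  have [|p [pX rp cp]] := crossing_tile rc; first by rewrite -tracedV permK.
  by exists p.
have [f fP] := choice tile.
have same (d : box n) (i j : 'I_n.+1) : d \in diagram pi -> i < j ->
    on_strand X i (f d) -> on_strand X j (f d) -> i = d.1 /\ j = traced d.2.
  move=> dD ij ip jp; have [rs pX rp sp] := fP d dD.
  have ne : d.1 != traced d.2 by rewrite -val_eqE /= ltn_eqF.
  have [iE|iE] := two_strands Xtri ne rp sp ip;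
    have [jE|jE] := two_strands Xtri ne rp sp jp => //.
  - by rewrite iE jE ltnn in ij.
  - by rewrite iE jE in ij; have := ltn_trans ij rs; rewrite ltnn.
  - by rewrite iE jE ltnn in ij.
have finj : {in diagram pi &, injective f}.
  move=> d e dD eD E; have [rs _ rp sp] := fP d dD; rewrite E in rp sp.
  have [d1 /perm_inj d2] := same e _ _ eD rs rp sp.
  by case: d e d1 d2 {dD eD E rs rp sp} => [? ?] [? ?] /= -> ->.
have fX : f @: diagram pi = X.
  apply/eqP; rewrite eqEcard card_in_imset // card_tree_crosses andbT.
  by apply/subsetP => _ /imsetP[d /fP[_ pX _ _] ->].
split; [|split].
- apply/eqP; rewrite eqEsubset diagram_sub_traced /=; apply/subsetP => -[r c].
  rewrite mem_diagram tracedV => /andP[rc cr].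
  have [|p [pX rp cp]] := crossing_tile rc; first by rewrite -tracedV permK.
  move: pX; rewrite -fX => /imsetP[d dD pE]; rewrite pE in rp cp.
  have [/= -> /perm_inj ->] := same d _ _ dD rc rp cp.
  by rewrite -surjective_pairing.
- apply/forallP => i; apply/forallP => j; apply/implyP => ij.
  apply/card_le1P => p; rewrite inE => /and3P[pX ip jp] q; rewrite [LHS]inE [RHS]inE.
  apply/and3P/eqP => [[qX iq jq]|->]; last by split.
  move: pX qX; rewrite -fX => /imsetP[d dD pE] /imsetP[e eD qE].
  rewrite pE in ip jp *; rewrite qE in iq jq *.
  have [d1 d2] := same d _ _ dD ij ip jp; have [e1 e2] := same e _ _ eD ij iq jq.
  congr f; move: d2; rewrite e2 => /perm_inj.
  by rewrite e1 in d1; case: (d) (e) d1 => [? ?] [? ?] /= -> ->.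
- by rewrite -fX card_in_imset.
Qed.

Lemma tree_crosses_reduced : reduced_pipe_dream pi X.
Proof.
have [/diagram_inj E [ndc _]] := crosses_of_diagram.
apply/and3P; split=> //; apply/forallP => j.
have := @strand_exitE _ _ Xtri (pi j) (2 * n.+1) (leqnn _).
by rewrite -tracedV -E permK => <-.
Qed.

End DreamOfTree.
End TreesAndDreams.

(** * The core of the pipe dream complex *)

Lemma mem_coning (V : finType) (C : {set {set V}}) (S : {set option V}) :
  (S \in coning C) = ([set v | Some v \in S] \in C).
Proof.
have preS (F : {set V}) : [set v | Some v \in Some @: F] = F.
  by apply/setP => v; rewrite inE mem_imset // => x y [].
have preN (F : {set V}) : [set v | Some v \in None |: Some @: F] = F.
  by apply/setP => v; rewrite !inE /= mem_imset // => x y [].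
rewrite in_setU; apply/orP/idP => [[]/imsetP[F FC ->]|SC]; rewrite ?preS ?preN //.
have [NS|NS] := boolP (None \in S); [right | left]; apply/imsetP; eexists; try exact: SC.
  apply/setP => -[v|]; rewrite !inE /=; last by rewrite NS.
  by rewrite mem_imset ?inE // => x y [].
apply/setP => -[v|]; last first.
  by rewrite (negbTE NS); apply/esym/negP => /imsetP[].
by rewrite mem_imset ?inE // => x y [].
Qed.

Section CoreComplex.
Variables (n : nat) (pi : 'S_n.+1).
Hypotheses (pi0 : pi ord0 = ord0) (pi_dom : dominant_tail pi).

Local Notation dg := (dg pi).
Local Notation box_edge := (box_edge pi0 pi_dom).

Definition boxes_free (F : {set box n}) : Prop :=
  forall p q, p \in F -> q \in F -> ~~ boxes_conflict pi p q.

Lemma origin_in_region : (ord0, ord0) \in region pi.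
Proof. exact: setU11. Qed.

Lemma boxes_conflict_origin (p : box n) :
  ~~ boxes_conflict pi (ord0, ord0) p /\ ~~ boxes_conflict pi p (ord0, ord0).
Proof. by split; rewrite /boxes_conflict ltn0 // andbF. Qed.

Lemma boxes_free_edges (F : {set box n}) : F \subset region pi -> boxes_free F ->
  conflict_free (box_edge @: ((ord0, ord0) |: F)).
Proof.
move=> /subsetP FR Ff _ _ /imsetP[p pF ->] /imsetP[q qF ->].
have inR x : x \in (ord0, ord0) |: F -> x \in region pi.
  by rewrite in_setU1 => /predU1P[->|/FR//]; apply: origin_in_region.
rewrite conflict_boxes ?inR //; move: pF qF; rewrite !in_setU1.
case/predU1P=> [->|pF]; first by case: (boxes_conflict_origin q).
case/predU1P=> [->|qF]; first by case: (boxes_conflict_origin p).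
exact: Ff.
Qed.

(** Boxes of [F] outside the region are elbows anyway, since the dream of a tree has its crosses in
    the region. The origin conflicts with nothing and can be added before extending to a tree. *)
Lemma boxes_free_dream (F : {set box n}) : boxes_free F -> exists X,
  [/\ reduced_pipe_dream pi X, forall p, p \in F -> p \notin X & #|X| = #|diagram pi|].
Proof.
move=> Ff.
have FRf : boxes_free (F :&: region pi).
  by move=> p q /setIP[pF _] /setIP[qF _]; apply: Ff.
have sub : box_edge @: ((ord0, ord0) |: (F :&: region pi)) \subset
    transitive_closure (tree pi).
  rewrite (closureE pi0 pi_dom); apply: imsetS.
  by rewrite subUset sub1set origin_in_region subsetIr.
have [T [FT TE Tf Tc]] := free_extension (@closure_increasing _ (tree pi))
  (closure_exchange pi0 pi_dom) (closure_connected pi0 pi_dom) sub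
  (boxes_free_edges (subsetIr _ _) FRf).
have T0 : box_edge (ord0, ord0) \in T.
  by apply: (subsetP FT); apply: imset_f; apply: setU11.
exists (tree_crosses pi0 pi_dom T); split.
- exact: tree_crosses_reduced.
- move=> p pF; apply/negP; rewrite in_set => /andP[pR /negP]; apply.
  by apply: (subsetP FT); apply: imset_f; rewrite in_setU1 in_setI pF pR orbT.
- by have [_ [_ ->]] := crosses_of_diagram TE Tf Tc T0.
Qed.

Lemma mem_PD (F : {set box n}) :
  F \in PD pi <-> F \subset triangle n /\ boxes_free F.
Proof.
rewrite inE; split=> [/existsP[G /andP[/imsetP[X Xr ->] FX]]|[Ft Ff]].
  rewrite inE in Xr; have FXP p : p \in F -> p \notin X.
    by move/(subsetP FX); rewrite in_setD => /andP[].
  split; first exact: subset_trans FX (subsetDl _ _).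
  by move=> p q /FXP pX /FXP qX; apply: reduced_elbows_free Xr pX qX.
have [X [Xr FX _]] := boxes_free_dream Ff.
apply/existsP; exists (triangle n :\: X); rewrite imset_f ?inE //=.
by apply/subsetP => p pF; rewrite in_setD FX // (subsetP Ft).
Qed.

(** Two strands that share a cross share only this one, so it accounts for an inversion of [pi], and
    distinct crosses account for distinct inversions. *)
Lemma card_reduced_pipe_dream (X : {set box n}) : reduced_pipe_dream pi X ->
  #|X| <= #|diagram pi|.
Proof.
case/and3P=> Xtri tr ndc; have exitE := exit_of_trace Xtri tr.
have ndcP (i j : 'I_n.+1) p q : i < j -> p \in X -> on_strand X i p -> on_strand X j p ->
    q \in X -> on_strand X i q -> on_strand X j q -> q = p.
  move=> ij pX ip jp qX iq jq.
  move/forallP: ndc => /(_ i)/forallP/(_ j); rewrite ij => /card_le1P/(_ p).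
  rewrite [_ \in _]inE pX ip jp => /(_ isT q).
  by rewrite [LHS]inE qX iq jq [RHS]inE => /esym/eqP.
have strands (p : box n) : exists d : box n, p \in X ->
    [/\ d.1 < pi d.2, d \in diagram pi, on_strand X d.1 p & on_strand X (pi d.2) p].
  have [pX|] := boolP (p \in X); last by exists p.
  have [i [j [ij ip jp]]] := cross_two_strands Xtri pX.
  exists (i, (pi^-1)%g j) => _; rewrite /= permKV; split=> //.
  rewrite mem_diagram permKV ij /= -!exitE.
  by apply: (crossed_once_exit Xtri ij pX ip jp) => q qX iq jq; apply: (ndcP i j).
have [f fP] := choice strands.
have finj : {in X &, injective f}.
  move=> p q pX qX E; have [ij _ ip jp] := fP p pX; have [_ _ iq jq] := fP q qX.
  rewrite -E in iq jq; exact: (ndcP _ _ _ _ ij qX iq jq pX ip jp).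
rewrite -(card_in_imset finj); apply: subset_leq_card.
by apply/subsetP => _ /imsetP[p /fP[_ pD _ _] ->].
Qed.

(* A cross of a reduced pipe dream outside the core region could be spared, as
   no box conflicts with it; but all these pipe dreams have as many crosses. *)
Lemma mem_PD_cone (v : box n) : v \in triangle n ->
  (v \in PD_cone pi) = (v \notin core_region pi).
Proof.
move=> vt; rewrite inE vt /=; apply/forall_inP/idP => [cone|vcr G /imsetP[X]].
  apply/negP; rewrite mem_core_region // => vcr.
  suff [w [wt vw]] : exists w : box n, w \in triangle n /\
      (boxes_conflict pi v w || boxes_conflict pi w v).
    have /mem_PD : [set w] \subset triangle n /\ boxes_free [set w].
      split; first by rewrite sub1set.
      by move=> p q /set1P-> /set1P->; rewrite /boxes_conflict ltnn.
    rewrite inE => /existsP[G /andP[GF wG]]; have vG := cone G GF.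
    move: GF vG wG; case/imsetP=> X; rewrite inE => Xr ->.
    rewrite sub1set !in_setD => /andP[vX _] /andP[wX _]; move: vw.
    by rewrite (negbTE (reduced_elbows_free pi0 pi_dom Xr vX wX))
      (negbTE (reduced_elbows_free pi0 pi_dom Xr wX vX)).
  (* The box in conflict with [v] is the top of the next column or the left end of the next row. *)
  case/orP: vcr => D; have := dg_bound pi0 pi_dom D; have [a0 b0] := dg_gt0 pi0 D => le.
    have lt : v.2.+1 < n.+1 by lia.
    exists (ord0, Ordinal lt); split; first by rewrite inE /=; lia.
    by rewrite /boxes_conflict /= a0 D leqnn.
  have lt : v.1.+1 < n.+1 by lia.
  exists (Ordinal lt, ord0); split; first by rewrite inE /=; lia.
  by rewrite orbC /boxes_conflict /= b0 D leqnn.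
rewrite inE => Xr ->; rewrite in_setD vt andbT; apply/negP => vX.
have Ff : boxes_free (v |: (triangle n :\: X)).
  have vfree q : ~~ boxes_conflict pi v q && ~~ boxes_conflict pi q v.
    rewrite -negb_or; apply: contra vcr; rewrite mem_core_region //.
    case/orP=> /and3P[lt1 lt2 D]; apply/orP; [left | right];
      apply: (dg_sub pi0 pi_dom D); have [a0 b0] := dg_gt0 pi0 D; lia.
  move=> p q; rewrite !in_setU1 => /predU1P[->|pX]; first by case/andP: (vfree q).
  case/predU1P=> [->|qX]; first by case/andP: (vfree p).
  case/setDP: pX => _ pX; case/setDP: qX => _ qX.
  exact: reduced_elbows_free Xr pX qX.
have [Y [Yr YF Yc]] := boxes_free_dream Ff.
have := card_reduced_pipe_dream Xr; rewrite -Yc leqNgt => /negP; apply.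
apply: proper_card; apply/properP; split; last by exists v => //; apply: YF; apply: setU11.
apply/subsetP => p pY; apply: contraTT pY => pX.
have [pt|pt] := boolP (p \in triangle n).
  by apply: YF; rewrite in_setU1 in_setD pX pt orbT.
by case/and3P: Yr => /subsetP Yt _ _; apply: contra pt; apply: Yt.
Qed.

Lemma mem_core (F : {set box n}) :
  F \in core pi <-> F \subset core_region pi /\ boxes_free F.
Proof.
have crt := core_sub_triangle pi0 pi_dom.
have cE : triangle n :\: PD_cone pi = core_region pi.
  apply/setP => v; rewrite in_setD; have [vt|vt] := boolP (v \in triangle n).
    by rewrite mem_PD_cone // negbK andbT.
  by rewrite andbF; apply/esym/negbTE; apply: contra vt; apply: (subsetP crt).
have -> : (F \in core pi) = (F \in PD pi) && (F \subset core_region pi).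
  by rewrite inE cE.
split=> [/andP[/mem_PD[_ Ff] Fcr] //|[Fcr Ff]].
by rewrite Fcr andbT; apply/mem_PD; split=> //; apply: subset_trans crt.
Qed.

(* The two apexes of the double cone stand for the origin and for the edge of
   the box [(1, 1)], both of which are compatible with everything. *)
Definition vertex_of (x : option (option (box n))) :
    option ('I_(nlabels pi) * 'I_(nlabels pi)) :=
  match x with
  | None => None
  | Some None => Some (box_edge (ord0, ord0))
  | Some (Some p) => Some (box_edge p)
  end.

Definition core_vertices : {set option (option (box n))} :=
  [set x | if x is Some (Some p) then p \in core_region pi else true].

Lemma core_sub_region : core_region pi \subset region pi.
Proof. exact: subsetUr. Qed.

Lemma origin_notin_core : (ord0, ord0) \notin core_region pi.
Proof.
by rewrite mem_core_region //=; apply/norP; split; apply/negP => /(dg_gt0 pi0)[].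
Qed.

Lemma vertex_of_inj : {in core_vertices &, injective vertex_of}.
Proof.
have inj := @box_edge_inj _ _ pi0 pi_dom; have O := origin_in_region.
have ne p : p \in core_region pi -> box_edge p <> box_edge (ord0, ord0).
  move=> pc E; have pO := inj p _ (subsetP core_sub_region p pc) O E.
  by have := origin_notin_core; rewrite -pO pc.
have cvE p : (Some (Some p) \in core_vertices) = (p \in core_region pi).
  by rewrite [LHS]in_set.
move=> [[p|]|] [[q|]|]; rewrite ?cvE => pc qc // /Some_inj E.
- by rewrite (inj p q (subsetP core_sub_region p pc) (subsetP core_sub_region q qc) E).
- by case: (ne p pc E).
- by case: (ne q qc (esym E)).
Qed.

Lemma mem_double_cone (S : {set option (option (box n))}) :
  S \in double_cone_core pi <-> [set p | Some (Some p) \in S] \in core pi.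
Proof.
rewrite /double_cone_core !mem_coning.
by have -> : [set v | Some v \in [set v0 | Some v0 \in S]] =
  [set p | Some (Some p) \in S] by apply/setP => p; rewrite !inE.
Qed.

End CoreComplex.

Lemma double_cone_realized (R : realFieldType) (n : nat) (pi : 'S_n.+1) :
    pi ord0 = ord0 -> dominant_tail pi ->
  geometric_realization (canonical_triangulation R (tree pi)) (double_cone_core pi).
Proof.
move=> pi0 pi_dom; have O := origin_in_region pi.
have coreR p : p \in core_region pi -> p \in region pi by apply: (subsetP (core_sub_region pi)).
apply: (@canonical_triangulation_realizes R _ _ _ _ (core_vertices pi)
  (vertex_of pi0 pi_dom)).
- exact: closure_exchange.
- exact: closure_connected.
- exact: vertex_of_inj.
- move=> S /mem_double_cone/(mem_core pi0 pi_dom)[/subsetP Sc _].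
  apply/subsetP => -[[p|]|] pS; rewrite in_set //.
  by apply: Sc; rewrite inE.
- move=> S /mem_double_cone/(mem_core pi0 pi_dom)[Sc Sf].
  have sub : edges (vertex_of pi0 pi_dom @: S) \subset
      box_edge pi0 pi_dom @: ((ord0, ord0) |: [set p | Some (Some p) \in S]).
    apply/subsetP => e; rewrite inE => /imsetP[[[p|]|] pS //= [->]].
      by apply: imset_f; rewrite in_setU1 inE pS orbT.
    by apply: imset_f; apply: setU11.
  have SR : [set p | Some (Some p) \in S] \subset region pi.
    exact: subset_trans Sc (core_sub_region pi).
  split; last first.
    exact: conflict_free_sub sub (boxes_free_edges SR Sf).
  rewrite (closureE pi0 pi_dom); apply: subset_trans sub _; apply: imsetS.
  by rewrite subUset sub1set O.
- move=> S' [S'E S'f].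
  pose S := [set x in core_vertices pi | vertex_of pi0 pi_dom x \in S'].
  have preS (p : box n) : p \in [set p | Some (Some p) \in S] ->
      p \in core_region pi /\ box_edge pi0 pi_dom p \in edges S'.
    by rewrite [p \in _]in_set [_ \in S]in_set [_ \in core_vertices pi]in_set =>
      /andP[pc pS]; rewrite [_ \in edges _]in_set.
  exists S.
    apply/mem_double_cone/(mem_core pi0 pi_dom); split.
      by apply/subsetP => p /preS[].
    move=> p q /preS[pc pe] /preS[qc qe].
    by rewrite -(conflict_boxes pi0 pi_dom) ?coreR //; apply: S'f.
  apply/setP => i; apply/idP/imsetP => [iS'|[x]]; last by rewrite inE => /andP[_ xS] ->.
  case: i iS' => [e|] iS'; last by exists None; rewrite // !in_set.
  have : e \in transitive_closure (tree pi) by apply: (subsetP S'E); rewrite inE.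
  rewrite (closureE pi0 pi_dom) => /imsetP[p].
  rewrite in_setU1 => /predU1P[->|pc] eE; rewrite eE in iS' *.
    by exists (Some None); rewrite // [_ \in S]in_set in_set.
  by exists (Some (Some p)); rewrite // [_ \in S]in_set in_set pc.
Qed.

Theorem theorem1p1 (R : realFieldType) (n : nat) (pi : 'S_n.+1)
    (pi_fixes_1 : pi ord0 = ord0) (pi'_dominant : dominant_tail pi) :
  regular_triangulation (root_points R (tree pi))
                        (canonical_triangulation R (tree pi)) /\
  geometric_realization (canonical_triangulation R (tree pi))
                        (double_cone_core pi).
Proof.
split; last exact: double_cone_realized.
apply: regular_canonical_triangulation; first exact: closure_exchange.
exact: closure_connected.
Qed.
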